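(* Let $\mathbb T^d_L$ be the $d$-dimensional torus of side length $L>0$, let $W\in C^2(\mathbb T^d_L)$ be even along every coordinate, and let $\beta_c>0$ be a discontinuous transition point of the McKean--Vlasov free energy $I$, so that at $\beta=\beta_c$ there exist at least two distinct minimisers of $I$ over $\mathcal P(\mathbb T^d_L)$, one being $\mu^L=L^{-d}dx$ and the other some $\bar\mu\in\mathcal P(\mathbb T^d_L)$. Then, at $\beta=\beta_c$, there exists $\mu^*\in\mathcal P(\mathbb T^d_L)$, distinct from $\mu^L$ and $\bar\mu$, such that $|\partial I|(\mu^* )=|dI|(\mu^* )=0$. Additionally $I(\mu^* )=c$ with $$c=\inf_{\gamma\in\Gamma}\ \sup_{t\in[0,1]}I(\gamma(t)),\qquad\Gamma=\{\gamma\in C([0,1];\mathcal P(\mathbb T^d_L)):\gamma(0)=\mu^L,\ \gamma(1)=\bar\mu\}.$$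
   Context: $\mathcal P(\mathbb T^d_L)$ is the set of Borel probability measures on the torus with the metric $W_2$, $W_2^2(\mu,\nu)=\inf_{\pi\in\Pi(\mu,\nu)}\int d_{\mathbb T^d_L}(x,y)^2\,d\pi(x,y)$, with $\Pi(\mu,\nu)$ the set of couplings; continuity of curves is with respect to $W_2$. ''Even along every coordinate'' means $W$ is invariant under $x_i\mapsto-x_i$ for each $i$. **Free energy** (for parameter $\beta>0$). $I(\mu)=\beta^{-1}\int\log\left(\frac{d\mu}{dx}\right)d\mu+\frac12\iint W(x-y)\,d\mu(y)\,d\mu(x)$ for $\mu\ll dx$, $I(\mu)=+\infty$ otherwise. $D(I)=\{I<+\infty\}$. **Transition point.** $\beta_c>0$ is a transition point if: (1) for $0<\beta<\beta_c$, $\mu^L$ is the unique minimiser of $I$; (2) for $\beta=\beta_c$, $\mu^L$ is a minimiser; (3) for $\beta>\beta_c$ there is a minimiser $\mu_\beta\ne\mu^L$. It is continuous if in addition $\mu^L$ is the unique minimiser at $\beta=\beta_c$ and, for any family of minimisers $\{\mu_\beta\}_{\beta>\beta_c}$, $\limsup_{\beta\downarrow\beta_c}\|\mu_\beta-\mu^L\|_{TV}=0$; otherwise it is discontinuous. (It is known that at a discontinuous transition point a minimiser $\bar\mu\ne\mu^L$ exists.) **Metric slope.** For $\mu\in D(I)$, $|\partial I|(\mu)=\limsup_{\nu\to\mu}\frac{(I(\mu)-I(\nu))_+}{W_2(\mu,\nu)}$ (and $+\infty$ outside $D(I)$). **Weak metric slope.** For a metric space $(X,d)$ and continuous $J:X\to\mathbb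 R$, $x$ is $\delta$-regular ($\delta>0$) if there are a neighbourhood $U$ of $x$, $\alpha>0$ and a continuous $\psi:U\times[0,\alpha]\to X$ with $d(\psi(u,t),u)\le t$ and $J(u)-J(\psi(u,t))\ge\delta t$ for all $(u,t)\in U\times[0,\alpha]$; $|dJ|(x)$ is the supremum of such $\delta$ ($0$ if none). For the l.s.c. functional $I$ on $X=\mathcal P(\mathbb T^d_L)$, let $\mathrm{epi}(I)=\{(u,\xi)\in X\times\mathbb R:I(u)\le\xi\}$ with metric $\sqrt{W_2(u,v)^2+|\xi-\zeta|^2}$ and $\mathcal G_I(u,\xi)=\xi$ on $\mathrm{epi}(I)$ (one has $|d\mathcal G_I|\le1$). For $x\in D(I)$, with $s=|d\mathcal G_I|(x,I(x))$, set $|dI|(x)=s/\sqrt{1-s^2}$ if $s<1$, and $+\infty$ if $s=1$. *)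

(* Defs.v *)
From HB Require Import structures.
From mathcomp Require Import all_boot all_order all_algebra.
From mathcomp Require Import generic_quotient ring_quotient lra.
From mathcomp Require Import all_classical all_reals all_analysis giry.

Set Implicit Arguments.
Unset Strict Implicit.
Unset Printing Implicit Defensive.

Import Order.TTheory GRing.Theory Num.Theory.
Import numFieldNormedType.Exports.

Local Open Scope classical_set_scope.
Local Open Scope ring_scope.
Local Open Scope quotient_scope.
Local Open Scope charge_scope.

Section lattice.
Context {R : realType} (L : {posnum R}) (d : nat).

Definition lattice : {pred 'rV[R]_d} :=
  fun x => [forall i, (x ord0 i / L%:num) \is a Num.int].

Lemma lattice_closed : zmod_closed lattice.
Proof.
split; first by apply/forallP => i; rewrite mxE mul0r rpred0.
move=> x y /forallP hx /forallP hy; apply/forallP => i.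
by rewrite !mxE mulrBl rpredB.
Qed.

HB.instance Definition _ := GRing.isZmodClosed.Build _ lattice lattice_closed.

End lattice.

Definition torus {R : realType} (L : {posnum R}) (d : nat) : Type :=
  quotient_topology (Quotient.quot (@lattice R L d)).

Section torus.
Context {R : realType} (L : {posnum R}) (d : nat).
Local Notation T := (torus L d).

HB.instance Definition _ := PointedTopological.on T.
HB.instance Definition _ := Quotient.on T.
HB.instance Definition _ :=
  GRing.Zmodule.copy T (Quotient.quot (@lattice R L d)).
(* The Borel sigma-algebra of the quotient topology. *)
HB.instance Definition _ := Measurable.copy T (g_sigma_algebraType (@open T)).

Definition to_torus (x : 'rV[R]_d) : T := \pi_T x.

Definition enorm (x : 'rV[R]_d) : R := Num.sqrt (\sum_i x ord0 i ^+ 2).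

(* The quotient (flat) distance: the least Euclidean norm among the
   representatives of x - y. *)
Definition torus_dist (x y : T) : R :=
  inf [set enorm z | z in [set z | to_torus z = x - y]].

End torus.

Section finite_instances.
Local Open Scope ereal_scope.
Context d1 d2 (T1 : measurableType d1) (T2 : measurableType d2) (R : realType).

Section pushforward.
Variable m : {finite_measure set T1 -> \bar R}.

(* pushforward keeping track of the measurability proof, so that the measure
   structures can be inferred. *)
Definition fpushforward (f : T1 -> T2) (mf : measurable_fun [set: T1] f) :
  set T2 -> \bar R := pushforward m f.

Variables (f : T1 -> T2) (mf : measurable_fun [set: T1] f).

Let fpushforward0 : fpushforward mf set0 = 0.
Proof. by rewrite /fpushforward /pushforward preimage_set0 measure0. Qed.

Let fpushforward_ge0 A : 0 <= fpushforward mf A.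
Proof. exact: measure_ge0. Qed.

Let fpushforward_sigma_additive : semi_sigma_additive (fpushforward mf).
Proof.
have pE : measurable_fun [set: T1] f by [].
exact: (@measure_semi_sigma_additive _ _ _
  (measure_function_pushforward__canonical__measure_function_Measure m pE)).
Qed.

HB.instance Definition _ := isMeasure.Build _ _ _ (fpushforward mf)
  fpushforward0 fpushforward_ge0 fpushforward_sigma_additive.

Let fpushforward_fin : fin_num_fun (fpushforward mf).
Proof.
move=> A mA; apply: fin_num_measure.
by rewrite -[X in measurable X]setTI; exact: mf.
Qed.

HB.instance Definition _ :=
  Measure_isFinite.Build _ _ _ (fpushforward mf) fpushforward_fin.

End pushforward.

Section product.
Variables (m1 : {finite_measure set T1 -> \bar R})
          (m2 : {finite_measure set T2 -> \bar R}).

(* The product measure at argument types from which finiteness is inferred. *)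
Definition fproduct : set (T1 * T2) -> \bar R := m1 \x m2.

HB.instance Definition _ := Measure.on fproduct.

Let fproduct_fin : fin_num_fun fproduct.
Proof.
apply: lty_fin_num_fun => /=; rewrite /fproduct -setXTT product_measure1E//.
by rewrite ltey_eq fin_numM// fin_num_measure.
Qed.

HB.instance Definition _ := Measure_isFinite.Build _ _ _ fproduct fproduct_fin.

End product.
End finite_instances.

Section cube_measure.
Context {R : realType} (L : {posnum R}).
Local Notation mR := (measurableTypeR R).

Definition side_measure :=
  mrestr (@lebesgue_measure R) (measurable_itv `[0, L%:num]).

HB.instance Definition _ := Measure.on side_measure.

Lemma side_measureT : side_measure setT = L%:num%:E.
Proof.
rewrite /side_measure /mrestr setTI.
by rewrite lebesgue_measure_itv /= lte_fin gt0 oppr0 adde0.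
Qed.

Let side_measure_fin : fin_num_fun side_measure.
Proof. by apply: lty_fin_num_fun => /=; rewrite side_measureT ltry. Qed.

HB.instance Definition _ :=
  @Measure_isFinite.Build _ _ _ side_measure side_measure_fin.

Definition cons_pair n (p : mR * n.-tuple mR) : n.+1.-tuple mR :=
  cons_tuple p.1 p.2.

Lemma measurable_cons_pair n : measurable_fun setT (@cons_pair n).
Proof.
have := @measurable_cons _ _ (mR * n.-tuple mR)%type mR fst n snd
  measurable_fst measurable_snd.
by apply: eq_measurable_fun => x _; exact/val_inj.
Qed.

(* Lebesgue measure on [0, L]^n, as an iterated product measure. *)
Fixpoint cube_measure n : {finite_measure set (n.-tuple mR) -> \bar R} :=
  match n with
  | 0 => dirac [tuple]
  | n.+1 => fpushforward (fproduct side_measure (cube_measure n))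
                         (@measurable_cons_pair n)
  end.

Lemma cube_measureT n : cube_measure n setT = (L%:num ^+ n)%:E.
Proof.
elim: n => [|n ih]; first by rewrite /= diracT expr0.
rewrite /= /fpushforward /pushforward preimage_setT /fproduct -setXTT.
by rewrite product_measure1E//= side_measureT ih exprS EFinM.
Qed.

End cube_measure.

Section volume.
Context {R : realType} (L : {posnum R}) (d : nat).
Local Notation mR := (measurableTypeR R).

Definition torus_of_tuple (t : d.-tuple mR) : torus L d :=
  to_torus L (\row_i (tnth t i : R)).

Lemma measurable_torus_of_tuple : measurable_fun [set: d.-tuple mR] torus_of_tuple.
Proof.
apply: (@measurability _ _ _ (torus L d) _ _ (@open (torus L d))) => //.
move=> _ [U oU <-]; rewrite setTI.
pose f (t : d.-tuple mR) : 'rV[R]_d := \row_i (tnth t i : R).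
pose V : set 'rV[R]_d := @to_torus R L d @^-1` U.
have oV : open V := oU.
pose B (p : 'rV[rat]_d * rat) : set (d.-tuple mR) :=
  [set t | forall i, `|tnth t i - ratr (p.1 ord0 i)| < ratr p.2 :> R].
have mB p : measurable (B p).
  rewrite (_ : B p = \bigcap_(i in [set: 'I_d]) [set t | `|tnth t i - ratr (p.1 ord0 i)| < ratr p.2 :> R]); last first.
    by apply/seteqP; split => [t Bt i _|t Bt i]; [exact: Bt|exact: (Bt i I)].
  apply: fin_bigcap_measurable => // i _.
  have mt := @measurable_tnth _ mR d i.
  have mI : measurable
      `]ratr (p.1 ord0 i) - ratr p.2 : R, ratr (p.1 ord0 i) + ratr p.2[.
    exact: measurable_itv.
  have := mt measurableT _ mI; rewrite setTI; congr (measurable _).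
  by apply/seteqP; split => t; rewrite /= in_itv /= ltr_distl.
rewrite (_ : _ @^-1` U = \bigcup_(p in [set p | B p `<=` f @^-1` V]) B p).
  rewrite bigcup_mkcond; apply: countable_bigcupT_measurable.
    exact: countableP.
  by move=> p; case: ifP.
apply/seteqP; split => [t Ut|t [p +]]; last exact.
have /nbhs_ballP[e /= e0 eV] : nbhs (f t) V by exact: open_nbhs_nbhs.
have e40 : e / 4 < e / 2 by lra.
have [r /andP[r1 r2]] : exists r : rat, e / 4 < ratr r < e / 2.
  by have [r] := rat_in_itvoo e40; rewrite in_itv /=; exists r.
have r0 : 0 < ratr r :> R by lra.
have /choice[q qP] (i : 'I_d) : exists q : rat, `|tnth t i - ratr q| < ratr r :> R.
  have : tnth t i - ratr r < tnth t i + ratr r :> R by lra.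
  move=> /rat_in_itvoo[q]; rewrite in_itv /= => qt; exists q.
  by rewrite ltr_distlC; lra.
exists (\row_i q i, r); last by move=> i; rewrite mxE.
move=> s Bs /=; apply: eV; split => // i j.
have := Bs j; have := qP j; rewrite /f !mxE /ball /= => h1 h2.
rewrite (le_lt_trans (ler_distD (ratr (q j)) _ _))//.
by rewrite [X in _ + X]distrC; lra.
Qed.

(* The measure dx on the torus: the image of Lebesgue measure on the cube
   [0, L]^d, whose upper faces are negligible. *)
Definition volume : {finite_measure set (torus L d) -> \bar R} :=
  fpushforward (cube_measure L d) measurable_torus_of_tuple.

Definition uniform_measure : set (torus L d) -> \bar R :=
  mscale ((L%:num ^+ d)^-1)%:nng volume.

HB.instance Definition _ := Measure.on uniform_measure.

Let uniform_measureT : uniform_measure setT = 1%E.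
Proof.
rewrite /uniform_measure /mscale /= /fpushforward /pushforward preimage_setT.
by rewrite cube_measureT -EFinM mulVf.
Qed.

HB.instance Definition _ :=
  Measure_isProbability.Build _ _ _ uniform_measure uniform_measureT.

End volume.

Arguments uniform_measure {R} L d A.

(* Elements of [probability T R] are functions on all subsets, including
   non-measurable ones, so equality of probability measures is the library's
   relation [mu ≡μ nu] (agreement on the sigma-algebra) and not [mu = nu]. *)

Section distances.
Context {R : realType} (L : {posnum R}) (d : nat).
Local Notation T := (torus L d).
Local Notation P := (probability T R).
Implicit Types mu nu : P.

Definition coupling mu nu : set (probability (T * T)%type R) :=
  [set pi | (forall A, measurable A -> pi (A `*` setT) = mu A) /\
            (forall B, measurable B -> pi (setT `*` B) = nu B)].

(* The infimum is finite, as couplings exist and the torus is bounded. *)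
Definition W2 mu nu : R :=
  Num.sqrt (fine (ereal_inf
    [set (\int[pi]_z (torus_dist z.1 z.2 ^+ 2)%:E)%E | pi in coupling mu nu])).

Definition TV mu nu : \bar R :=
  ereal_sup [set `|mu A - nu A|%E | A in measurable].

End distances.

Section metric.
Context {R : realType} {X : Type} (dist : X -> X -> R).

Definition punctured_nbhs (x : X) : set_system X :=
  filter_from [set r : R | 0 < r] (fun r => [set y | 0 < dist x y < r]).

(* limsup_(y -> x, y <> x); this is what [limf_esup] unfolds to, but here X
   carries no canonical topology. *)
Definition punctured_limsup (f : X -> \bar R) (x : X) : \bar R :=
  ereal_inf [set ereal_sup (f @` V) | V in punctured_nbhs x].

Definition metric_slope (J : X -> \bar R) (x : X) : \bar R :=
  if (J x < +oo)%E then
    punctured_limsup (fun y => maxe (J x - J y) 0 * ((dist x y)^-1)%:E)%E x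
  else +oo%E.

Definition continuous_curve (gamma : R -> X) :=
  forall t, 0 <= t <= 1 -> forall e, 0 < e -> exists2 r, 0 < r &
    forall s, 0 <= s <= 1 -> `|t - s| < r -> dist (gamma t) (gamma s) < e.

Definition continuous_deformation (U : set X) (alpha : R) (psi : X -> R -> X) :=
  forall u t, U u -> 0 <= t <= alpha -> forall e, 0 < e -> exists2 r, 0 < r &
    forall v s, U v -> 0 <= s <= alpha -> dist u v < r -> `|t - s| < r ->
      dist (psi u t) (psi v s) < e.

Definition regular_point (J : X -> R) (x : X) (delta : R) :=
  0 < delta /\ exists (U : set X) (alpha : R) (psi : X -> R -> X),
    [/\ exists2 r, 0 < r & [set u | dist x u < r] `<=` U,
        0 < alpha,
        continuous_deformation U alpha psi &
        forall u t, U u -> 0 <= t <= alpha ->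
          dist (psi u t) u <= t /\ delta * t <= J u - J (psi u t)].

(* Weak slope of a continuous function; adjoining 0 makes the supremum 0 when
   x is not regular. *)
Definition weak_slope_continuous (J : X -> R) (x : X) : \bar R :=
  ereal_sup (0%E |` [set delta%:E | delta in regular_point J x]).

End metric.

Section weak_slope.
Context {R : realType} {X : Type} (dist : X -> X -> R) (J : X -> \bar R).

Definition epi : Type := {p : X * R | (J p.1 <= p.2%:E)%E}.

Definition epi_dist (p q : epi) : R :=
  Num.sqrt (dist (sval p).1 (sval q).1 ^+ 2 +
            `|(sval p).2 - (sval q).2| ^+ 2).

Definition epi_height (p : epi) : R := (sval p).2.

Lemma le_fine_dom x : (J x < +oo)%E -> (J x <= (fine (J x))%:E)%E.
Proof. by case: (J x) => [r| |] //= _; exact: leNye. Qed.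

Definition epi_graph x (Jx : (J x < +oo)%E) : epi :=
  exist _ (x, fine (J x)) (le_fine_dom Jx).

(* Outside the domain of J the slope is +oo. *)
Definition weak_slope (x : X) : \bar R :=
  match pselect (J x < +oo)%E with
  | left Jx =>
      let s := weak_slope_continuous epi_dist epi_height (epi_graph Jx) in
      if (s < 1)%E then (fine s / Num.sqrt (1 - fine s ^+ 2))%:E else +oo%E
  | right _ => +oo%E
  end.

End weak_slope.

Section potential.
Context {R : realType} (L : {posnum R}) (d : nat).

Fixpoint Ck (k : nat) (f : 'rV[R]_d -> R) : Prop :=
  continuous f /\
  if k is k'.+1 then
    forall i, (forall x, derivable f x (delta_mx ord0 i)) /\
              Ck k' (fun x => 'D_(delta_mx ord0 i) f x)
  else True.

Definition torus_Ck (k : nat) (W : torus L d -> R) : Prop :=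
  Ck k (W \o @to_torus R L d).

Definition flip (i : 'I_d) (x : 'rV[R]_d) : 'rV[R]_d :=
  \row_j (if j == i then - x ord0 j else x ord0 j).

Definition even_along_coordinates (W : torus L d -> R) : Prop :=
  forall i x, W (to_torus L (flip i x)) = W (to_torus L x).

End potential.

Section free_energy.
Context {R : realType} (L : {posnum R}) (d : nat) (W : torus L d -> R).
Local Notation P := (probability (torus L d) R).
Local Notation muL := (uniform_measure L d : P).
Implicit Types (beta : R) (mu nu : P).

Definition free_energy beta mu : \bar R :=
  (if `[< mu `<< volume L d >] then
     (beta^-1)%:E *
       \int[mu]_x (ln (fine
         ('d (charge_of_finite_measure mu) '/d (volume L d) x)))%:E
     + (2^-1)%:E * \int[mu]_x \int[mu]_y (W (x - y))%:E
   else +oo)%E.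

Definition minimiser beta mu : Prop :=
  forall nu, (free_energy beta mu <= free_energy beta nu)%E.

Definition unique_minimiser beta mu : Prop :=
  minimiser beta mu /\ forall nu, minimiser beta nu -> nu ≡μ mu.

Definition transition_point betac : Prop :=
  [/\ 0 < betac,
      forall beta, 0 < beta < betac -> unique_minimiser beta muL,
      minimiser betac muL &
      forall beta, betac < beta ->
        exists mu, minimiser beta mu /\ ~ (mu ≡μ muL)].

Definition continuous_transition_point betac : Prop :=
  [/\ transition_point betac,
      unique_minimiser betac muL &
      forall mu_ : R -> P,
        (forall beta, betac < beta -> minimiser beta (mu_ beta)) ->
        limf_esup (fun beta => TV (mu_ beta) muL) betac^'+ = 0%E].

Definition discontinuous_transition_point betac : Prop :=
  transition_point betac /\ ~ continuous_transition_point betac.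

Definition paths mu nu : set (R -> P) :=
  [set gamma | [/\ continuous_curve (@W2 R L d) gamma,
                   gamma 0 ≡μ mu & gamma 1 ≡μ nu]].

Definition minimax_level (J : P -> \bar R) mu nu : \bar R :=
  ereal_inf [set ereal_sup [set J (gamma t) | t in `[0, 1]]
            | gamma in paths mu nu].

End free_energy.

(* Main.v *)
Require Import Defs.
From HB Require Import structures.
From mathcomp Require Import all_boot all_order all_algebra generic_quotient ring_quotient lra ring.
From mathcomp Require Import all_classical all_reals all_analysis measurable_realfun giry.
Set Implicit Arguments.
Unset Strict Implicit.
Unset Printing Implicit Defensive.

Import Order.TTheory GRing.Theory Num.Theory.
Import numFieldNormedType.Exports.
Local Open Scope classical_set_scope.
Local Open Scope ring_scope.
Local Open Scope charge_scope.
Local Open Scope quotient_scope.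

(** A measure is critical when its density is the Gibbs density of its own potential,
    $\rho=e^{-\beta W*\rho}/Z$ ([critical]). The relative entropy [KL f (conv f)] of $f$ with
    respect to the Gibbs density of $W*f$ measures the failure of this, and two facts about it carry
    the proof without any differential structure on the space of measures.

    Descent ([relax_decrease]): mixing $f$ with the Gibbs density of $W*f$, with a fixed small
    weight, lowers the free energy by a multiple of [KL f (conv f)]. Indeed entropy is convex, and
    Pinsker's inequality bounds the second-order interaction term by the same relative entropy. This
    relaxation makes sense for every probability measure, keeps curves $W_2$-continuous
    ([relaxed_curve]) and fixes minimisers ([minimiser_relaxed]), so it maps $\Gamma$ to itself.

    Compactness ([palais_smale]): if the free energies of $f_n$ tend to $c$ and the relative
    entropies tend to $0$, the bounded equicontinuous potentials $W*f_n$ have a uniform cluster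
    point. Pinsker's inequality turns this into $L^1$ clustering of the $f_n$, and the limit is
    critical at level $c$.

    For the critical measure ([mountain_pass]), take a path whose free energy stays below $c+1/n$.
    Its relaxation lies in $\Gamma$, hence somewhere exceeds $c-1/n$; at that parameter the descent
    was small, so the relative entropy is $O(1/n)$ and compactness applies. If $c$ is above the
    minimum, the limit is automatically not a minimiser. If $c$ is the minimum, all points of the
    path are almost minimisers; one picks the point whose potential at a place $x_0$ separating the
    two minimisers is the midpoint of their values there. The limit keeps this value and so differs
    from both.

    Descent from $\mu^*$ is thus at most quadratic in the distance, and both slopes vanish.

    A second minimiser exists ([exists_nontrivial_minimiser]) because otherwise the same
    compactness, applied to minimisers as $\beta\downarrow\beta_c$, would make the transition
    continuous. *)

(** * Real-valued integrals against a finite measure *)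

Section integration.
Context {dT : measure_display} {T : measurableType dT} {R : realType}.
Implicit Types (m : {finite_measure set T -> \bar R}) (f g h : T -> R).

Definition bounded_by h (M : R) := forall x, `|h x| <= M.

Lemma boundedW h M : bounded_by h M -> [bounded h x | x in [set: T]].
Proof.
move=> hM; exists M; split; first exact: num_real.
by move=> x Mx y _; exact: le_trans (hM y) (ltW Mx).
Qed.

Lemma int_bounded m h M : measurable_fun setT h -> bounded_by h M ->
  m.-integrable setT (EFin \o h).
Proof.
move=> mh hM; apply: measurable_bounded_integrable => //.
- by rewrite -ge0_fin_numE// fin_num_measure.
- exact: boundedW hM.
Qed.

Lemma int_meas (m : {measure set T -> \bar R}) f :
  m.-integrable setT (EFin \o f) -> measurable_fun setT f.
Proof. by move=> /measurable_int/measurable_EFinP. Qed.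

Lemma intD m f g : m.-integrable setT (EFin \o f) ->
  m.-integrable setT (EFin \o g) ->
  m.-integrable setT (EFin \o (fun x => f x + g x)).
Proof.
move=> fi gi.
by have := integrableD measurableT fi gi; apply: eq_integrable.
Qed.

Lemma intZ m (c : R) f : m.-integrable setT (EFin \o f) ->
  m.-integrable setT (EFin \o (fun x => c * f x)).
Proof.
move=> fi; have := integrableZl measurableT c fi.
by apply: eq_integrable.
Qed.

Lemma intB m f g : m.-integrable setT (EFin \o f) ->
  m.-integrable setT (EFin \o g) ->
  m.-integrable setT (EFin \o (fun x => f x - g x)).
Proof.
move=> fi gi; have := integrableB measurableT fi gi.
by apply: eq_integrable.
Qed.

Lemma int_abs m f : m.-integrable setT (EFin \o f) ->
  m.-integrable setT (EFin \o (fun x => `|f x|)).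
Proof.
move=> /integrable_abse; by apply: eq_integrable.
Qed.

Lemma intM m f h M : measurable_fun setT h -> bounded_by h M ->
  m.-integrable setT (EFin \o f) ->
  m.-integrable setT (EFin \o (fun x => h x * f x)).
Proof.
move=> mh hM fi; have := integrableMr measurableT mh (boundedW hM) fi.
by apply: eq_integrable.
Qed.

Lemma int_le m f g : measurable_fun setT f -> (forall x, `|f x| <= g x) ->
  m.-integrable setT (EFin \o g) -> m.-integrable setT (EFin \o f).
Proof.
move=> mf fg; apply: le_integrable => //; first exact/measurable_EFinP.
by move=> x _ /=; rewrite lee_fin (le_trans (fg x))// ler_norm.
Qed.

Lemma EFin_Rint m f : m.-integrable setT (EFin \o f) ->
  (\int[m]_x (f x)%:E)%E = (\int[m]_x f x)%:E.
Proof. by move=> fi; rewrite /Rintegral fineK// integrable_fin_num. Qed.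

Lemma RintD m f g : m.-integrable setT (EFin \o f) ->
  m.-integrable setT (EFin \o g) ->
  \int[m]_x (f x + g x) = \int[m]_x f x + \int[m]_x g x.
Proof. by move=> fi gi; rewrite RintegralD. Qed.

Lemma RintB m f g : m.-integrable setT (EFin \o f) ->
  m.-integrable setT (EFin \o g) ->
  \int[m]_x (f x - g x) = \int[m]_x f x - \int[m]_x g x.
Proof. by move=> fi gi; rewrite RintegralB. Qed.

Lemma RintZ m (c : R) f : m.-integrable setT (EFin \o f) ->
  \int[m]_x (c * f x) = c * \int[m]_x f x.
Proof. by move=> fi; rewrite RintegralZl. Qed.

Lemma Rint_le m f g : m.-integrable setT (EFin \o f) ->
  m.-integrable setT (EFin \o g) -> (forall x, f x <= g x) ->
  \int[m]_x f x <= \int[m]_x g x.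
Proof. by move=> fi gi fg; apply: le_Rintegral. Qed.

Lemma Rint_norm m f : m.-integrable setT (EFin \o f) ->
  `|\int[m]_x f x| <= \int[m]_x `|f x|.
Proof. exact: le_normr_Rintegral. Qed.

Lemma eq_Rint m f g : f =1 g -> \int[m]_x f x = \int[m]_x g x.
Proof. by move=> fg; apply: eq_Rintegral => x _. Qed.

(* The product of a bounded function and an integrable one. *)
Lemma RintM_le m f h M : measurable_fun setT h -> bounded_by h M ->
  m.-integrable setT (EFin \o f) ->
  `|\int[m]_x (h x * f x)| <= M * \int[m]_x `|f x|.
Proof.
move=> mh hM fi; have hfi := intM mh hM fi.
apply: le_trans (Rint_norm hfi) _; rewrite -RintZ; last exact: int_abs.
apply: Rint_le; [exact: int_abs|exact/intZ/int_abs|].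
by move=> x; rewrite normrM ler_wpM2r.
Qed.

End integration.

(** * Probability measures and their mixtures *)

Section probabilities.
Context {dT : measure_display} {T : measurableType dT} {R : realType}.
Implicit Types (p q : probability T R).

Lemma Rint_prob_cst p (c : R) : \int[p]_x c = c.
Proof. by rewrite Rintegral_cst// [X in fine X]probability_setT mulr1. Qed.

Lemma Rint_prob_bounded p (h : T -> R) M : measurable_fun setT h ->
  bounded_by h M -> `|\int[p]_x h x| <= M.
Proof.
move=> mh hM; have hi := int_bounded p mh hM.
apply: le_trans (Rint_norm hi) _; rewrite -[leRHS](Rint_prob_cst p).
apply: Rint_le => //; first exact: int_abs.
by apply: (@int_bounded _ _ _ _ _ `|M|) => // x.
Qed.

Lemma probability_of_measure (m : {measure set T -> \bar R}) :
  m setT = 1%E -> exists p, (p : set T -> \bar R) = m.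
Proof.
case: m => m mc /= m1; pose M : {measure set T -> \bar R} := Measure.Pack mc.
pose mP := Measure_isProbability.Build _ _ _ (M : set T -> \bar R) m1.
by exists (HB.pack_for (probability T R) m mc mP).
Qed.

(** Three components suffice for the transport plans used later: a given plan, a diagonal plan that
    moves nothing, and a product plan for the remaining mass. *)
Lemma mixture3_exists p1 p2 p3 (a1 a2 a3 : R) :
  0 <= a1 -> 0 <= a2 -> 0 <= a3 -> a1 + a2 + a3 = 1 ->
  exists q : probability T R,
    (forall A, q A = (a1%:E * p1 A + a2%:E * p2 A + a3%:E * p3 A)%E) /\
    (forall h : T -> \bar R, measurable_fun setT h -> (forall x, 0 <= h x)%E ->
      (\int[q]_x h x = a1%:E * \int[p1]_x h x + a2%:E * \int[p2]_x h x +
                       a3%:E * \int[p3]_x h x)%E).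
Proof.
move=> a10 a20 a30 a1E.
pose m := measure_add (measure_add (mscale (NngNum a10) p1)
   (mscale (NngNum a20) p2)) (mscale (NngNum a30) p3).
have mE A : m A = (a1%:E * p1 A + a2%:E * p2 A + a3%:E * p3 A)%E.
  by rewrite /m measure_addE; congr (_ + _)%E; exact: measure_addE.
have m1 : m setT = 1%E.
  by rewrite mE !probability_setT !mule1 -!EFinD a1E.
have [q qm] := probability_of_measure m1.
exists q; split => [A|h mh h0]; first by rewrite qm; exact: mE.
have -> : (\int[q]_x h x = \int[m]_x h x)%E.
  by apply: eq_measure_integral => A _ _; exact: (congr1 (@^~ A) qm).
rewrite ge0_integral_measure_add// ge0_integral_measure_add//.
by rewrite !ge0_integral_mscale.
Qed.

End probabilities.

(** * Measures given by a density *)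

Section density.
Context {dT : measure_display} {T : measurableType dT} {R : realType}.
Variable vol : {finite_measure set T -> \bar R}.
Implicit Types (f g : T -> R) (mu : probability T R).

Definition density f :=
  [/\ measurable_fun setT f, forall x, 0 <= f x & (\int[vol]_x (f x)%:E = 1)%E].

Definition has_density mu f :=
  density f /\
  forall A, measurable A -> (mu A = \int[vol]_(x in A) (f x)%:E)%E.

Lemma density_int f : density f -> vol.-integrable setT (EFin \o f).
Proof.
move=> [mf f0 f1]; apply/integrableP; split; first exact/measurable_EFinP.
under eq_integral do rewrite /= ger0_norm//.
by rewrite f1 ltry.
Qed.

Lemma density_Rint f : density f -> \int[vol]_x f x = 1.
Proof. by move=> [mf f0 f1]; rewrite /Rintegral f1. Qed.

Lemma density_norm f : density f -> \int[vol]_x `|f x| = 1.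
Proof.
move=> fd; rewrite -(density_Rint fd); apply: eq_Rint => x.
by case: fd => _ f0 _; rewrite ger0_norm.
Qed.

Lemma densityP f : vol.-integrable setT (EFin \o f) -> (forall x, 0 <= f x) ->
  \int[vol]_x f x = 1 -> density f.
Proof.
move=> fi f0 f1; split => //; first exact: int_meas fi.
by rewrite EFin_Rint// f1.
Qed.

Lemma density_probability f : density f -> exists mu, has_density mu f.
Proof.
move=> fd; have [mf f0 f1] := fd.
have mEf : measurable_fun setT (EFin \o f) by exact/measurable_EFinP.
pose m A := (\int[vol]_(x in A) (f x)%:E)%E.
have m0 : m set0 = 0%E by rewrite /m integral_set0.
have m_ge0 A : (0 <= m A)%E.
  by apply: integral_ge0 => x _; rewrite lee_fin.
have msa : semi_sigma_additive m.
  by apply: semi_sigma_additive_nng_induced => // x; rewrite lee_fin.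
pose mM := isMeasure.Build _ _ _ m m0 m_ge0 msa.
pose M : {measure set T -> \bar R} := HB.pack m mM.
have [p pM] := @probability_of_measure _ _ _ M f1.
by exists p; split => // A _; rewrite pM.
Qed.

Lemma has_density_dominates mu f : has_density mu f -> mu `<< vol.
Proof.
move=> [[mf f0 f1] mufE]; apply/null_content_dominatesP => A mA A0.
rewrite mufE//; apply: null_set_integral => //.
exact/measurable_EFinP/measurable_funTS.
Qed.

(** Both functions are integrable and integrate to [mu A] over every measurable [A]. The derivative
    appearing in the free energy is exchanged for a concrete density through this. *)
Lemma has_density_RN mu f : has_density mu f ->
  ae_eq vol setT ('d (charge_of_finite_measure mu) '/d vol) (EFin \o f).
Proof.
move=> muf; have muvol := has_density_dominates muf.
case: muf => fd mufE; have [mf f0 f1] := fd.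
apply: integral_ae_eq => //.
- exact: Radon_Nikodym_integrable.
- exact/measurable_EFinP.
- move=> A _ mA; rewrite -Radon_Nikodym_integral//.
  by rewrite -mufE.
Qed.

Lemma ge0_has_density_integral mu f (h : T -> \bar R) : has_density mu f ->
  measurable_fun setT h -> (forall x, 0 <= h x)%E ->
  (\int[mu]_x h x = \int[vol]_x (h x * (f x)%:E))%E.
Proof.
move=> muf mh h0; have muvol := has_density_dominates muf.
have RNf := has_density_RN muf; case: muf => [[mf f0 f1] mufE].
rewrite -(Radon_Nikodym_SigmaFinite.change_of_variables muvol)//.
apply: ae_eq_integral => //.
- apply: emeasurable_funM => //.
  exact: measurable_int (Radon_Nikodym_SigmaFinite.f_integrable _).
- by apply: emeasurable_funM => //; exact/measurable_EFinP.
- apply: ae_eqe_mul2l; apply: ae_eq_trans RNf.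
  exact: ae_eq_Radon_Nikodym_SigmaFinite.
Qed.

(** Multiplication by [f >= 0] commutes with taking positive and negative parts. Integrability of
    [h] is not assumed, so logarithms of densities with infinite entropy are covered. *)
Lemma has_density_integral mu f (h : T -> \bar R) : has_density mu f ->
  measurable_fun setT h ->
  (\int[mu]_x h x = \int[vol]_x (h x * (f x)%:E))%E.
Proof.
move=> muf mh; have [[_ f0 _] _] := muf.
rewrite integralE (ge0_has_density_integral muf); [|exact: measurable_funepos|by[]].
rewrite (ge0_has_density_integral muf); [|exact: measurable_funeneg|by[]].
rewrite [RHS]integralE; congr (_ - _)%E; apply: eq_integral => x _.
- by rewrite !funeposE maxe_pMl ?lee_fin// mul0e.
- by rewrite !funenegE maxe_pMl ?lee_fin// mul0e mulNe.
Qed.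

End density.

(** * Pointwise inequalities for $r\ln r$ *)

Section xlnx.
Context {R : realType}.
Implicit Types (f g a t : R).

Definition xlnx (r : R) : R := r * ln r.

Lemma ln_le_subr1 (x : R) : 0 < x -> ln x <= x - 1.
Proof.
move=> x0; have := @le_ln1Dx R (x - 1).
by rewrite (_ : 1 + (x - 1) = x); [apply; lra|ring].
Qed.

(* With [p = sqrt f] and [q = sqrt g], this is [ln (q / p) <= q / p - 1]. *)
Lemma relative_entropy_ge f g : 0 <= f -> 0 < g ->
  (Num.sqrt f - Num.sqrt g) ^+ 2 <= xlnx f - f * ln g - f + g.
Proof.
move=> f0 g0; rewrite /xlnx.
have q0 : 0 < Num.sqrt g by rewrite sqrtr_gt0.
have qE : Num.sqrt g ^+ 2 = g by rewrite sqr_sqrtr// ltW.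
have [->|fn0] := eqVneq f 0.
  by rewrite !mul0r sqrtr0 sub0r sqrrN qE subr0 sub0r oppr0 add0r.
have {fn0} f0' : 0 < f by rewrite lt_neqAle eq_sym fn0.
have p0 : 0 < Num.sqrt f by rewrite sqrtr_gt0.
have pE : Num.sqrt f ^+ 2 = f by rewrite sqr_sqrtr// ltW.
set p := Num.sqrt f in p0 pE *; set q := Num.sqrt g in q0 qE *.
have lnqp : ln q - ln p <= q / p - 1.
  by rewrite -ln_div ?posrE//; apply: ln_le_subr1; rewrite divr_gt0.
have -> : ln f = ln p *+ 2 by rewrite -pE lnXn.
have -> : ln g = ln q *+ 2 by rewrite -qE lnXn.
have h : p ^+ 2 * (ln q - ln p) <= p * q - p ^+ 2.
  rewrite (_ : p * q - p ^+ 2 = p ^+ 2 * (q / p - 1)); last first.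
    by field; rewrite gt_eqF.
  by rewrite ler_wpM2l// exprn_ge0// ltW.
rewrite -pE -qE; nra.
Qed.

Lemma relative_entropy_ge0 f g : 0 <= f -> 0 < g ->
  0 <= xlnx f - f * ln g - f + g.
Proof. by move=> f0 g0; apply: le_trans (relative_entropy_ge f0 g0); exact: sqr_ge0. Qed.

(** Factor $f-g=(\sqrt f-\sqrt g)(\sqrt f+\sqrt g)$, apply Young's inequality with weight [a], and
    use $(\sqrt f+\sqrt g)^2\le 2(f+g)$. Leaving [a] free allows it to be tuned after
    integration. *)
Lemma pinsker_pointwise f g a : 0 <= f -> 0 < g -> 0 < a ->
  `|f - g| <= (2 * a)^-1 * (xlnx f - f * ln g - f + g) + a * (f + g).
Proof.
move=> f0 g0 a0.
have a20 : 0 < (2 * a)^-1 by rewrite invr_gt0; lra.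
apply: (@le_trans _ _ ((2 * a)^-1 * (Num.sqrt f - Num.sqrt g) ^+ 2 + a * (f + g))); last first.
  by rewrite lerD2r ler_wpM2l// ?(ltW a20)// relative_entropy_ge.
have q0 := sqrtr_ge0 g; have p0 := sqrtr_ge0 f.
have qE : Num.sqrt g ^+ 2 = g by rewrite sqr_sqrtr// ltW.
have pE : Num.sqrt f ^+ 2 = f by rewrite sqr_sqrtr// ltW.
set p := Num.sqrt f in p0 pE *; set q := Num.sqrt g in q0 qE *.
have -> : f - g = (p - q) * (p + q) by rewrite -pE -qE; ring.
rewrite normrM (ger0_norm (addr_ge0 p0 q0)).
have -> : (p - q) ^+ 2 = `|p - q| ^+ 2 by rewrite real_normK// num_real.
set u := `|p - q|.
have h1 : (p + q) ^+ 2 <= 2 * (f + g).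
  by rewrite -pE -qE -subr_ge0 (_ : _ - _ = (p - q) ^+ 2) ?sqr_ge0//; ring.
have : 0 <= (2 * a)^-1 * (u - a * (p + q)) ^+ 2.
  by rewrite mulr_ge0 ?sqr_ge0// ltW.
have -> : (2 * a)^-1 * (u - a * (p + q)) ^+ 2 =
   (2 * a)^-1 * u ^+ 2 - u * (p + q) + (a / 2) * (p + q) ^+ 2.
  by field; rewrite gt_eqF.
nra.
Qed.

Lemma xlnx_ge (r : R) : 0 <= r -> r - 1 <= xlnx r.
Proof. by move=> r0; have := relative_entropy_ge0 r0 ltr01; rewrite ln1; lra. Qed.

(** Both points lie above the tangent at the mixture [m]: this is [relative_entropy_ge0] with [m] as
    second argument, averaged with weights [1 - t] and [t]. The case [m = 0] has no tangent and is
    separate. *)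
Lemma xlnx_convex f g t : 0 <= f -> 0 <= g -> 0 <= t <= 1 ->
  xlnx ((1 - t) * f + t * g) <= (1 - t) * xlnx f + t * xlnx g.
Proof.
move=> f0 g0 /andP[t0 t1]; set m := _ + _.
have tf0 : 0 <= (1 - t) * f by rewrite mulr_ge0// subr_ge0.
have tg0 : 0 <= t * g by rewrite mulr_ge0.
have m0 : 0 <= m by rewrite addr_ge0.
have [mE|mn0] := eqVneq m 0.
  have f1 : (1 - t) * f = 0 by move: mE; rewrite /m; lra.
  have g1 : t * g = 0 by move: mE; rewrite /m; lra.
  by rewrite mE /xlnx mul0r !mulrA f1 g1 !mul0r addr0.
have {mn0} m0' : 0 < m by rewrite lt_neqAle eq_sym mn0.
have hf := relative_entropy_ge0 f0 m0'; have hg := relative_entropy_ge0 g0 m0'.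
have mE : xlnx m = ((1 - t) * f + t * g) * ln m by [].
have mE2 : m = (1 - t) * f + t * g by [].
rewrite mE; nra.
Qed.

Lemma measurable_xlnx d (T : measurableType d) (f : T -> R) :
  measurable_fun setT f -> measurable_fun setT (xlnx \o f).
Proof.
by move=> mf; apply: measurable_funM => //; apply: measurableT_comp => //; exact: measurable_ln.
Qed.

End xlnx.

(** * Potentials and interaction energy of a bounded symmetric kernel *)

Section kernel.
Context {dT : measure_display} {T : measurableType dT} {R : realType}.
Variables (vol : {finite_measure set T -> \bar R}) (k : T -> T -> R) (M : R).
Hypothesis mk : measurable_fun setT (fun z : T * T => k z.1 z.2).
Hypothesis kM : forall x y, `|k x y| <= M.
Hypothesis ksym : forall x y, k x y = k y x.
Implicit Types (f g h : T -> R) (mu : probability T R).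

Definition lint h := vol.-integrable setT (EFin \o h).

Definition conv_density h x := \int[vol]_y (k x y * h y).

Definition energy g h := \int[vol]_x (conv_density h x * g x).

(** The potential is also taken of measures without a density, since the Wasserstein estimates and
    the relaxation concern all probability measures. *)
Definition conv_prob mu x := \int[mu]_y k x y.

Lemma measurable_k x : measurable_fun setT (k x).
Proof.
rewrite (_ : k x = (fun z : T * T => k z.1 z.2) \o pair x)//.
by apply: measurableT_comp => //; exact: measurable_pair1.
Qed.

Lemma int_kM x h : lint h -> lint (fun y => k x y * h y).
Proof. by move=> hi; apply: (@intM _ _ _ _ _ _ M) => //; exact: measurable_k. Qed.

Lemma kernel_bounded : [bounded k z.1 z.2 | z in [set: T * T]].
Proof.
exists M; split; first exact: num_real.
by move=> x Mx y _; exact: le_trans (kM _ _) (ltW Mx).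
Qed.

Lemma int_product g h : lint g -> lint h ->
  (vol \x vol)%E.-integrable setT (fun z => (k z.1 z.2 * (g z.1 * h z.2))%:E).
Proof.
move=> gi hi.
have mg : measurable_fun setT (fun z : T * T => g z.1).
  by apply: measurableT_comp (int_meas gi) _; exact: measurable_fst.
have mh : measurable_fun setT (fun z : T * T => h z.2).
  by apply: measurableT_comp (int_meas hi) _; exact: measurable_snd.
have ghi : (vol \x vol)%E.-integrable setT (fun z => (g z.1 * h z.2)%:E).
  apply/integrable12ltyP.
    by apply/measurable_EFinP; exact: measurable_funM.
  have mEh : measurable_fun setT (fun y => `|(h y)%:E|%E).
    by apply: measurableT_comp => //; apply/measurable_EFinP; exact: int_meas hi.
  have mEg : measurable_fun setT (fun y => `|(g y)%:E|%E).
    by apply: measurableT_comp => //; apply/measurable_EFinP; exact: int_meas gi.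
  have -> : (\int[vol]_x \int[vol]_y `|(g (x, y).1 * h (x, y).2)%:E| =
      \int[vol]_x (`|(g x)%:E| * \int[vol]_y `|(h y)%:E|))%E.
    apply: eq_integral => x _; rewrite -ge0_integralZl//.
    by apply: eq_integral => y _; rewrite /= normrM.
  rewrite ge0_integralZr//; last exact: integral_ge0.
  move: gi hi => /integrableP[_ gi] /integrableP[_ hi].
  by apply: lte_mul_pinfty => //; [exact: integral_ge0|rewrite ge0_fin_numE//; exact: integral_ge0].
by have := integrableMr measurableT mk kernel_bounded ghi; apply: eq_integrable.
Qed.

Lemma measurable_conv h : lint h -> measurable_fun setT (conv_density h).
Proof.
move=> hi.
have i1 : lint (fun=> 1) by apply: (@int_bounded _ _ _ _ _ 1) => // x; rewrite normr1.
have := measurable_fubini_F (int_product i1 hi).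
move=> /(measurableT_comp (@measurable_realfun.fine_measurable R setT measurableT)).
apply: eq_measurable_fun => x _ /=; rewrite /fubini_F /conv_density /Rintegral.
by congr fine; apply: eq_integral => y _; rewrite /= mul1r.
Qed.

Lemma conv_bounded h : lint h -> bounded_by (conv_density h) (M * \int[vol]_x `|h x|).
Proof. by move=> hi x; apply: RintM_le => //; exact: measurable_k. Qed.

Lemma convD h1 h2 (a b : R) : lint h1 -> lint h2 ->
  forall x, conv_density (fun y => a * h1 y + b * h2 y) x = a * conv_density h1 x + b * conv_density h2 x.
Proof.
move=> i1 i2 x; rewrite /conv_density -!RintZ; [|exact: int_kM..].
rewrite -RintD; [|exact/intZ/int_kM..].
by apply: eq_Rint => y; ring.
Qed.

Lemma int_energy g h : lint g -> lint h -> lint (fun x => conv_density h x * g x).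
Proof.
by move=> gi hi; apply: intM gi; [exact: measurable_conv|exact: conv_bounded].
Qed.

Lemma energyE g h : lint g -> lint h ->
  ((energy g h)%:E = \int[vol]_x \int[vol]_y (k x y * (g x * h y))%:E)%E.
Proof.
move=> gi hi; rewrite /energy -EFin_Rint; last exact: int_energy.
apply: eq_integral => x _; rewrite EFin_Rint; last first.
  apply: (@intM _ _ _ _ _ _ M) => //; first exact: measurable_k.
  exact: intZ.
congr EFin; rewrite /conv_density mulrC -RintZ; last exact: int_kM.
by apply: eq_Rint => y; ring.
Qed.

Lemma energy_sym g h : lint g -> lint h -> energy g h = energy h g.
Proof.
move=> gi hi; apply: EFin_inj; rewrite !energyE//.
rewrite (Fubini (int_product gi hi)) /=.
by apply: eq_integral => x _; apply: eq_integral => y _; rewrite ksym (mulrC (g y)).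
Qed.

Lemma energy_linr g h1 h2 (a b : R) : lint g -> lint h1 -> lint h2 ->
  energy g (fun x => a * h1 x + b * h2 x) = a * energy g h1 + b * energy g h2.
Proof.
move=> gi i1 i2; rewrite /energy -!RintZ; [|exact: int_energy..].
rewrite -RintD; [|exact/intZ/int_energy..].
by apply: eq_Rint => x; rewrite convD//; ring.
Qed.

Lemma energy_linl g h1 h2 (a b : R) : lint g -> lint h1 -> lint h2 ->
  energy (fun x => a * h1 x + b * h2 x) g = a * energy h1 g + b * energy h2 g.
Proof.
move=> gi i1 i2; have i12 := intD (intZ a i1) (intZ b i2).
rewrite energy_sym// energy_linr//.
by rewrite (energy_sym gi i1) (energy_sym gi i2).
Qed.

Lemma energy_quad g h (a b : R) : lint g -> lint h ->
  energy (fun x => a * g x + b * h x) (fun x => a * g x + b * h x) =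
  a ^+ 2 * energy g g + 2 * a * b * energy g h + b ^+ 2 * energy h h.
Proof.
move=> gi hi; have i12 := intD (intZ a gi) (intZ b hi).
rewrite energy_linr// !energy_linl// (energy_sym hi gi); ring.
Qed.

Lemma energy_le h e : lint h -> bounded_by (conv_density h) e ->
  `|energy h h| <= e * \int[vol]_x `|h x|.
Proof. by move=> hi he; apply: RintM_le => //; exact: measurable_conv. Qed.

Lemma measurable_mconv mu : measurable_fun setT (conv_prob mu).
Proof.
have ik : (mu \x mu)%E.-integrable setT (fun z => (k z.1 z.2)%:E).
  apply: (@measurable_bounded_integrable _ _ _ _ (fun z => k z.1 z.2)) => //.
    have muT : (mu \x mu)%E setT = 1%E.
      rewrite -setXTT product_measure1E// [X in (X * _)%E]probability_setT.
      by rewrite [X in (_ * X)%E]probability_setT mule1.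
    by rewrite [X in (X < _)%E]muT ltry.
  exact: kernel_bounded.
exact: (measurableT_comp (@measurable_realfun.fine_measurable R setT measurableT)
  (measurable_fubini_F ik)).
Qed.

Lemma mconv_bounded mu : bounded_by (conv_prob mu) M.
Proof. by move=> x; apply: Rint_prob_bounded => //; exact: measurable_k. Qed.

End kernel.

(** * The free energy in terms of densities *)

Section free_energy_density.
Context {dT : measure_display} {T : measurableType dT} {R : realType}.
Variables (vol : {finite_measure set T -> \bar R}) (k : T -> T -> R) (M : R).
Hypothesis mk : measurable_fun setT (fun z : T * T => k z.1 z.2).
Hypothesis kM : forall x y, `|k x y| <= M.
Implicit Types (f g h : T -> R) (mu nu : probability T R) (beta : R).

(** The sigma-finite Radon-Nikodym derivative is nonnegative and finite everywhere, so taking [fine]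
    loses nothing and gives a genuine real density. *)
Lemma dominates_has_density mu : mu `<< vol -> exists f, has_density vol mu f.
Proof.
move=> muvol.
pose F := Radon_Nikodym_SigmaFinite.f mu vol.
have FE x : (fine (F x))%:E = F x.
  by rewrite fineK// Radon_Nikodym_SigmaFinite.f_fin_num.
have Fi := Radon_Nikodym_SigmaFinite.f_integrable muvol.
have E A : measurable A -> (mu A = \int[vol]_(x in A) (fine (F x))%:E)%E.
  move=> mA; rewrite (Radon_Nikodym_SigmaFinite.f_integral muvol)//.
  by apply: eq_integral => x _; rewrite FE.
exists (fine \o F); split; last exact: E.
split => [|x|].
- exact: (measurableT_comp (@measurable_realfun.fine_measurable R setT measurableT)
    (measurable_int _ Fi)).
- by rewrite fine_ge0// Radon_Nikodym_SigmaFinite.f_ge0.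
- by rewrite -E// probability_setT.
Qed.

Lemma Rint_has_density mu f h B : has_density vol mu f ->
  measurable_fun setT h -> bounded_by h B ->
  \int[mu]_x h x = \int[vol]_x (h x * f x).
Proof.
move=> muf mh hB; rewrite /Rintegral (has_density_integral muf)//.
exact/measurable_EFinP.
Qed.

Lemma mconv_conv mu f : has_density vol mu f -> conv_prob k mu =1 conv_density vol k f.
Proof.
by move=> muf x; rewrite /conv_prob (@Rint_has_density _ _ _ M muf)//; exact: measurable_k.
Qed.

Definition entropy f := \int[vol]_x xlnx (f x).

Definition fin_ent f := density vol f /\ lint vol (xlnx \o f).

(* The text of [free_energy], for a general kernel. *)
Definition kernel_free_energy beta mu : \bar R :=
  (if `[< mu `<< vol >] then
     (beta^-1)%:E *
       \int[mu]_x (ln (fine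
         ('d (charge_of_finite_measure mu) '/d vol x)))%:E
     + (2^-1)%:E * \int[mu]_x \int[mu]_y (k x y)%:E
   else +oo)%E.

Definition density_free_energy beta f : R :=
  beta^-1 * entropy f + 2^-1 * energy vol k f f.

(** Changing variables multiplies the logarithm by [f]; where [f] vanishes both sides are zero
    whatever the value of [ln 0]. *)
Lemma entropy_has_density mu f : has_density vol mu f ->
  (\int[mu]_x (ln (fine ('d (charge_of_finite_measure mu) '/d vol x)))%:E =
   \int[vol]_x (xlnx (f x))%:E)%E.
Proof.
move=> muf; have muvol := has_density_dominates muf.
have RNf := has_density_RN muf.
have [[mf f0 f1] mufE] := muf.
have mlnRN : measurable_fun setT
    (fun x => (ln (fine ('d (charge_of_finite_measure mu) '/d vol x)))%:E).
  apply/measurable_EFinP; apply: (measurableT_comp (@measurable_ln R)).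
  apply: (measurableT_comp (@measurable_realfun.fine_measurable R setT measurableT)).
  by apply: measurable_int; exact: Radon_Nikodym_integrable.
rewrite (has_density_integral muf)//.
apply: ae_eq_integral => //.
- by apply: emeasurable_funM => //; exact/measurable_EFinP.
- by apply/measurable_EFinP; exact: measurable_xlnx.
- apply: filterS RNf => x /= /(_ I) -> _.
  by rewrite /xlnx mulrC.
Qed.

(** By $r\ln r\ge r-1\ge-1$ the negative part is at most $1$, hence integrable for a finite measure;
    the bound on the integral then controls the positive part. *)
Lemma int_xlnx f : density vol f -> (\int[vol]_x (xlnx (f x))%:E < +oo)%E ->
  lint vol (xlnx \o f).
Proof.
move=> [mf f0 f1] lty0.
have lty : (\int[vol]_x (EFin \o (xlnx \o f)) x < +oo)%E by [].
have mxf : measurable_fun setT (EFin \o (xlnx \o f)).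
  by apply/measurable_EFinP; exact: measurable_xlnx.
have negi : vol.-integrable setT ((EFin \o (xlnx \o f))^\-)%E.
  apply: (@le_integrable _ _ _ _ _ measurableT _ (EFin \o (cst 1))).
  - exact: measurable_funeneg.
  - move=> x _ /=; rewrite funenegE -EFinN -EFin_max /= lee_fin normr1.
    have := xlnx_ge (f0 x); have := f0 x.
    by rewrite ger0_norm ?le_max ?lexx ?orbT// ge_max ler01 andbT; lra.
  - by apply: (@int_bounded _ _ _ _ _ 1) => // x; rewrite normr1.
have posi : vol.-integrable setT ((EFin \o (xlnx \o f))^\+)%E.
  apply/integrableP; split; first exact: measurable_funepos.
  under eq_integral do rewrite gee0_abs//.
  rewrite integralE in lty; move: (integrable_fin_num measurableT negi) lty.
  case: (\int[vol]_x ((EFin \o (xlnx \o f))^\- x)%E)%E => // r _.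
  by case: (\int[vol]_x ((EFin \o (xlnx \o f))^\+ x)%E)%E => [s| |] /=; rewrite ?ltry.
apply/integrableP; split => //.
have -> : (\int[vol]_x `|(EFin \o (xlnx \o f)) x| =
    \int[vol]_x ((EFin \o (xlnx \o f))^\+ x + (EFin \o (xlnx \o f))^\- x))%E.
  by apply: eq_integral => x _; rewrite -[RHS]/(((_)^\+ \+ _^\-)%E x) -fune_abse.
rewrite integralD//; apply: lte_add_pinfty.
  by have := integrable_fin_num measurableT posi; rewrite fin_numE => /andP[_]; rewrite -ltey.
by have := integrable_fin_num measurableT negi; rewrite fin_numE => /andP[_]; rewrite -ltey.
Qed.

Lemma interaction_has_density mu f : has_density vol mu f ->
  (\int[mu]_x \int[mu]_y (k x y)%:E = (energy vol k f f)%:E)%E.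
Proof.
move=> muf; have fi := density_int muf.1.
under eq_integral => x _.
  rewrite (has_density_integral muf); last first.
    by apply/measurable_EFinP; exact: measurable_k.
  rewrite (_ : (\int[vol]_x0 _ = (conv_density vol k f x)%:E)%E); last first.
    by rewrite -EFin_Rint; [apply: eq_integral => y _; rewrite EFinM|exact: (@int_kM _ _ _ _ _ M)].
  over.
rewrite (has_density_integral muf); last first.
  by apply/measurable_EFinP; exact: (@measurable_conv _ _ _ _ _ M).
by rewrite -EFin_Rint//; exact: (@int_energy _ _ _ _ _ M).
Qed.

Lemma kernel_free_energyE beta mu f : has_density vol mu f ->
  lint vol (xlnx \o f) ->
  kernel_free_energy beta mu = (density_free_energy beta f)%:E.
Proof.
move=> muf fi; rewrite /kernel_free_energy asboolT; last exact: has_density_dominates muf.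
by rewrite (entropy_has_density muf) (interaction_has_density muf) EFin_Rint.
Qed.

(** The interaction term is finite because the kernel is bounded, so infinite entropy would make the
    whole sum infinite. *)
Lemma kernel_free_energy_lty beta mu : 0 < beta ->
  (kernel_free_energy beta mu < +oo)%E ->
  exists2 f, has_density vol mu f & lint vol (xlnx \o f).
Proof.
move=> b0; rewrite /kernel_free_energy; case: asboolP => // muvol lty.
have [f muf] := dominates_has_density muvol; exists f => //.
apply: int_xlnx; first exact: muf.1.
move: lty; rewrite (entropy_has_density muf) (interaction_has_density muf).
case: (\int[vol]_x _)%E => [r| |] //=; first by move=> _; rewrite ltry.
by rewrite gt0_muley ?lte_fin ?invr_gt0// -EFinM addye// ltxx.
Qed.

End free_energy_density.

(** * Gibbs densities, relative entropy and Pinsker's inequality *)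

Section gibbs.
Context {dT : measure_display} {T : measurableType dT} {R : realType}.
Variables (vol : {finite_measure set T -> \bar R}) (beta : R).
Hypothesis vol0 : (0 < vol setT)%E.
Hypothesis beta0 : 0 < beta.
Implicit Types (f g h u v : T -> R).

Definition gibbs_weight v x := expR (- (beta * v x)).
Definition partition_function v := \int[vol]_x gibbs_weight v x.
Definition gibbs v x := gibbs_weight v x / partition_function v.

(* The relative entropy of [f] with respect to [gibbs v], see [KL_Rint]. *)
Definition KL f v :=
  entropy vol f + beta * (\int[vol]_x (v x * f x)) + ln (partition_function v).

Section potential.
Variables (v : T -> R) (B : R).
Hypothesis mv : measurable_fun setT v.
Hypothesis vB : bounded_by v B.

Lemma measurable_gibbs_weight : measurable_fun setT (gibbs_weight v).
Proof.
apply: (measurableT_comp (@measurable_expR R)).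
by apply: measurableT_comp => //; exact: measurable_funM.
Qed.

Lemma gibbs_weight_ge x : expR (- (beta * B)) <= gibbs_weight v x.
Proof.
by rewrite ler_expR lerN2 ler_wpM2l ?(ltW beta0)// (le_trans (ler_norm _) (vB x)).
Qed.

Lemma gibbs_weight_le x : gibbs_weight v x <= expR (beta * B).
Proof.
rewrite ler_expR -mulrN ler_wpM2l ?(ltW beta0)//.
by rewrite (le_trans _ (vB x))// -normrN ler_norm.
Qed.

Lemma int_gibbs_weight : lint vol (gibbs_weight v).
Proof.
apply: (@int_bounded _ _ _ _ _ (expR (beta * B))).
  exact: measurable_gibbs_weight.
by move=> x; rewrite ger0_norm ?expR_ge0 ?gibbs_weight_le.
Qed.

Lemma partition_function_gt0 : 0 < partition_function v.
Proof.
have cstR : lint vol (fun=> expR (- (beta * B))).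
  by apply: (@int_bounded _ _ _ _ _ (expR (- (beta * B)))) => // x; rewrite ger0_norm ?expR_ge0.
apply: (@lt_le_trans _ _ (\int[vol]_x (expR (- (beta * B))))); last first.
  by apply: Rint_le => //; [exact: int_gibbs_weight|exact: gibbs_weight_ge].
rewrite Rintegral_cst// mulr_gt0 ?expR_gt0// fine_gt0// vol0 /=.
by rewrite -ge0_fin_numE// fin_num_measure.
Qed.

Lemma gibbs_gt0 x : 0 < gibbs v x.
Proof. by rewrite divr_gt0 ?expR_gt0 ?partition_function_gt0. Qed.

Lemma ln_gibbs x : ln (gibbs v x) = - (beta * v x) - ln (partition_function v).
Proof. by rewrite ln_div ?posrE ?expR_gt0 ?partition_function_gt0// expRK. Qed.

Lemma int_gibbs : lint vol (gibbs v).
Proof.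
have := intZ (partition_function v)^-1 int_gibbs_weight.
by apply: eq_integrable => // x _; rewrite /= mulrC.
Qed.

Lemma density_gibbs : density vol (gibbs v).
Proof.
apply: densityP; first exact: int_gibbs.
  by move=> x; exact/ltW/gibbs_gt0.
rewrite (@eq_Rint _ _ _ _ _ (fun x => (partition_function v)^-1 * gibbs_weight v x)).
  by rewrite RintZ ?mulVf ?gt_eqF ?partition_function_gt0//; exact: int_gibbs_weight.
by move=> x; rewrite mulrC.
Qed.

Lemma int_potentialM f : lint vol f -> lint vol (fun x => v x * f x).
Proof. by move=> fi; exact: (@intM _ _ _ _ _ _ B). Qed.

Lemma int_f_ln_gibbs f : lint vol f -> lint vol (fun x => f x * ln (gibbs v x)).
Proof.
move=> fi; have := intD (intZ (- beta) (int_potentialM fi))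
  (intZ (- ln (partition_function v)) fi).
by apply: eq_integrable => // x _ /=; congr EFin; rewrite ln_gibbs; ring.
Qed.

Lemma fin_ent_gibbs : fin_ent vol (gibbs v).
Proof.
split; first exact: density_gibbs.
exact: int_f_ln_gibbs int_gibbs.
Qed.

Lemma int_KL f : fin_ent vol f ->
  lint vol (fun x => xlnx (f x) - f x * ln (gibbs v x) - f x + gibbs v x).
Proof.
move=> [fd fi]; have f1 := density_int fd.
by apply: intD int_gibbs; apply: intB => //; apply: intB => //; exact: int_f_ln_gibbs.
Qed.

(** The two added terms cancel since both densities have mass $1$; they make the integrand
    nonnegative pointwise, which is the form in which [relative_entropy_ge0] and [pinsker_pointwise]
    apply. *)
Lemma KL_Rint f : fin_ent vol f -> KL f v =
  \int[vol]_x (xlnx (f x) - f x * ln (gibbs v x) - f x + gibbs v x).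
Proof.
move=> [fd fi]; have f1 := density_int fd; have lf := int_f_ln_gibbs f1.
rewrite RintD//; [|by apply: intB => //; apply: intB|exact: int_gibbs].
rewrite RintB//; last by apply: intB.
rewrite RintB// (density_Rint fd) (density_Rint density_gibbs) subrK.
rewrite /KL -addrA; congr (_ + _).
rewrite (@eq_Rint _ _ _ _ (fun x => f x * ln (gibbs v x))
  (fun x => (- beta) * (v x * f x) + (- ln (partition_function v)) * f x)); last first.
  by move=> x; rewrite ln_gibbs; ring.
have vfi := int_potentialM f1.
by rewrite RintD ?RintZ ?(density_Rint fd)//; [ring|exact: intZ|exact: intZ].
Qed.

Lemma KL_ge0 f : fin_ent vol f -> 0 <= KL f v.
Proof.
move=> ff; rewrite KL_Rint//; apply: Rintegral_ge0 => x _.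
by apply: relative_entropy_ge0; [case: ff => -[]|exact: gibbs_gt0].
Qed.

Lemma KL_gibbs : KL (gibbs v) v = 0.
Proof.
rewrite KL_Rint; last exact: fin_ent_gibbs.
rewrite (@eq_Rint _ _ _ _ _ (cst 0)); first by rewrite /= Rintegral_cst// mul0r.
by move=> x; rewrite /xlnx /=; ring.
Qed.

Lemma int_dist_gibbs f : fin_ent vol f -> lint vol (fun x => f x - gibbs v x).
Proof. by move=> [fd fi]; apply: intB; [exact: density_int|exact: int_gibbs]. Qed.

Lemma pinsker_linear f a : fin_ent vol f -> 0 < a ->
  \int[vol]_x `|f x - gibbs v x| <= (2 * a)^-1 * KL f v + 2 * a.
Proof.
move=> ff a0; have f1 := density_int ff.1; have ki := int_KL ff.
have si : lint vol (fun x => f x + gibbs v x) by apply: intD => //; exact: int_gibbs.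
set c := (2 * a)^-1.
have -> : 2 * a = a * \int[vol]_x (f x + gibbs v x).
  rewrite RintD//; last exact: int_gibbs.
  by rewrite (density_Rint ff.1) (density_Rint density_gibbs); ring.
have -> : c * KL f v =
    \int[vol]_x (c * (xlnx (f x) - f x * ln (gibbs v x) - f x + gibbs v x)).
  by rewrite RintZ// KL_Rint.
rewrite -(RintZ _ si) -RintD; [|exact: intZ|exact: intZ].
apply: Rint_le; [exact/int_abs/int_dist_gibbs|by apply: intD; exact: intZ|].
by move=> x; apply: pinsker_pointwise => //; [case: ff => -[]|exact: gibbs_gt0].
Qed.

Lemma pinsker f : fin_ent vol f ->
  (\int[vol]_x `|f x - gibbs v x|) ^+ 2 <= 4 * KL f v.
Proof.
(* The weight, a quarter of the $L^1$ distance, lets half of the left-hand side absorb the term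
   [2 * a]; this yields the constant 4. *)
move=> ff; have := @pinsker_linear f ((\int[vol]_x `|f x - gibbs v x|) / 4) ff.
have := KL_ge0 ff.
have : 0 <= \int[vol]_x `|f x - gibbs v x| by apply: Rintegral_ge0.
move: (\int[vol]_x _) (KL f v) => y c; rewrite le_eqVlt => /predU1P[<- c0 _|y0 c0].
  by rewrite expr0n/= mulr_ge0.
have y40 : 0 < y / 4 by rewrite divr_gt0.
move=> /(_ y40) h.
have : y * y <= y * ((2 * (y / 4))^-1 * c + 2 * (y / 4)) by rewrite ler_wpM2l// ltW.
have -> : y * ((2 * (y / 4))^-1 * c + 2 * (y / 4)) = 2 * c + y ^+ 2 / 2.
  by field; rewrite gt_eqF.
by rewrite expr2; lra.
Qed.

End potential.

(** Potentials at uniform distance [e] have weights within a factor $e^{\beta e}$ of each other, and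
    this survives integration. *)
Lemma ln_partition_function_le u v B e : measurable_fun setT u -> measurable_fun setT v ->
  bounded_by u B -> bounded_by v B -> bounded_by (fun x => u x - v x) e ->
  ln (partition_function u) <= ln (partition_function v) + beta * e.
Proof.
move=> mu mv uB vB uve.
have Zu := partition_function_gt0 mu uB; have Zv := partition_function_gt0 mv vB.
rewrite -[X in _ + X]expRK -lnM ?posrE ?expR_gt0// ler_ln ?posrE//; last first.
  by rewrite mulr_gt0 ?expR_gt0.
rewrite mulrC -RintZ; last exact: int_gibbs_weight mv vB.
apply: Rint_le; [exact: int_gibbs_weight mu uB|exact/intZ/(int_gibbs_weight mv vB)|].
move=> x; rewrite /gibbs_weight -expRD ler_expR.
have := uve x; rewrite ler_norml => /andP[h _].
by have := ler_wpM2l (ltW beta0) h; lra.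
Qed.

(** The potential term and the logarithm of the partition function each change by at most
    [beta * e]. This transfers smallness of the relative entropy from $W*f_n$ to a limiting
    potential. *)
Lemma KL_shift f u v B e : measurable_fun setT u -> measurable_fun setT v ->
  bounded_by u B -> bounded_by v B -> bounded_by (fun x => u x - v x) e ->
  fin_ent vol f -> KL f u <= KL f v + 2 * beta * e.
Proof.
move=> mu mv uB vB uve [fd fi]; have f1 := density_int fd.
have h := ln_partition_function_le mu mv uB vB uve.
have : `|\int[vol]_x ((u x - v x) * f x)| <= e.
  by rewrite -[leRHS]mulr1 -(density_norm fd); apply: RintM_le => //; exact: measurable_funB.
rewrite (@eq_Rint _ _ _ _ _ (fun x => u x * f x - v x * f x)); last first.
  by move=> x; ring.
rewrite RintB; [|exact: int_potentialM uB _ f1|exact: int_potentialM vB _ f1].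
rewrite ler_norml => /andP[_ /(ler_wpM2l (ltW beta0))].
by rewrite /KL; lra.
Qed.

End gibbs.

(** * Descent of the free energy under relaxation *)

Section free_energy_estimates.
Context {dT : measure_display} {T : measurableType dT} {R : realType}.
Variables (vol : {finite_measure set T -> \bar R}) (beta : R).
Variables (k : T -> T -> R) (M : R).
Hypothesis vol0 : (0 < vol setT)%E.
Hypothesis beta0 : 0 < beta.
Hypothesis M0 : 0 < M.
Hypothesis mk : measurable_fun setT (fun z : T * T => k z.1 z.2).
Hypothesis kM : forall x y, `|k x y| <= M.
Hypothesis ksym : forall x y, k x y = k y x.
Implicit Types (f g h : T -> R).

Local Notation conv := (conv_density vol k).
Local Notation energy := (energy vol k).
Local Notation F := (density_free_energy vol k beta).
Local Notation KL := (KL vol beta).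
Local Notation gibbs := (gibbs vol beta).

Lemma conv_density_bounded f : density vol f -> bounded_by (conv f) M.
Proof.
move=> fd x; rewrite -[leRHS]mulr1 -(density_norm fd).
by apply: conv_bounded => //; exact: density_int.
Qed.

Lemma measurable_conv_density f : density vol f -> measurable_fun setT (conv f).
Proof. by move=> fd; apply: (@measurable_conv _ _ _ _ _ M) => //; exact: density_int. Qed.

Lemma energyB f g : lint vol f -> lint vol g ->
  energy (fun x => f x - g x) (fun x => f x - g x) =
  energy f f - 2 * energy f g + energy g g.
Proof.
move=> fi gi; rewrite (_ : (fun x => f x - g x) = (fun x => 1 * f x + (-1) * g x)).
  by rewrite (energy_quad mk kM)//; ring.
by apply/funext => x; ring.
Qed.

Lemma energyB_le f g : lint vol f -> lint vol g ->
  `|energy (fun x => f x - g x) (fun x => f x - g x)| <=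
  M * (\int[vol]_x `|f x - g x|) ^+ 2.
Proof.
move=> fi gi; have hi := intB fi gi; rewrite expr2 mulrA.
apply: (energy_le mk kM) => //.
exact: (conv_bounded mk kM).
Qed.

Lemma KL_conv f g : fin_ent vol f -> fin_ent vol g ->
  KL f (conv g) = entropy vol f + beta * energy f g + ln (partition_function vol beta (conv g)).
Proof. by []. Qed.

(** At a fixed point, [KL rho (conv rho) = 0] expresses the partition function through the entropy
    and energy of [rho]. All terms linear in [f - rho] are then absorbed in the relative entropy,
    leaving an exact identity with a quadratic remainder. *)
Lemma free_energy_gap f rho : fin_ent vol f -> fin_ent vol rho ->
  KL rho (conv rho) = 0 ->
  F f - F rho = beta^-1 * KL f (conv rho) +
    2^-1 * energy (fun x => f x - rho x) (fun x => f x - rho x).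
Proof.
move=> ff fr; rewrite !KL_conv// => h.
have -> : ln (partition_function vol beta (conv rho)) =
  - (entropy vol rho + beta * energy rho rho) by lra.
rewrite energyB; [|exact: density_int ff.1|exact: density_int fr.1].
by rewrite /density_free_energy; field; rewrite gt_eqF.
Qed.

Lemma fin_ent_mix f g t : 0 <= t <= 1 -> fin_ent vol f -> fin_ent vol g ->
  fin_ent vol (fun x => (1 - t) * f x + t * g x).
Proof.
move=> t01 [fd fi] [gd gi]; have /andP[t0 t1] := t01.
have [f1 g1] := (density_int fd, density_int gd).
have si := intD (intZ (1 - t) f1) (intZ t g1).
have [[_ f0 _] [_ g0 _]] := (fd, gd).
have s0 x : 0 <= (1 - t) * f x + t * g x.
  by rewrite addr_ge0 ?mulr_ge0// subr_ge0.
split.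
  apply: densityP => //; rewrite RintD; [|exact: intZ|exact: intZ].
  by rewrite !RintZ// (density_Rint fd) (density_Rint gd); ring.
apply: (@int_le _ _ _ _ _ (fun x => 1 + ((1 - t) * `|xlnx (f x)| + t * `|xlnx (g x)|))).
- by apply: measurable_xlnx; exact: int_meas si.
- move=> x /=; have hc := xlnx_convex (f0 x) (g0 x) t01.
  have hl := xlnx_ge (s0 x).
  have hf : (1 - t) * xlnx (f x) <= (1 - t) * `|xlnx (f x)|.
    by rewrite ler_wpM2l ?ler_norm// subr_ge0.
  have hg : t * xlnx (g x) <= t * `|xlnx (g x)| by rewrite ler_wpM2l ?ler_norm.
  have pf : 0 <= (1 - t) * `|xlnx (f x)| by rewrite mulr_ge0// subr_ge0.
  have pg : 0 <= t * `|xlnx (g x)| by rewrite mulr_ge0.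
  have s0x := s0 x; rewrite ler_norml; apply/andP; split; lra.
- apply: intD; last by apply: intD; exact/intZ/int_abs.
  by apply: (@int_bounded _ _ _ _ _ 1) => // x; rewrite normr1.
Qed.

Lemma entropy_mix_le f g t : 0 <= t <= 1 -> fin_ent vol f -> fin_ent vol g ->
  entropy vol (fun x => (1 - t) * f x + t * g x) <=
  (1 - t) * entropy vol f + t * entropy vol g.
Proof.
move=> t01 ff fg; have [[fd fi] [gd gi]] := (ff, fg).
rewrite /entropy -(RintZ _ fi) -(RintZ _ gi) -RintD; [|exact: intZ|exact: intZ].
apply: Rint_le; [exact: (fin_ent_mix t01 ff fg).2|by apply: intD; exact: intZ|].
move=> x; apply: xlnx_convex => //; [by case: fd|by case: gd].
Qed.

(** The step is chosen so that $t(1+4M\beta)=1$: the quadratic interaction error then costs at most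
    half of the first-order gain. *)
Definition relax_step : R := (1 + 4 * M * beta)^-1.

Lemma relax_step_gt0 : 0 < relax_step.
Proof. by rewrite invr_gt0; have := mulr_gt0 M0 beta0; lra. Qed.

Lemma relax_step_le1 : relax_step <= 1.
Proof.
rewrite invf_le1; last by have := mulr_gt0 M0 beta0; lra.
by have := mulr_gt0 M0 beta0; lra.
Qed.

Definition relax f x := (1 - relax_step) * f x + relax_step * gibbs (conv f) x.

Lemma fin_ent_gibbs_conv f : fin_ent vol f -> fin_ent vol (gibbs (conv f)).
Proof.
move=> [fd _]; apply: fin_ent_gibbs => //; first exact: measurable_conv_density.
exact: conv_density_bounded.
Qed.

Lemma relax_step01 : 0 <= relax_step <= 1.
Proof. by rewrite (ltW relax_step_gt0) relax_step_le1. Qed.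

Lemma fin_ent_relax f : fin_ent vol f -> fin_ent vol (relax f).
Proof. by move=> ff; apply: fin_ent_mix => //; [exact: relax_step01|exact: fin_ent_gibbs_conv]. Qed.

(** Convexity of entropy, together with the vanishing relative entropy of the Gibbs density, gives a
    first-order gain of $t\beta^{-1}$ times [KL f (conv f)]. The interaction is a quadratic
    polynomial in $t$ whose second-order part is the energy of the difference of the two densities,
    at most $4M$ times the same relative entropy by Pinsker's inequality. *)
Lemma relax_decrease f : fin_ent vol f ->
  F (relax f) <= F f - relax_step / (2 * beta) * KL f (conv f).
Proof.
move=> ff; have fg := fin_ent_gibbs_conv ff.
have mc := measurable_conv_density ff.1; have bc := conv_density_bounded ff.1.
have [f1 g1] := (density_int ff.1, density_int fg.1).
have hent := entropy_mix_le relax_step01 ff fg.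
have hE := energy_quad mk kM ksym (1 - relax_step) relax_step f1 g1.
have hb := energyB_le f1 g1.
have hp := pinsker vol0 beta0 mc bc ff.
have hgg := KL_gibbs vol0 beta0 mc bc.
have hKL := KL_ge0 vol0 beta0 mc bc ff.
have hb2 : M * (\int[vol]_x `|f x - gibbs (conv f) x|) ^+ 2 <= M * (4 * KL f (conv f)).
  by rewrite ler_wpM2l// ltW.
move: hb; rewrite energyB// ler_norml => /andP[_ /le_trans/(_ hb2) {hb2 hp}].
rewrite -/(relax f) in hE hent.
move: hgg hKL; rewrite !KL_conv//= (energy_sym mk kM ksym g1 f1).
rewrite /density_free_energy hE.
set Ef := entropy _ f; set Eg := entropy _ (gibbs _); set Es := entropy _ _ in hent *.
move: (energy f f) (energy f (gibbs (conv f))) (energy (gibbs (conv f)) (gibbs (conv f))) => A B C.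
move: (ln _) => lZ hgg hKL hM.
set K := Ef + beta * A + lZ in hKL hM *.
have tE : relax_step * (1 + 4 * M * beta) = 1.
  by rewrite mulVf// gt_eqF//; have := mulr_gt0 M0 beta0; lra.
have t0 := relax_step_gt0; move: (relax_step) hent tE t0 => t hent tE t0.
have hEs : beta^-1 * Es <= beta^-1 * ((1 - t) * Ef + t * Eg).
  by rewrite ler_wpM2l// invr_ge0 ltW.
have -> : 2^-1 * ((1 - t) ^+ 2 * A + 2 * (1 - t) * t * B + t ^+ 2 * C) =
   2^-1 * A + t * (B - A) + 2^-1 * (t ^+ 2 * (A - 2 * B + C)) by field.
have h1 : t ^+ 2 * (A - 2 * B + C) <= t ^+ 2 * (M * (4 * K)).
  by rewrite ler_wpM2l// sqr_ge0.
have h2 : beta^-1 * ((1 - t) * Ef + t * Eg) = beta^-1 * Ef + t * (A - B) - t * (beta^-1 * K).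
  have -> : Eg = - (beta * B + lZ) by lra.
  by rewrite /K; field; rewrite gt_eqF.
have h3 : 2^-1 * (t ^+ 2 * (M * (4 * K))) = 2^-1 * (t * (beta^-1 * K)) - 2^-1 * (t ^+ 2 * (beta^-1 * K)).
  rewrite -mulrBr; congr (_ * _).
  transitivity (t * (beta^-1 * K) * (t * (1 + 4 * M * beta)) - t ^+ 2 * (beta^-1 * K)); last by rewrite tE mulr1.
  by field; rewrite gt_eqF.
have h4 : 0 <= t ^+ 2 * (beta^-1 * K).
  by rewrite mulr_ge0 ?sqr_ge0// mulr_ge0// invr_ge0 ltW.
have -> : t / (2 * beta) * K = 2^-1 * (t * (beta^-1 * K)) by field; rewrite gt_eqF.
lra.
Qed.

End free_energy_estimates.

(** * Uniform cluster points of equicontinuous sequences *)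

Section uniform_cluster.
Context {R : realType} {T : eqType}.
Variables (w : nat -> T -> R) (M : R).
Hypothesis wM : forall n x, `|w n x| <= M.
Hypothesis wnet : forall e : R, 0 < e -> exists (m : nat) (s : 'I_m -> T),
  forall x, exists i, forall n, `|w n x - w n (s i)| <= e.

(* Tychonoff's theorem gives a pointwise cluster point; on a finite net
   pointwise proximity is uniform. *)
Lemma uniform_cluster : exists2 g : T -> R, (forall x, `|g x| <= M) &
  forall e, 0 < e -> forall n0, exists2 n, (n0 <= n)%N & forall x, `|w n x - g x| <= e.
Proof.
pose K (x : T) : set R := `[- M, M]%classic.
have cK : forall x, compact (K x) by move=> x; exact: segment_compact.
have cT := tychonoff cK.
pose PT : topologicalType := prod_topology (fun _ : T => R : topologicalType).
pose F : set_system PT := fmap (w : nat -> PT) \oo.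
have FF : ProperFilter F by apply: fmap_proper_filter; exact: eventually_filter.
have [|g [/= gK gcl]] := cT F FF.
  by exists 0 => // n _ x /=; rewrite /K /= in_itv /= -ler_norml.
have gM x : `|g x| <= M by have := gK x; rewrite /K /= in_itv /= -ler_norml.
exists g => //.
have close (m : nat) (s : 'I_m -> T) e n0 : 0 < e ->
    exists2 n, (n0 <= n)%N & forall i, `|w n (s i) - g (s i)| < e.
  move=> e0.
  have nU : @nbhs _ PT g [set f : PT | forall i, ball (g (s i)) e (f (s i))].
    apply: (@filter_forall PT _ _ _ (nbhs_filter (g : PT))) => i.
    have := @proj_continuous T (fun _ => R) (s i) g.
    by apply; exact: nbhsx_ballx.
  have FA : F [set f | exists2 n, (n0 <= n)%N & f = w n].
    by exists n0 => // n /= n0n; exists n.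
  have [f [[n n0n ->] fU]] := gcl _ _ FA nU.
  by exists n => // i; have := fU i; rewrite /ball /= distrC.
move=> e e0 n0; have e5 : 0 < e / 5 by rewrite divr_gt0.
have [m [s hs]] := wnet e5; have [n n0n hn] := close m s _ n0 e5.
exists n => // x; have [i hi] := hs x.
(* A second index, allowed to depend on [x], approximates the limit at [x] and at the net point
   simultaneously. The chain from [w n x] to [g x] through both indices has five links, whence
   [e / 5]. *)
have [n' _ hn'] := close 2 (fun j => if j == ord0 then x else s i) _ 0%N e5.
have h0 := hn' ord0; have h1 := hn' (lift ord0 ord0); rewrite /= in h0 h1.
have := hi n; have := hi n'; have := hn i; move: h0 h1.
rewrite !ltr_norml !ler_norml => /andP[? ?] /andP[? ?] /andP[? ?] /andP[? ?] /andP[? ?].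
apply/andP; split; lra.
Qed.

End uniform_cluster.

Lemma eq0_le_small {R : realType} (x C : R) :
  (forall e, 0 < e -> `|x| <= C * e) -> x = 0.
Proof.
move=> h; apply/eqP/negP => /negP; rewrite -normr_gt0 => x0.
have C0 : 0 < C by have := h 1 ltr01; lra.
have := h (`|x| / (2 * C)); rewrite divr_gt0//; last lra.
rewrite (_ : C * _ = `|x| / 2); last by field; rewrite gt_eqF.
by move=> /(_ isT); lra.
Qed.

(** * The Palais-Smale property *)

Section palais_smale.
Context {dT : measure_display} {T : measurableType dT} {R : realType}.
Variables (vol : {finite_measure set T -> \bar R}) (beta : R).
Variables (k : T -> T -> R) (M : R).
Hypothesis vol0 : (0 < vol setT)%E.
Hypothesis beta0 : 0 < beta.
Hypothesis M0 : 0 < M.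
Hypothesis mk : measurable_fun setT (fun z : T * T => k z.1 z.2).
Hypothesis kM : forall x y, `|k x y| <= M.
Hypothesis ksym : forall x y, k x y = k y x.
Hypothesis knet : forall e : R, 0 < e -> exists (m : nat) (s : 'I_m -> T),
  forall x, exists i, forall y, `|k x y - k (s i) y| <= e.
Implicit Types (f g h : T -> R).

Local Notation conv := (conv_density vol k).
Local Notation energy := (energy vol k).
Local Notation F := (density_free_energy vol k beta).
Local Notation KL := (KL vol beta).
Local Notation gibbs := (gibbs vol beta).

Lemma conv_dist_le f x y e : density vol f -> (forall z, `|k x z - k y z| <= e) ->
  `|conv f x - conv f y| <= e.
Proof.
move=> fd he; have fi := density_int fd; rewrite /conv_density -RintB; [|exact: (int_kM mk kM)..].
rewrite (@eq_Rint _ _ _ _ _ (fun z => (k x z - k y z) * f z)); last by move=> z; ring.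
rewrite -[leRHS]mulr1 -(density_norm fd); apply: RintM_le => //.
by apply: measurable_funB; exact: measurable_k.
Qed.

(** The net for [k] makes the potentials of the $f_n$ equicontinuous, so they cluster uniformly at
    some [g]. Along these indices $f_n$ has small relative entropy with respect to [gibbs g], hence
    is $L^1$-close to it, so [gibbs g] has potential [g] and is a fixed point. *)
Lemma palais_smale (f : nat -> T -> R) (c : R) : (forall n, fin_ent vol (f n)) ->
  (forall e, 0 < e -> exists n0, forall n, (n0 <= n)%N -> `|F (f n) - c| <= e) ->
  (forall e, 0 < e -> exists n0, forall n, (n0 <= n)%N -> KL (f n) (conv (f n)) <= e) ->
  exists rho, [/\ fin_ent vol rho, rho = gibbs (conv rho), F rho = c &
    forall e, 0 < e -> forall n0, exists2 n, (n0 <= n)%N &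
      \int[vol]_x `|f n x - rho x| <= e].
Proof.
move=> ff Fc KL0.
have mw n : measurable_fun setT (conv (f n)) := measurable_conv_density mk kM (ff n).1.
have bw n : bounded_by (conv (f n)) M := conv_density_bounded mk kM (ff n).1.
have [|g gM gcl] := @uniform_cluster R T (fun n => conv (f n)) M bw.
  move=> e /knet[m [s hs]]; exists m, s => x; have [i hi] := hs x.
  by exists i => n; apply: conv_dist_le hi; exact: (ff n).1.
(* A cluster point is only a limit along chosen indices; taking these with error $1/(n+1)$ presents
   [g] as a pointwise limit of measurable functions. *)
have mg : measurable_fun setT g.
  have /choice[u hu] n : exists j, forall x, `|conv (f j) x - g x| <= n.+1%:R^-1.
    by have [|j _ hj] := gcl n.+1%:R^-1 _ 0%N; [rewrite invr_gt0|exists j].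
  apply: (@measurable_realfun.measurable_fun_cvg _ _ _ _ (fun n => conv (f (u n)))) => //.
  move=> x _; apply/cvgrPdist_le => e e0.
  have := near_infty_natSinv_lt (PosNum e0); apply: filterS => n /= ne.
  by rewrite distrC (le_trans (hu n x))// ltW.
have approx e n0 : 0 < e -> exists2 n, (n0 <= n)%N &
    [/\ KL (f n) g <= e, `|F (f n) - c| <= e & forall x, `|conv (f n) x - g x| <= e].
  move=> e0; have e20 : 0 < e / 2 by rewrite divr_gt0.
  have [n1 h1] := Fc _ e0; have [n2 h2] := KL0 _ e20.
  (* With potentials within [e / (4 * beta)], [KL_shift] costs [e / 2]; the other half comes from
     the hypothesis on the relative entropies. *)
  have d0 : 0 < Num.min e (e / (4 * beta)).
    by rewrite lt_min e0 divr_gt0// mulr_gt0.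
  have [n nn hn] := gcl _ d0 (maxn n0 (maxn n1 n2)).
  have [n0n n1n n2n] : [/\ n0 <= n, n1 <= n & n2 <= n]%N.
    by move: nn; rewrite !geq_max => /and3P[].
  exists n => //; split; [|exact: h1|].
  - have hs : bounded_by (fun x => g x - conv (f n) x) (e / (4 * beta)).
      by move=> x; rewrite distrC (le_trans (hn x))// ge_min lexx orbT.
    have := KL_shift vol0 beta0 mg (mw n) gM (bw n) hs (ff n).
    have -> : 2 * beta * (e / (4 * beta)) = e / 2 by field; rewrite gt_eqF.
    by have := h2 _ n2n; lra.
  - by move=> x; rewrite (le_trans (hn x))// ge_min lexx.
have fr : fin_ent vol (gibbs g) := fin_ent_gibbs vol0 beta0 mg gM.
have dist_le e n : 0 < e -> KL (f n) g <= e ^+ 2 ->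
    \int[vol]_x `|f n x - gibbs g x| <= 2 * e.
  move=> e0 he; have hp := pinsker vol0 beta0 mg gM (ff n).
  rewrite -(@ler_pXn2r _ 2%N)// ?nnegrE ?mulr_ge0 ?(ltW e0)//.
    by rewrite exprMn; apply: le_trans hp _; rewrite -natrX ler_wpM2l.
  by apply: Rintegral_ge0.
have convg : conv (gibbs g) = g.
  apply/funext => x; apply/eqP; rewrite -subr_eq0; apply/eqP.
  apply: (@eq0_le_small _ _ (2 * M + 1)) => e e0.
  have d0 : 0 < Num.min (e ^+ 2) e by rewrite lt_min e0 exprn_gt0.
  have [n _ [h1 _ h3]] := approx _ 0%N d0.
  have hd : \int[vol]_x `|f n x - gibbs g x| <= 2 * e.
    by apply: dist_le => //; rewrite (le_trans h1)// ge_min lexx.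
  have h4 : `|conv (f n) x - g x| <= e by rewrite (le_trans (h3 x))// ge_min lexx orbT.
  have h5 : `|conv (f n) x - conv (gibbs g) x| <= M * (2 * e).
    have [f1 g1] := (density_int (ff n).1, density_int fr.1).
    rewrite /conv_density -RintB; [|exact: (int_kM mk kM)..].
    rewrite (@eq_Rint _ _ _ _ _ (fun z => k x z * (f n z - gibbs g z))); last by move=> z; ring.
    apply: le_trans (RintM_le (measurable_k mk x) (kM x) (intB f1 g1)) _.
    by rewrite ler_wpM2l// ltW.
  move: h4 h5; rewrite !ler_norml => /andP[? ?] /andP[? ?]; apply/andP; split; lra.
have KLr : KL (gibbs g) (conv (gibbs g)) = 0 by rewrite convg; exact: KL_gibbs mg gM.
exists (gibbs g); split => //; first by rewrite convg.
- apply/eqP; rewrite -subr_eq0; apply/eqP.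
  apply: (@eq0_le_small _ _ (1 + beta^-1 + 2 * M)) => e e0.
  have [n _ [h1 h2 _]] := approx _ 0%N e0.
  (* The level is identified by the exact gap formula: both the relative entropy and the quadratic
     remainder are of order [e] along the sequence, although entropy itself is not continuous in
     $L^1$. *)
  have hg := free_energy_gap beta0 mk kM ksym (ff n) fr KLr.
  have hE := energyB_le mk kM (density_int (ff n).1) (density_int fr.1).
  have hp := pinsker vol0 beta0 mg gM (ff n).
  have hK := KL_ge0 vol0 beta0 mg gM (ff n).
  rewrite convg in hg.
  have hE2 : M * (\int[vol]_x `|f n x - gibbs g x|) ^+ 2 <= M * (4 * e).
    by rewrite ler_wpM2l ?(ltW M0)// (le_trans hp)// ler_wpM2l.
  have b1 : 0 < beta^-1 by rewrite invr_gt0.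
  have hK2 : beta^-1 * KL (f n) g <= beta^-1 * e by rewrite ler_wpM2l// ltW.
  have hK3 : 0 <= beta^-1 * KL (f n) g by rewrite mulr_ge0// ltW.
  move: (le_trans hE hE2) h2; rewrite !ler_norml => /andP[? ?] /andP[? ?].
  apply/andP; split; lra.
- move=> e e0 n0; have d0 : 0 < (e / 2) ^+ 2 by rewrite exprn_gt0// divr_gt0.
  have [n n0n [h1 _ _]] := approx _ n0 d0.
  exists n => //; have e20 : 0 < e / 2 by rewrite divr_gt0.
  by apply: le_trans (dist_le _ _ e20 h1) _; lra.
Qed.

End palais_smale.

(** * Geometry and topology of the torus *)

Section torus_basics.
Context {R : realType} {L : {posnum R}} {d : nat}.
Local Notation T := (torus L d).
Local Notation pi := (@to_torus R L d).
Implicit Types (u v : 'rV[R]_d) (x y : T).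

Lemma to_torus_surj x : exists u, pi u = x.
Proof. by exists (repr x); rewrite /to_torus reprK. Qed.

Lemma to_torusB u v : pi (u - v) = pi u - pi v.
Proof. exact: (pi_is_zmod_morphism (Quotient.quot (@lattice R L d))). Qed.

Lemma to_torus0 : pi 0 = 0.
Proof. by rewrite -(subrr (0 : 'rV[R]_d)) to_torusB subrr. Qed.

Lemma to_torusN u : pi (- u) = - pi u.
Proof. by rewrite -sub0r to_torusB to_torus0 sub0r. Qed.

Lemma to_torusD u v : pi (u + v) = pi u + pi v.
Proof. by rewrite -{1}[v]opprK to_torusB to_torusN opprK. Qed.

Lemma to_torus_lattice u : u \in @lattice R L d -> pi u = 0.
Proof.
move=> ul; rewrite -to_torus0; apply/eqquotP.
by rewrite Quotient.equivE subr0.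
Qed.

Lemma to_torus_cube u : exists2 v, pi v = pi u & forall i, 0 <= v ord0 i <= L%:num.
Proof.
exists (\row_i (u ord0 i - (Num.floor (u ord0 i / L%:num))%:~R * L%:num)).
  apply: subr0_eq; rewrite -to_torusB; apply: to_torus_lattice.
  apply/forallP => i; rewrite !mxE addrAC subrr sub0r mulNr mulfK//.
  by rewrite rpredN intr_int.
move=> i; rewrite mxE; have L0 : 0 < L%:num by [].
have /andP[] := floor_itv (u ord0 i / L%:num).
rewrite ler_pdivlMr// ltr_pdivrMr// intrD mulrDl mul1r => h1 h2.
by apply/andP; split; lra.
Qed.

Lemma enorm_ge0 u : 0 <= enorm u. Proof. exact: sqrtr_ge0. Qed.

Lemma enorm0 : enorm (0 : 'rV[R]_d) = 0.
Proof.
by rewrite /enorm big1 ?sqrtr0// => i _; rewrite mxE expr0n.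
Qed.

Lemma coord_le_enorm u i : `|u ord0 i| <= enorm u.
Proof.
rewrite -sqrtr_sqr /enorm ler_wsqrtr// (bigD1 i)//= lerDl.
by apply: sumr_ge0 => j _; exact: sqr_ge0.
Qed.

Lemma sum_coord_le_enorm u : \sum_i `|u ord0 i| <= d%:R * enorm u.
Proof.
apply: (@le_trans _ _ (\sum_(i < d) enorm u)).
  by apply: ler_sum => i _; exact: coord_le_enorm.
by rewrite sumr_const card_ord mulr_natl.
Qed.

Lemma continuous_enorm : continuous (@enorm R d).
Proof.
have csum (r : seq 'I_d) :
    continuous (fun v : 'rV[R]_d => \sum_(i <- r) v ord0 i ^+ 2).
  elim: r => [|i r ih].
    rewrite (_ : (fun _ => _) = cst 0); first exact: cst_continuous.
    by apply/funext => v; rewrite big_nil.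
  rewrite (_ : (fun _ => _) = (fun v : 'rV[R]_d => v ord0 i ^+ 2) \+
      (fun v => \sum_(j <- r) v ord0 j ^+ 2)); last first.
    by apply/funext => v; rewrite big_cons.
  move=> v; apply: continuousD; last exact: ih.
  apply: (@continuous_comp _ _ _ (fun v : 'rV[R]_d => v ord0 i) (fun r => r ^+ 2)).
    exact: coord_continuous.
  exact: exprn_continuous.
move=> u; apply: (@continuous_comp _ _ _ (fun v : 'rV[R]_d => \sum_i v ord0 i ^+ 2)).
  exact: csum.
exact: sqrt_continuous.
Qed.

(* The representatives over which [torus_dist] takes the infimum. *)
Definition dist_reps x : set R := [set enorm z | z in [set z | pi z = x]].

Lemma dist_reps_inf x : has_inf (dist_reps x).
Proof.
split; last by exists 0 => _ [z _ <-]; exact: enorm_ge0.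
by have [u ux] := to_torus_surj x; exists (enorm u), u.
Qed.

Lemma torus_distE x y : torus_dist x y = inf (dist_reps (x - y)).
Proof. by []. Qed.

Lemma torus_dist_ge0 x y : 0 <= torus_dist x y.
Proof.
apply: lb_le_inf; first by have [] := dist_reps_inf (x - y).
by move=> _ [z _ <-]; exact: enorm_ge0.
Qed.

Lemma torus_dist_le x y z : pi z = x - y -> torus_dist x y <= enorm z.
Proof.
move=> zE; apply: ge_inf; first by have [] := dist_reps_inf (x - y).
by exists z.
Qed.

Lemma torus_distxx x : torus_dist x x = 0.
Proof.
apply/eqP; rewrite eq_le torus_dist_ge0 andbT -enorm0.
by apply: torus_dist_le; rewrite subrr to_torus0.
Qed.

Definition torus_diameter : R := Num.sqrt (\sum_(i < d) L%:num ^+ 2).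

Lemma torus_dist_diameter x y : torus_dist x y <= torus_diameter.
Proof.
have [u ux] := to_torus_surj (x - y); have [v vu vc] := to_torus_cube u.
apply: le_trans (torus_dist_le (z := v) _) _; first by rewrite vu.
rewrite ler_wsqrtr//; apply: ler_sum => i _; have /andP[v0 vL] := vc i.
by rewrite ler_pXn2r// nnegrE.
Qed.

(** The preimage of the image of [U] is the union of the lattice translates of [U]. *)
Lemma open_to_torus (U : set 'rV[R]_d) : open U -> open (pi @` U : set T).
Proof.
move=> oU; suff oV : open (pi @^-1` (pi @` U)) by exact: oV.
have -> : pi @^-1` (pi @` U) = \bigcup_(l in [set l : 'rV[R]_d | pi l = 0])
    ((fun v : 'rV[R]_d => v - l) @^-1` U).
  apply/seteqP; split => [v [u Uu uv]|v [l /= l0 Uvl]].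
    exists (v - u); first by rewrite /= to_torusB uv; exact: subrr.
    by rewrite /= opprB addrC subrK.
  by exists (v - l) => //; rewrite to_torusB l0 subr0.
apply: bigcup_open => l _.
have /continuousP : continuous (fun v : 'rV[R]_d => v - l).
  move=> v; apply: (@continuousB R 'rV[R]_d 'rV[R]_d (fun v => v) (fun=> l)).
    by move=> ?.
  exact: cst_continuous.
exact.
Qed.

End torus_basics.

(** * Measurability on the torus and its square *)

Section torus_measurability.
Context {R : realType} {L : {posnum R}} {d : nat}.
Local Notation T := (torus L d).
Local Notation pi := (@to_torus R L d).

Lemma torus_open_measurable (U : set T) : open U -> measurable U.
Proof. by move=> oU; exact: sub_sigma_algebra. Qed.

Lemma torus_measurable_fun (f : T -> R) :
  continuous (f \o pi) -> measurable_fun setT f.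
Proof.
move=> /continuousP cf.
apply: (measurability (@measurable_realfun.RGenOInfty.G R)).
  exact: measurable_realfun.RGenOInfty.measurableE.
move=> _ [_ [r ->] <-]; rewrite setTI; apply: torus_open_measurable.
suff oV : open (pi @^-1` (f @^-1` `]r, +oo[%classic)) by exact: oV.
by apply: cf; exact: interval_open.
Qed.

(** An infimum is below [r] exactly when some representative has norm below [r], so strict sublevel
    sets are images of open balls and hence open. *)
Lemma torus_dist_measurable :
  measurable_fun setT (fun x : T => inf (dist_reps x)).
Proof.
apply: (measurability (@measurable_realfun.RGenInftyO.G R)).
  exact: measurable_realfun.RGenInftyO.measurableE.
move=> _ [_ [r ->] <-]; rewrite setTI; apply: torus_open_measurable.
rewrite (_ : _ @^-1` _ = pi @` (@enorm R d @^-1` `]-oo, r[%classic)).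
  apply: open_to_torus; move/continuousP: (@continuous_enorm R d); apply.
  exact: interval_open.
apply/seteqP; split => [x|_ [z zr <-]]; rewrite /= !in_itv/=.
  move=> /(inf_lt (dist_reps_inf x).1)[_ [z zx <-] zr].
  by exists z; rewrite //= in_itv.
apply: le_lt_trans (_ : enorm z < r); last by move: zr; rewrite /= in_itv.
by apply: ge_inf; [have [] := dist_reps_inf (pi z)|exists z].
Qed.

Definition rat_box (q : 'rV[rat]_d) (r : rat) : set 'rV[R]_d :=
  [set u | forall i, `|u ord0 i - ratr (q ord0 i)| < ratr r :> R].

Lemma rat_box_open q r : open (rat_box q r).
Proof.
rewrite openE => u ub; rewrite /interior; apply: (@filter_forall _ _ _ _ (nbhs_filter u)) => i.
have nb : nbhs (u ord0 i) `]ratr (q ord0 i) - ratr r, ratr (q ord0 i) + ratr r[%classic.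
  apply: open_nbhs_nbhs; split; first exact: interval_open.
  by rewrite /= in_itv /= -ltr_distl.
have := @coord_continuous _ _ _ ord0 i u _ nb.
rewrite nbhs_simpl; apply: (@filterS _ _ (nbhs_filter u)) => v /=.
by rewrite in_itv /= -ltr_distl.
Qed.

Lemma rat_box_center (u : 'rV[R]_d) (r : rat) : 0 < ratr r :> R ->
  exists q, rat_box q r u.
Proof.
move=> r0.
have /choice[q qP] (i : 'I_d) : exists q : rat, `|u ord0 i - ratr q| < ratr r :> R.
  have : u ord0 i - ratr r < u ord0 i + ratr r :> R by lra.
  move=> /rat_in_itvoo[q]; rewrite in_itv /= => qt; exists q.
  by rewrite ltr_distlC; lra.
by exists (\row_i q i) => i; rewrite mxE.
Qed.

(* The torus has a countable basis, so that [T * T] carries the Borel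
   sigma-algebra of the product topology. *)
Lemma torus_measurable_sub : measurable_fun setT (fun z : T * T => z.1 - z.2).
Proof.
apply: (@measurability _ _ _ T _ _ (@open T)) => //.
move=> _ [U oU <-]; rewrite setTI.
pose B (p : 'rV[rat]_d * 'rV[rat]_d * rat) : set (T * T) :=
  (pi @` rat_box p.1.1 p.2) `*` (pi @` rat_box p.1.2 p.2).
have mB p : measurable (B p).
  by apply: measurableX; apply: torus_open_measurable; apply: open_to_torus; exact: rat_box_open.
rewrite (_ : _ @^-1` U =
    \bigcup_(p in [set p | B p `<=` [set z | U (z.1 - z.2)]]) B p).
  rewrite bigcup_mkcond; apply: countable_bigcupT_measurable.
    exact: countableP.
  by move=> p; case: ifP.
apply/seteqP; split => [[x y] /= Uxy|z [p +]]; last exact.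
have [u ux] := to_torus_surj x; have [v vy] := to_torus_surj y.
have oV : open (pi @^-1` U) := oU.
have /nbhs_ballP[e /= e0 eV] : nbhs (u - v) (pi @^-1` U).
  by apply: open_nbhs_nbhs; split => //=; rewrite to_torusB ux vy.
have e40 : e / 8 < e / 4 by lra.
have [r /andP[r1 r2]] : exists r : rat, e / 8 < ratr r < e / 4.
  by have [r] := rat_in_itvoo e40; rewrite in_itv /=; exists r.
have r0 : 0 < ratr r :> R by lra.
have [q1 hq1] := rat_box_center u r0; have [q2 hq2] := rat_box_center v r0.
exists (q1, q2, r); last by split; [exists u|exists v].
move=> [x' y'] [/= [u' hu' ux'] [v' hv' vy']]; rewrite -ux' -vy'.
rewrite -to_torusB; apply: eV; split => //= i j; rewrite /ball /= !mxE.
have := hq1 j; have := hq2 j; have := hu' j; have := hv' j.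
rewrite (ord1 i) !ltr_norml => /andP[? ?] /andP[? ?] /andP[? ?] /andP[? ?].
apply/andP; split; lra.
Qed.

Lemma measurable_torus_dist : measurable_fun setT (fun z : T * T => torus_dist z.1 z.2).
Proof.
exact: (measurableT_comp torus_dist_measurable torus_measurable_sub).
Qed.

End torus_measurability.

(** * Lipschitz bounds from partial derivatives *)

Section coordinate_lipschitz.
Context {R : realType} {d : nat}.
Implicit Types (f : 'rV[R]_d -> R) (u v : 'rV[R]_d).

Lemma lipschitz_direction f (e : 'rV[R]_d) M :
  (forall u, derivable f u e) -> (forall u, `|'D_e f u| <= M) ->
  forall u t, `|f (u + t *: e) - f u| <= M * `|t|.
Proof.
move=> df Df u t; pose g s := f (u + s *: e).
have shiftE s : (fun h : R => h^-1 *: ((g \o shift s) (h *: (1 : R)) - g s)) =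
    (fun h => h^-1 *: ((f \o shift (u + s *: e)) (h *: e) - f (u + s *: e))).
  apply/funext => h; rewrite /g /= /shift /=; congr (_ *: (f _ - _)).
  by rewrite scalerDl addrCA /GRing.scale /= mulr1.
have dg (s : R) : derivable g s (1 : R) by rewrite /derivable shiftE; exact: df.
have Dg (s : R) : 'D_(1 : R) g s = 'D_e f (u + s *: e) by rewrite /derive shiftE.
have cg (i : interval R) : {within [set` i], continuous g}.
  by apply: derivable_within_continuous => x _.
have isd (s : R) : is_derive s (1 : R) g ('D_e f (u + s *: e)) by rewrite -Dg; apply: derivableP.
have -> : f u = g 0 by rewrite /g scale0r addr0.
rewrite -/(g t); have [t0|/ltW t0] := lerP 0 t.
  have [c _ ->] := MVT_segment t0 (fun x _ => isd x) (cg _).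
  by rewrite subr0 normrM ler_wpM2r.
have [c _ gE] := MVT_segment t0 (fun x _ => isd x) (cg _).
by rewrite distrC gE sub0r normrM normrN ler_wpM2r.
Qed.

Lemma enorm_le u (a : R) : 0 <= a -> (forall i, `|u ord0 i| <= a) ->
  enorm u <= Num.sqrt d%:R * a.
Proof.
move=> a0 ua; rewrite -[X in _ * X](ger0_norm a0) -sqrtr_sqr -sqrtrM//.
rewrite ler_wsqrtr//; apply: (@le_trans _ _ (\sum_(i < d) a ^+ 2)).
  by apply: ler_sum => i _; rewrite -real_normK ?num_real// ler_pXn2r ?nnegrE.
by rewrite sumr_const card_ord mulr_natl.
Qed.

(** Move from [u] to [u + v] one coordinate at a time and apply the one-dimensional mean value
    theorem on each leg; total differentiability is not invoked. *)
Lemma lipschitz_coordinates f M :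
  (forall i u, derivable f u 'e_i) -> (forall i u, `|'D_('e_i) f u| <= M) ->
  forall u v, `|f (u + v) - f u| <= M * \sum_i `|v ord0 i|.
Proof.
move=> df Df u v; rewrite {1}(row_sum_delta v).
elim: (index_enum 'I_d) => [|i r ih].
  by rewrite !big_nil addr0 subrr normr0 mulr0.
rewrite !big_cons mulrDr addrCA (addrC (_ *: _)).
set w := u + _ in ih *; rewrite -(subrK (f w) (f _)) -addrA.
apply: le_trans (ler_normD _ _) _; apply: lerD => //.
exact: lipschitz_direction.
Qed.

End coordinate_lipschitz.

(** * Regularity of the interaction potential *)

Section periodic.
Context {R : realType} {L : {posnum R}} {d : nat}.
Local Notation T := (torus L d).
Local Notation pi := (@to_torus R L d).

Lemma periodic_bounded (f : 'rV[R]_d -> R) : continuous f ->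
  (forall u v, pi u = pi v -> f u = f v) -> exists M, forall u, `|f u| <= M.
Proof.
move=> cf fper.
have cA := @rV_compact R d (fun=> `[0, L%:num]%classic) (fun=> @segment_compact R 0 L%:num).
have := continuous_compact (continuous_subspaceT cf) cA.
move=> /compact_bounded[M [_ hM]]; exists (M + 1) => u.
have [v vu vc] := @to_torus_cube R L d u; rewrite -(fper v u)//.
have M1 : M < M + 1 by rewrite ltrDl.
apply: (hM _ M1 (f v)).
by exists v => // i; rewrite /= in_itv /=; exact: vc.
Qed.

Lemma derive_periodic (f : 'rV[R]_d -> R) e u v :
  (forall u v, pi u = pi v -> f u = f v) -> pi u = pi v -> 'D_e f u = 'D_e f v.
Proof.
move=> fper uv; rewrite /derive.
have -> : (fun h : R => h^-1 *: ((f \o shift u) (h *: e) - f u)) =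
    (fun h => h^-1 *: ((f \o shift v) (h *: e) - f v)).
  apply/funext => h /=; rewrite /shift /= (fper _ _ uv); congr (_ *: (_ - _)).
  by apply: fper; rewrite !to_torusD uv.
by [].
Qed.

Variable W : T -> R.
Hypothesis W2 : torus_Ck 2 W.

Lemma W_periodic u v : pi u = pi v -> (W \o pi) u = (W \o pi) v.
Proof. by rewrite /= => ->. Qed.

Lemma W_measurable : measurable_fun setT W.
Proof. by case: W2 => cW _; exact: torus_measurable_fun. Qed.

Lemma W_bounded : exists2 M, 0 < M & forall x, `|W x| <= M.
Proof.
case: W2 => cW _; have [M hM] := periodic_bounded cW W_periodic.
exists (`|M| + 1); first by rewrite ltr_wpDl.
move=> x; have [u <-] := to_torus_surj x.
by apply: le_trans (hM u) _; rewrite (le_trans (ler_norm M))// lerDl.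
Qed.

(** The partial derivatives are continuous and periodic, hence bounded by compactness of the
    cube. *)
Lemma W_lipschitz : exists2 K, 0 < K & forall u v,
  `|W (pi (u + v)) - W (pi u)| <= K * enorm v.
Proof.
case: W2 => cW W1.
have /choice[m hm] i : exists M, forall u, `|'D_('e_i) (W \o pi) u| <= M.
  have [_ [cD _]] := W1 i; apply: periodic_bounded cD _ => u v uv.
  exact: derive_periodic W_periodic uv.
pose M := \sum_i `|m i|.
have hM i u : `|'D_('e_i) (W \o pi) u| <= M.
  apply: le_trans (hm i u) (le_trans (ler_norm _) _).
  by rewrite /M (bigD1 i)//= lerDl sumr_ge0.
have M0 : 0 <= M by apply: sumr_ge0.
exists (M * d%:R + 1); first by rewrite ltr_wpDl// mulr_ge0.
move=> u v.
have := lipschitz_coordinates (fun i => (W1 i).1) hM u v.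
move=> /le_trans; apply; rewrite mulrDl mul1r.
apply: le_trans (ler_wpM2l M0 (sum_coord_le_enorm v)) _.
by rewrite mulrA lerDl enorm_ge0.
Qed.

Lemma W_dist_lipschitz : exists2 K, 0 < K & forall x y,
  `|W x - W y| <= K * torus_dist x y.
Proof.
have [K K0 hK] := W_lipschitz; exists K => // x y.
rewrite -ler_pdivrMl// mulrC.
apply: lb_le_inf; first by have [] := dist_reps_inf (x - y).
move=> _ [z zxy <-]; rewrite ler_pdivrMr// mulrC.
have [u uy] := to_torus_surj y.
by have := hK u z; rewrite to_torusD uy zxy (addrC y) subrK.
Qed.

(** A grid of mesh $L/N$ in the cube works: the Lipschitz bound depends only on the displacement of
    the first argument, so one grid point serves all [y]. This is the equicontinuity input of the
    Palais-Smale property. *)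
Lemma W_net (e : R) : 0 < e -> exists (m : nat) (s : 'I_m -> T),
  forall x, exists i, forall y, `|W (x - y) - W (s i - y)| <= e.
Proof.
move=> e0; have [K K0 hK] := W_lipschitz.
have L0 : 0 < L%:num by [].
pose N := (Num.truncn (K * Num.sqrt (d%:R) * L%:num / e)).+1.
have N0 : 0 < N%:R :> R by [].
pose pt (c : {ffun 'I_d -> 'I_N.+1}) : T := pi (\row_i ((c i)%:R * L%:num / N%:R)).
exists #|{ffun 'I_d -> 'I_N.+1}|, (pt \o enum_val) => x.
have [u ux] := to_torus_surj x; have [v vu vc] := @to_torus_cube R L d u.
pose c : {ffun 'I_d -> 'I_N.+1} := [ffun i => inord (Num.truncn (v ord0 i * N%:R / L%:num))].
exists (enum_rank c) => y; rewrite /= enum_rankK.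
have [w wy] := to_torus_surj y.
pose q : 'rV[R]_d := \row_i ((c i)%:R * L%:num / N%:R).
have -> : pt c - y = pi (q - w) by rewrite to_torusB wy.
have -> : x - y = pi (q - w + (v - q)).
  by rewrite [q - w + _]addrC addrA subrK to_torusB vu ux wy.
apply: le_trans (hK _ _) _.
have cq i : `|(v - q) ord0 i| <= L%:num / N%:R.
  have /andP[v0 vL] := vc i.
  have vN0 : 0 <= v ord0 i * N%:R / L%:num by rewrite divr_ge0// mulr_ge0.
  have cE : nat_of_ord (c i) = Num.truncn (v ord0 i * N%:R / L%:num).
    rewrite ffunE inordK// ltnS -(ler_nat R).
    apply: le_trans (_ : _ <= v ord0 i * N%:R / L%:num) _; first by rewrite truncn_le.
    by rewrite ler_pdivrMr// mulrC ler_wpM2l.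
  rewrite !mxE cE; have /andP[h1 h2] := truncn_itv vN0.
  move: h1; rewrite ler_pdivlMr// => h1; move: h2; rewrite ltr_pdivrMr// => h2.
  move: (Num.truncn _) h1 h2 => n h1 h2.
  rewrite -ler_pdivrMr ?invr_gt0// invrK.
  rewrite -[X in _ * X](ger0_norm (ltW N0)) -normrM mulrBl mulfVK ?gt_eqF//.
  rewrite -natr1 mulrDl mul1r in h2.
  rewrite ger0_norm; lra.
have hn := enorm_le (ltW (divr_gt0 L0 N0)) cq.
apply: le_trans (ler_wpM2l (ltW K0) hn) _.
have x0 : 0 <= K * Num.sqrt d%:R * L%:num / e.
  by rewrite divr_ge0 ?(ltW e0)// !mulr_ge0 ?sqrtr_ge0 ?(ltW K0).
have /andP[_] := truncn_itv x0; rewrite -/N ltr_pdivrMr// => hN.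
by rewrite !mulrA ler_pdivrMr// mulrC (mulrC N%:R) in hN *; lra.
Qed.

End periodic.

(** * Images and products of probability measures *)

Section pushforward.
Context {d1 d2 : measure_display} {T1 : measurableType d1} {T2 : measurableType d2}.
Context {R : realType}.
Implicit Types (p : probability T1 R).

Lemma pushforward_probability p (f : T1 -> T2) : measurable_fun setT f ->
  exists q : probability T2 R, (forall A, q A = p (f @^-1` A)) /\
    forall (h : T2 -> R) B, measurable_fun setT h -> bounded_by h B ->
      \int[q]_x h x = \int[p]_x h (f x).
Proof.
move=> mf; pose m := fpushforward p mf.
have m1 : m setT = 1%E.
  by rewrite /m /fpushforward /pushforward preimage_setT; exact: (@probability_setT _ _ _ p).
have [q qm] := probability_of_measure m1.
exists q; split => [A|h B mh hB]; first by rewrite qm.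
rewrite /Rintegral; congr fine.
transitivity (\int[pushforward p f]_x (h x)%:E)%E.
  by apply: eq_measure_integral => A _ _; exact: (congr1 (@^~ A) qm).
have hi : p.-integrable setT (EFin \o (h \o f)).
  by apply: (@int_bounded _ _ _ _ _ B) => [|x]; [exact: measurableT_comp|exact: hB].
rewrite integral_pushforward ?preimage_setT//; exact/measurable_EFinP.
Qed.

Lemma product_probability p (q : probability T2 R) :
  exists r : probability (T1 * T2)%type R,
    forall A B, measurable A -> measurable B -> (r (A `*` B) = p A * q B)%E.
Proof.
have m1 : (p \x q)%E setT = 1%E.
  rewrite -setXTT product_measure1E// [X in (X * _)%E]probability_setT.
  by rewrite [X in (_ * X)%E]probability_setT mule1.
have [r rm] := probability_of_measure m1.
by exists r => A B mA mB; rewrite rm; exact: product_measure1E.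
Qed.

End pushforward.

(** * Couplings and the Wasserstein distance *)

Section wasserstein.
Context {R : realType} {L : {posnum R}} {d : nat}.
Local Notation T := (torus L d).
Local Notation P := (probability T R).
Local Notation D := (@torus_diameter R L d).
Implicit Types (mu nu p q : P) (pi : probability (T * T)%type R).

Definition cost pi := \int[pi]_z (torus_dist z.1 z.2 ^+ 2).

Lemma measurable_dist2 : measurable_fun setT (fun z : T * T => torus_dist z.1 z.2 ^+ 2).
Proof. by apply: measurable_funX; exact: measurable_torus_dist. Qed.

Lemma dist2_bounded : bounded_by (fun z : T * T => torus_dist z.1 z.2 ^+ 2) (D ^+ 2).
Proof.
move=> z; rewrite ger0_norm ?sqr_ge0//.
by rewrite ler_pXn2r ?nnegrE ?torus_dist_ge0 ?sqrtr_ge0 ?torus_dist_diameter.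
Qed.

Lemma int_dist2 pi : pi.-integrable setT (EFin \o (fun z => torus_dist z.1 z.2 ^+ 2)).
Proof. exact: int_bounded measurable_dist2 dist2_bounded. Qed.

Lemma costE pi : (\int[pi]_z (torus_dist z.1 z.2 ^+ 2)%:E)%E = (cost pi)%:E.
Proof. by rewrite EFin_Rint//; exact: int_dist2. Qed.

Lemma cost_ge0 pi : 0 <= cost pi.
Proof. by apply: Rintegral_ge0 => z _; exact: sqr_ge0. Qed.

Lemma cost_le pi : cost pi <= D ^+ 2.
Proof.
by apply: le_trans (ler_norm _) (Rint_prob_bounded _ measurable_dist2 dist2_bounded).
Qed.

Lemma product_coupling mu nu : exists pi, coupling mu nu pi.
Proof.
have [r rE] := product_probability mu nu; exists r; split => A mA.
- by rewrite rE// probability_setT mule1.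
- by rewrite rE// probability_setT mul1e.
Qed.

Lemma diagonal_coupling mu : exists2 pi, coupling mu mu pi & cost pi = 0.
Proof.
have md : measurable_fun setT (fun x : T => (x, x)) by exact: measurable_fun_pair.
have [q [qE qI]] := pushforward_probability mu md.
exists q.
  by split => A mA; rewrite qE; congr (mu _); apply/seteqP; split => x //= -[].
rewrite /cost (qI _ _ measurable_dist2 dist2_bounded).
rewrite (@eq_Rint _ _ _ _ _ (cst 0)); first by rewrite /= Rintegral_cst// mul0r.
by move=> x; rewrite /= torus_distxx expr0n.
Qed.

Lemma W2_ge0 mu nu : 0 <= W2 mu nu. Proof. exact: sqrtr_ge0. Qed.

Lemma W2_sqr mu nu : (W2 mu nu ^+ 2)%:E =
  ereal_inf [set (cost pi)%:E | pi in coupling mu nu].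
Proof.
have -> : [set (cost pi)%:E | pi in coupling mu nu] =
    [set (\int[pi]_z (torus_dist z.1 z.2 ^+ 2)%:E)%E | pi in coupling mu nu].
  by apply/seteqP; split => _ [pi cpi <-]; exists pi => //; rewrite costE.
set S := [set _ | _ in _].
have S0 : (0 <= ereal_inf S)%E.
  by apply/le_ereal_inf_tmp => _ [pi _ <-]; rewrite costE lee_fin cost_ge0.
have Sfin : (ereal_inf S)%E \is a fin_num.
  rewrite ge0_fin_numE//; have [pi cpi] := product_coupling mu nu.
  apply: le_lt_trans (ltry (cost pi)); apply: ereal_inf_lbound.
  by exists pi => //; rewrite costE.
by rewrite /W2 sqr_sqrtr ?fine_ge0// fineK.
Qed.

Lemma W2_le mu nu pi : coupling mu nu pi -> W2 mu nu ^+ 2 <= cost pi.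
Proof.
by move=> cpi; rewrite -lee_fin W2_sqr; apply: ereal_inf_lbound; exists pi.
Qed.

Lemma W2_ge mu nu c : (forall pi, coupling mu nu pi -> c <= cost pi) ->
  c <= W2 mu nu ^+ 2.
Proof.
move=> h; rewrite -lee_fin W2_sqr; apply/le_ereal_inf_tmp => _ [pi cpi <-].
by rewrite lee_fin h.
Qed.

Lemma W2xx mu : W2 mu mu = 0.
Proof.
have [pi cpi c0] := diagonal_coupling mu; have := W2_le cpi.
by rewrite c0 => h; apply/eqP; rewrite -sqrf_eq0 eq_le h sqr_ge0.
Qed.

(** The shared component [G] stays in place at no cost, [pi] transports the first component, and the
    last is moved by a product plan at cost at most the squared diameter. Both continuity of
    segments and continuity of the relaxation reduce to this. *)
Lemma coupling_mix mu nu (G : P) p q mu' nu' pi (a1 a2 a3 : R) :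
  0 <= a1 -> 0 <= a2 -> 0 <= a3 -> a1 + a2 + a3 = 1 -> coupling mu nu pi ->
  (forall A, measurable A -> (mu' A = a1%:E * mu A + a2%:E * G A + a3%:E * p A)%E) ->
  (forall A, measurable A -> (nu' A = a1%:E * nu A + a2%:E * G A + a3%:E * q A)%E) ->
  W2 mu' nu' ^+ 2 <= a1 * cost pi + a3 * D ^+ 2.
Proof.
move=> a10 a20 a30 asum cpi mu'E nu'E.
have [pi2 [c2l c2r] c20] := diagonal_coupling G.
have [pi3 [c3l c3r]] := product_coupling p q.
have [r [rE rI]] := mixture3_exists pi pi2 pi3 a10 a20 a30 asum.
have cr : coupling mu' nu' r.
  have [cl cr] := cpi.
  by split => A mA; rewrite rE ?mu'E ?nu'E// ?cl ?c2l ?c3l ?cr ?c2r ?c3r.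
apply: le_trans (W2_le cr) _; rewrite -lee_fin -costE rI; last 2 first.
- by apply/measurable_EFinP; exact: measurable_dist2.
- by move=> z; rewrite lee_fin sqr_ge0.
rewrite !costE c20 -!EFinM -!EFinD lee_fin mulr0 addr0 lerD2l.
by rewrite ler_wpM2l// cost_le.
Qed.

Lemma W2_mix mu nu (G : P) p q mu' nu' (a1 a2 a3 : R) :
  0 <= a1 -> 0 <= a2 -> 0 <= a3 -> a1 + a2 + a3 = 1 ->
  (forall A, measurable A -> (mu' A = a1%:E * mu A + a2%:E * G A + a3%:E * p A)%E) ->
  (forall A, measurable A -> (nu' A = a1%:E * nu A + a2%:E * G A + a3%:E * q A)%E) ->
  W2 mu' nu' ^+ 2 <= W2 mu nu ^+ 2 + a3 * D ^+ 2.
Proof.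
move=> a10 a20 a30 asum mu'E nu'E; rewrite -lerBlDr; apply: W2_ge => pi cpi.
have := coupling_mix a10 a20 a30 asum cpi mu'E nu'E.
have a11 : a1 <= 1 by lra.
have := ler_wpM2r (cost_ge0 pi) a11; lra.
Qed.

(** This is the Cauchy-Schwarz inequality for $\phi(x)-\phi(y)$ under the plan. *)
Lemma coupling_Lipschitz (phi : T -> R) B K mu nu pi : measurable_fun setT phi ->
  bounded_by phi B -> (forall x y, `|phi x - phi y| <= K * torus_dist x y) ->
  coupling mu nu pi ->
  (\int[mu]_x phi x - \int[nu]_x phi x) ^+ 2 <= K ^+ 2 * cost pi.
Proof.
move=> mphi phiB phiK [cl cr].
have [q1 [q1E q1I]] := pushforward_probability pi (@measurable_fst _ _ T T).
have [q2 [q2E q2I]] := pushforward_probability pi (@measurable_snd _ _ T T).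
have -> : \int[mu]_x phi x = \int[pi]_z phi z.1.
  rewrite -(q1I _ _ mphi phiB) /Rintegral; congr fine; apply: eq_measure_integral => A mA _.
  rewrite -[LHS](cl A mA) [RHS]q1E; congr (pi _).
  by apply/seteqP; split => z //= -[].
have -> : \int[nu]_x phi x = \int[pi]_z phi z.2.
  rewrite -(q2I _ _ mphi phiB) /Rintegral; congr fine; apply: eq_measure_integral => A mA _.
  rewrite -[LHS](cr A mA) [RHS]q2E; congr (pi _).
  by apply/seteqP; split => z //= -[].
have i1 : pi.-integrable setT (EFin \o (fun z : T * T => phi z.1)).
  by apply: (@int_bounded _ _ _ _ _ B) => //; exact: measurableT_comp mphi measurable_fst.
have i2 : pi.-integrable setT (EFin \o (fun z : T * T => phi z.2)).
  by apply: (@int_bounded _ _ _ _ _ B) => //; exact: measurableT_comp mphi measurable_snd.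
rewrite -RintB//; have i12 := intB i1 i2.
set Delta := \int[pi]_z _.
have [->|Dn0] := eqVneq Delta 0.
  by rewrite expr0n /= mulr_ge0 ?sqr_ge0 ?cost_ge0.
have a0 : 0 < `|Delta| by rewrite normr_gt0.
have id := int_dist2 pi.
have c1 : pi.-integrable setT (EFin \o (fun=> `|Delta| / 2)).
  apply: (@int_bounded _ _ _ _ _ (`|Delta| / 2)) => // z.
  by rewrite normrM normr_id [X in _ * X]ger0_norm ?invr_ge0.
(* Young's inequality weighted by the quantity being estimated: multiplying by it afterwards gives
   the sharp quadratic bound. *)
have : `|Delta| <= K ^+ 2 / (2 * `|Delta|) * cost pi + `|Delta| / 2.
  apply: le_trans (Rint_norm i12) _.
  rewrite -[X in _ <= _ + X](Rint_prob_cst pi) -(RintZ _ id) -RintD//; last exact: intZ.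
  apply: Rint_le; [exact: int_abs|by apply: intD => //; exact: intZ|].
  move=> z; apply: le_trans (phiK _ _) _; set t := torus_dist _ _.
  have : 0 <= (2 * `|Delta|)^-1 * (K * t - `|Delta|) ^+ 2.
    by rewrite mulr_ge0 ?sqr_ge0// invr_ge0 mulr_ge0.
  have -> : (2 * `|Delta|)^-1 * (K * t - `|Delta|) ^+ 2 =
      K ^+ 2 / (2 * `|Delta|) * t ^+ 2 + `|Delta| / 2 - K * t.
    by field; rewrite gt_eqF.
  by rewrite subr_ge0.
rewrite -[Delta ^+ 2]real_normK ?num_real//.
move: a0; set a := `|Delta| => a0 h.
have : a * a <= a * (K ^+ 2 / (2 * a) * cost pi + a / 2) by rewrite ler_wpM2l// ltW.
have -> : a * (K ^+ 2 / (2 * a) * cost pi + a / 2) = (K ^+ 2 * cost pi + a ^+ 2) / 2.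
  by field; rewrite gt_eqF.
by rewrite expr2; lra.
Qed.

Lemma W2_Lipschitz (phi : T -> R) B K mu nu : measurable_fun setT phi ->
  bounded_by phi B -> 0 < K ->
  (forall x y, `|phi x - phi y| <= K * torus_dist x y) ->
  `|\int[mu]_x phi x - \int[nu]_x phi x| <= K * W2 mu nu.
Proof.
move=> mphi phiB K0 phiK.
rewrite -(@ler_pXn2r _ 2%N)// ?nnegrE ?mulr_ge0 ?W2_ge0 ?(ltW K0)// exprMn.
rewrite real_normK ?num_real// -ler_pdivrMl ?exprn_gt0//.
apply: W2_ge => pi cpi; rewrite ler_pdivrMl ?exprn_gt0//.
exact: coupling_Lipschitz mphi phiB phiK cpi.
Qed.

End wasserstein.

(** * Comparing measures through their densities *)

Section measures.
Context {dT : measure_display} {T : measurableType dT} {R : realType}.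
Variables (vol : {finite_measure set T -> \bar R}).
Implicit Types (f g h : T -> R) (mu nu p q : probability T R).

Lemma prob_fineE mu A : measurable A -> mu A = (fine (mu A))%:E.
Proof. by move=> mA; rewrite fineK// fin_num_measure. Qed.

Lemma prob_Rint_indic mu A : measurable A -> fine (mu A) = \int[mu]_x \1_A x.
Proof. by move=> mA; rewrite /Rintegral integral_indic// setIT. Qed.

Lemma indic_bounded (A : set T) : bounded_by (\1_A : T -> R) 1.
Proof. by move=> x; rewrite indicE; case: (_ \in _); rewrite ?normr1 ?normr0. Qed.

Lemma has_density_dist mu nu f g : has_density vol mu f -> has_density vol nu g ->
  forall A, measurable A -> (`|mu A - nu A| <= (\int[vol]_x `|f x - g x|)%:E)%E.
Proof.
move=> muf nug A mA; have [f1 g1] := (density_int muf.1, density_int nug.1).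
have m1 : measurable_fun setT (\1_A : T -> R) by exact: measurable_indic.
have b1 := indic_bounded A.
rewrite (prob_fineE mu mA) (prob_fineE nu mA) -EFinB abse_EFin lee_fin.
rewrite (prob_Rint_indic mu mA) (prob_Rint_indic nu mA) (Rint_has_density muf m1 b1) (Rint_has_density nug m1 b1).
rewrite -RintB; [|exact: intM b1 f1|exact: intM b1 g1].
rewrite (@eq_Rint _ _ _ _ _ (fun x => \1_A x * (f x - g x))); last by move=> x; ring.
by rewrite -[leRHS]mul1r; apply: RintM_le => //; exact: intB.
Qed.

Lemma has_density_eq mu nu f g : has_density vol mu f -> has_density vol nu g ->
  \int[vol]_x `|f x - g x| = 0 -> measure_eq mu nu.
Proof.
move=> muf nug fg0 A mA; have := has_density_dist muf nug mA.
rewrite fg0 (prob_fineE mu mA) (prob_fineE nu mA) -EFinB abse_EFin lee_fin normr_le0.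
rewrite subr_eq0 => /eqP h; have := prob_fineE mu mA.
by rewrite h -(prob_fineE nu mA).
Qed.

Lemma has_density_measure_eq mu nu f : measure_eq mu nu ->
  has_density vol mu f -> has_density vol nu f.
Proof.
move=> munu [fd fE]; split => // A mA.
exact: etrans (esym (munu A mA)) (fE A mA).
Qed.

Lemma has_density_same mu nu f : has_density vol mu f -> has_density vol nu f ->
  measure_eq mu nu.
Proof. by move=> [_ fE] [_ gE] A mA; exact: etrans (fE A mA) (esym (gE A mA)). Qed.

Lemma Rint_measure_eq mu nu h : measure_eq mu nu -> \int[mu]_x h x = \int[nu]_x h x.
Proof. by move=> munu; rewrite /Rintegral; congr fine; apply: eq_measure_integral => A mA _; exact: munu. Qed.

Lemma mixture_has_density p q nu f g (t : R) : 0 <= t <= 1 ->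
  has_density vol p f -> has_density vol q g ->
  (forall A, measurable A -> nu A = ((1 - t)%:E * p A + t%:E * q A)%E) ->
  has_density vol nu (fun x => (1 - t) * f x + t * g x).
Proof.
move=> /andP[t0 t1] pf qg nuE; have [f1 g1] := (density_int pf.1, density_int qg.1).
have [[[mf f0 fI] pE] [[mg g0 gI] qE]] := (pf, qg).
have t1' : 0 <= 1 - t by rewrite subr_ge0.
have E A : measurable A -> (nu A = \int[vol]_(x in A) ((1 - t) * f x + t * g x)%:E)%E.
  move=> mA; rewrite nuE// pE// qE//.
  under [RHS]eq_integral do rewrite EFinD !EFinM.
  have mfA : measurable_fun A (fun x => (f x)%:E) by exact/measurable_EFinP/measurable_funTS.
  have mgA : measurable_fun A (fun x => (g x)%:E) by exact/measurable_EFinP/measurable_funTS.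
  have fA x : A x -> (0 <= (f x)%:E)%E by rewrite lee_fin.
  have gA x : A x -> (0 <= (g x)%:E)%E by rewrite lee_fin.
  rewrite ge0_integralD//.
  - by rewrite !ge0_integralZl// lee_fin.
  - by move=> x _; rewrite mule_ge0 ?lee_fin.
  - exact: emeasurable_funM.
  - by move=> x _; rewrite mule_ge0 ?lee_fin.
  - exact: emeasurable_funM.
split => //; split => [|x|].
- by apply: measurable_funD; apply: measurable_funM.
- by rewrite addr_ge0 ?mulr_ge0.
- by rewrite -E// probability_setT.
Qed.

End measures.

Section mixture_integral.
Context {dT : measure_display} {T : measurableType dT} {R : realType}.
Implicit Types (p q : probability T R).

(** The formula for mixtures is available for nonnegative functions; adding the bound [B] to [h]
    reduces to that case, and the constant cancels because all three measures have mass one. *)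
Lemma mixture_Rint p1 p2 q (t : R) (h : T -> R) B : 0 <= t <= 1 ->
  (forall A, measurable A -> q A = ((1 - t)%:E * p1 A + t%:E * p2 A)%E) ->
  measurable_fun setT h -> bounded_by h B ->
  \int[q]_x h x = (1 - t) * \int[p1]_x h x + t * \int[p2]_x h x.
Proof.
move=> /andP[t0 t1] qE mh hB.
have t1' : 0 <= 1 - t by rewrite subr_ge0.
have [r [rE rI]] := mixture3_exists p1 p2 p2 t1' t0 (lexx 0) (ltac:(by rewrite addr0 subrK)).
have qr : measure_eq q r.
  move=> A mA; apply: etrans (qE A mA) _.
  by apply: esym; apply: etrans (rE A) _; rewrite mul0e adde0.
rewrite (Rint_measure_eq h qr).
have hi p : p.-integrable setT (EFin \o h) by exact: int_bounded mh hB.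
have Bi p : p.-integrable setT (EFin \o (fun=> B)).
  by apply: (@int_bounded _ _ _ _ _ `|B|) => // x.
have mhB : measurable_fun setT (EFin \o (fun x => h x + B)).
  by apply/measurable_EFinP; apply: measurable_funD.
have hB0 x : (0 <= (h x + B)%R%:E)%E.
  by rewrite lee_fin; have := hB x; rewrite ler_norml => /andP[? _]; lra.
have iB p := intD (hi p) (Bi p).
have := rI _ mhB hB0; rewrite /= mul0e adde0.
rewrite (EFin_Rint (iB r)) (EFin_Rint (iB p1)) (EFin_Rint (iB p2)).
rewrite -!EFinM -EFinD => -[].
by rewrite !(RintD (hi _) (Bi _)) !Rint_prob_cst; lra.
Qed.

End mixture_integral.

(** * Minimisers, almost minimisers and fixed points *)

Section minimisers.
Context {dT : measure_display} {T : measurableType dT} {R : realType}.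
Variables (vol : {finite_measure set T -> \bar R}).
Variables (k : T -> T -> R) (M : R).
Hypothesis vol0 : (0 < vol setT)%E.
Hypothesis M0 : 0 < M.
Hypothesis mk : measurable_fun setT (fun z : T * T => k z.1 z.2).
Hypothesis kM : forall x y, `|k x y| <= M.
Hypothesis ksym : forall x y, k x y = k y x.
Implicit Types (f g h : T -> R) (mu nu : probability T R).

Local Notation conv := (conv_density vol k).
Local Notation mconv := (conv_prob k).

Section fixed_beta.
Variable beta : R.
Hypothesis beta0 : 0 < beta.
Local Notation F := (density_free_energy vol k beta).
Local Notation KL := (KL vol beta).
Local Notation gibbs := (gibbs vol beta).
Local Notation I := (kernel_free_energy vol k beta).
Local Notation t0 := (relax_step beta M).

Definition is_minimiser mu := forall nu, (I mu <= I nu)%E.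

Lemma free_energy_densityE mu f : has_density vol mu f -> fin_ent vol f -> I mu = (F f)%:E.
Proof. by move=> muf [_ fi]; exact: kernel_free_energyE mk kM _ _ _ muf fi. Qed.

Lemma free_energy_lty mu : (I mu < +oo)%E ->
  exists f, [/\ has_density vol mu f, fin_ent vol f & I mu = (F f)%:E].
Proof.
move=> /(kernel_free_energy_lty mk kM beta0)[f muf fi].
have ff : fin_ent vol f by split => //; exact: muf.1.
by exists f; split => //; exact: free_energy_densityE.
Qed.

Lemma free_energy_measure_eq mu nu : measure_eq mu nu -> I mu = I nu.
Proof.
have main (m1 m2 : probability T R) : measure_eq m1 m2 -> (I m1 < +oo)%E -> I m1 = I m2.
  move=> m12 /free_energy_lty[f [m1f ff ->]].
  by rewrite (free_energy_densityE (has_density_measure_eq m12 m1f) ff).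
move=> munu; have [multy|] := ltP (I mu) +oo%E; first exact: main.
have [nulty _|] := ltP (I nu) +oo%E.
  by apply/esym/main => // A mA; exact/esym/munu.
by rewrite !leye_eq => /eqP -> /eqP ->.
Qed.

(** The Gibbs density of the zero potential is a competitor of finite free energy. *)
Lemma minimiser_density mu : is_minimiser mu ->
  exists f, [/\ has_density vol mu f, fin_ent vol f & I mu = (F f)%:E].
Proof.
move=> mumin; apply: free_energy_lty.
have mc : measurable_fun setT (fun _ : T => 0 : R) by [].
have bc : bounded_by (fun _ : T => 0 : R) 0 by move=> x; rewrite normr0.
have fg := fin_ent_gibbs vol0 beta0 mc bc.
have [nu nug] := density_probability fg.1.
by apply: le_lt_trans (mumin nu) _; rewrite (free_energy_densityE nug fg) ltry.
Qed.

(* The relaxation step lowers the free energy by a multiple of the relative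
   entropy, so that almost minimisers are almost fixed points. *)
Lemma almost_minimiser_KL mu f e : is_minimiser mu -> fin_ent vol f ->
  ((F f)%:E <= I mu + e%:E)%E -> KL f (conv f) <= 2 * beta / t0 * e.
Proof.
move=> mumin ff Ff; have [g [mug fg Imu]] := minimiser_density mumin.
have fr := fin_ent_relax vol0 beta0 M0 mk kM ff.
have [nu nur] := density_probability fr.1.
have := mumin nu; rewrite (free_energy_densityE nur fr) Imu lee_fin => h.
move: Ff; rewrite Imu -EFinD lee_fin => h2.
have := relax_decrease vol0 beta0 M0 mk kM ksym ff.
have t0_gt0 := relax_step_gt0 beta0 M0; move=> h3.
have h4 : t0 / (2 * beta) * KL f (conv f) <= e by lra.
rewrite (_ : KL f (conv f) = 2 * beta / t0 * (t0 / (2 * beta) * KL f (conv f))).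
  by rewrite ler_wpM2l// divr_ge0 ?mulr_ge0// ltW.
by field; rewrite !gt_eqF.
Qed.

Lemma minimiser_KL0 mu f : is_minimiser mu -> has_density vol mu f ->
  fin_ent vol f -> KL f (conv f) = 0.
Proof.
move=> mumin muf ff; apply/eqP; rewrite eq_le.
have mc := measurable_conv_density mk kM ff.1; have bc := conv_density_bounded mk kM ff.1.
rewrite (KL_ge0 vol0 beta0 mc bc ff) andbT.
have := @almost_minimiser_KL mu f 0 mumin ff; rewrite mulr0; apply.
by rewrite adde0 (free_energy_densityE muf ff).
Qed.

Lemma KL0_gibbs mu f G : has_density vol mu f -> fin_ent vol f ->
  KL f (conv f) = 0 -> has_density vol G (gibbs (conv f)) -> measure_eq mu G.
Proof.
move=> muf ff K0 Gg; apply: (has_density_eq muf Gg).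
have mc := measurable_conv_density mk kM ff.1; have bc := conv_density_bounded mk kM ff.1.
have := pinsker vol0 beta0 mc bc ff; rewrite K0 mulr0 => h.
by apply/eqP; rewrite -sqrf_eq0 eq_le h sqr_ge0.
Qed.

(** Relaxation cannot lower the free energy of a minimiser, so its relative entropy vanishes and
    Pinsker's inequality identifies it with its Gibbs measure. *)
Lemma minimiser_gibbs mu G : is_minimiser mu ->
  has_density vol G (gibbs (mconv mu)) -> measure_eq mu G.
Proof.
move=> mumin; have [f [muf ff _]] := minimiser_density mumin.
have -> : mconv mu = conv f by apply/funext => x; exact: mconv_conv mk kM _ _ muf x.
by move=> Gg; apply: (KL0_gibbs muf ff _ Gg); exact: (minimiser_KL0 mumin muf ff).
Qed.

(** A minimiser is the Gibbs measure of its potential, hence determined by that potential. The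
    separating point is what distinguishes the mountain pass measure from both ends. *)
Lemma minimisers_separated mu nu : is_minimiser mu -> is_minimiser nu ->
  ~ measure_eq mu nu -> exists x, mconv mu x != mconv nu x.
Proof.
move=> mumin numin; apply: contra_notP => /forallNP h A mA.
have E : mconv mu = mconv nu.
  by apply/funext => x; apply/eqP; have := h x; move=> /negP; rewrite negbK.
have fg := fin_ent_gibbs vol0 beta0 (measurable_mconv mk kM mu) (mconv_bounded mk kM mu).
have [G Gg] := density_probability fg.1.
have Gg' := Gg; rewrite E in Gg'.
exact: etrans (minimiser_gibbs mumin Gg mA) (esym (minimiser_gibbs numin Gg' mA)).
Qed.

(* Completing the square in Pinsker's inequality absorbs the interaction,
   which leaves a bound quadratic in the distance between the potentials. *)
Lemma critical_gap rho f e : fin_ent vol rho -> rho = gibbs (conv rho) ->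
  fin_ent vol f -> bounded_by (fun x => conv f x - conv rho x) e ->
  F rho - F f <= beta / 4 * e ^+ 2.
Proof.
move=> fr rhoE ff fe.
have mc := measurable_conv_density mk kM fr.1; have bc := conv_density_bounded mk kM fr.1.
have K0 : KL rho (conv rho) = 0 by rewrite {1}rhoE; exact: KL_gibbs mc bc.
have gap := free_energy_gap beta0 mk kM ksym ff fr K0.
have [f1 r1] := (density_int ff.1, density_int fr.1).
have he : bounded_by (conv (fun x => f x - rho x)) e.
  move=> x; rewrite (_ : (fun x => f x - rho x) = (fun x => 1 * f x + (-1) * rho x)).
    by rewrite (convD mk kM)// mul1r mulN1r; exact: fe.
  by apply/funext => y; ring.
have hE := energy_le mk kM (intB f1 r1) he.
have hK := KL_ge0 vol0 beta0 mc bc ff.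
(* A positive volume forces [T] to be inhabited, and any point shows that the bound [e] is
   nonnegative. *)
have [[x _]|T0] := pselect (exists x : T, True); last first.
  by exfalso; move: vol0; rewrite (_ : setT = set0) ?measure0 ?ltxx//;
    apply/seteqP; split => // x; case: T0; exists x.
have e_ge0 : 0 <= e by exact: le_trans (normr_ge0 _) (fe x).
have b1 : 0 < beta^-1 by rewrite invr_gt0.
have bK : 0 <= beta^-1 * KL f (conv rho) by rewrite mulr_ge0// ltW.
move: e_ge0; rewrite le_eqVlt => /predU1P[e0|e_gt0].
  move: hE; rewrite -e0 mul0r normr_le0 => /eqP hE.
  rewrite hE mulr0 addr0 in gap; rewrite expr0n /= mulr0; lra.
(* With this weight, half of the bound on the interaction contains exactly $\beta^{-1}$ times the
   relative entropy, which cancels the entropy term of the gap. *)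
have a0 : 0 < beta * e / 4 by rewrite divr_gt0// mulr_gt0.
have := pinsker_linear vol0 beta0 mc bc ff a0; rewrite -rhoE => hp.
have := le_trans hE (ler_wpM2l (ltW e_gt0) hp).
have -> : e * ((2 * (beta * e / 4))^-1 * KL f (conv rho) + 2 * (beta * e / 4)) =
    2 * (beta^-1 * KL f (conv rho)) + 2 * (beta / 4 * e ^+ 2).
  by field; rewrite !gt_eqF.
by rewrite ler_norml => /andP[? _]; lra.
Qed.

End fixed_beta.

End minimisers.

Lemma mixture_exists {dT : measure_display} {T : measurableType dT} {R : realType}
    (p1 p2 : probability T R) (t : R) : 0 <= t <= 1 ->
  exists q : probability T R,
    forall A, measurable A -> q A = ((1 - t)%:E * p1 A + t%:E * p2 A)%E.
Proof.
move=> /andP[t0 t1]; have t1' : 0 <= 1 - t by rewrite subr_ge0.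
have s1 : 1 - t + t + 0 = 1 by rewrite addr0 subrK.
have [q [qE _]] := mixture3_exists p1 p2 p2 t1' t0 (lexx 0) s1.
by exists q => A _; rewrite qE mul0e adde0.
Qed.

(** * Critical measures on the torus and their slopes *)

Section torus_mean_field.
Context {R : realType} {L : {posnum R}} {d : nat}.
Local Notation T := (torus L d).
Local Notation P := (probability T R).
Local Notation vol := (volume L d).
Local Notation D := (@torus_diameter R L d).
Variables (W : T -> R) (M K : R).
Hypothesis M0 : 0 < M.
Hypothesis K0 : 0 < K.
Hypothesis mW : measurable_fun setT W.
Hypothesis WM : forall x, `|W x| <= M.
Hypothesis WK : forall x y, `|W x - W y| <= K * torus_dist x y.
Hypothesis Wsym : forall x, W (- x) = W x.
Implicit Types (mu nu : P).

Definition kW (x y : T) := W (x - y).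
Local Notation conv := (conv_density vol kW).
Local Notation mconv := (conv_prob kW).

Lemma volume_gt0 : (0 < vol setT)%E.
Proof.
rewrite /volume /= /fpushforward /pushforward preimage_setT.
by rewrite cube_measureT lte_fin exprn_gt0.
Qed.

Lemma measurable_kW : measurable_fun setT (fun z : T * T => kW z.1 z.2).
Proof. exact: measurableT_comp mW torus_measurable_sub. Qed.

Lemma kW_bounded x y : `|kW x y| <= M. Proof. exact: WM. Qed.

Lemma kW_sym x y : kW x y = kW y x. Proof. by rewrite /kW -Wsym opprB. Qed.

Lemma kW_Lipschitz x y y' : `|kW x y - kW x y'| <= K * torus_dist y y'.
Proof.
rewrite !(kW_sym x); apply: le_trans (WK _ _) _.
by rewrite !torus_distE opprB addrA subrK.
Qed.

Lemma mconv_W2 mu nu x : `|mconv mu x - mconv nu x| <= K * W2 mu nu.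
Proof.
apply: (@W2_Lipschitz _ _ _ (kW x) M) => //.
- exact: measurable_k measurable_kW x.
- exact: kW_bounded.
- exact: kW_Lipschitz.
Qed.

Section fixed_beta.
Variable beta : R.
Hypothesis beta0 : 0 < beta.
Local Notation F := (density_free_energy vol kW beta).
Local Notation gibbs := (gibbs vol beta).
Local Notation I := (free_energy W beta).
Local Notation C := (beta / 4 * K ^+ 2).

Definition critical mu :=
  exists rho, [/\ has_density vol mu rho, fin_ent vol rho & rho = gibbs (conv rho)].

Lemma freeE mu : I mu = kernel_free_energy vol kW beta mu.
Proof. by []. Qed.

Lemma critical_real mu : critical mu -> I mu \is a fin_num.
Proof.
move=> [rho [mur fr _]].
by rewrite freeE (free_energy_densityE measurable_kW kW_bounded beta mur fr).
Qed.

(** [critical_gap] bounds the loss by the squared distance of the potentials; with [mconv_W2] this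
    becomes quadratic in the Wasserstein distance. Competitors of infinite free energy satisfy it
    trivially. *)
Lemma critical_free_energy_le mu nu w : critical mu ->
  (forall x, `|mconv nu x - mconv mu x| <= K * w) ->
  (I mu <= I nu + (C * w ^+ 2)%:E)%E.
Proof.
move=> [rho [mur fr rhoE]] hw.
have [|Inu] := ltP (I nu) +oo%E; last first.
  by move: Inu; rewrite leye_eq => /eqP ->; rewrite addye// leey.
move=> /(free_energy_lty measurable_kW kW_bounded beta0)[f [nuf ff]]; rewrite -freeE => ->.
rewrite freeE (free_energy_densityE measurable_kW kW_bounded beta mur fr) -EFinD lee_fin.
have fe : bounded_by (fun x => conv f x - conv rho x) (K * w).
  move=> x; have := hw x.
  rewrite (mconv_conv measurable_kW kW_bounded nuf).
  by rewrite (mconv_conv measurable_kW kW_bounded mur).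
have := critical_gap volume_gt0 measurable_kW kW_bounded kW_sym beta0 fr rhoE ff fe.
by rewrite exprMn mulrA; lra.
Qed.

(** Mix a little of [nu] into [mu]: little mass moves, yet the potential at [x] changes, so the
    distance is positive. Without such points the punctured neighbourhoods could be empty and the
    upper limit equal to [-oo]. *)
Lemma W2_near mu nu x r : mconv mu x != mconv nu x -> 0 < r ->
  exists nu', 0 < W2 mu nu' < r.
Proof.
move=> munu r0.
have D0 : 0 <= D ^+ 2 by exact: sqr_ge0.
pose e := Num.min 1 (r ^+ 2 / (2 * (D ^+ 2 + 1))).
have e0 : 0 < e by rewrite lt_min ltr01 divr_gt0 ?exprn_gt0//; lra.
have e1 : e <= 1 by rewrite ge_min lexx.
have eD : e * D ^+ 2 < r ^+ 2.
  apply: (@le_lt_trans _ _ (r ^+ 2 / (2 * (D ^+ 2 + 1)) * D ^+ 2)).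
    by rewrite ler_wpM2r// ge_min lexx orbT.
  rewrite mulrAC ltr_pdivrMr; last lra.
  by rewrite ltr_pM2l ?exprn_gt0//; lra.
have e01 : 0 <= e <= 1 by rewrite (ltW e0).
have [q qE] := mixture_exists mu nu e01.
exists q; apply/andP; split; last first.
  rewrite -(@ltr_pXn2r _ 2%N)// ?nnegrE ?W2_ge0 ?(ltW r0)//.
  apply: le_lt_trans eD; rewrite -[leRHS]add0r -[X in X + _](expr0n _ 2) -(W2xx mu).
  apply: (@W2_mix _ _ _ mu mu mu mu nu mu q (1 - e) 0 e) => //.
  - by rewrite subr_ge0.
  - exact: ltW.
  - by rewrite addr0 subrK.
  - move=> A mA; rewrite mul0e adde0 (prob_fineE mu mA) -!EFinM -EFinD.
    by congr EFin; ring.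
  - by move=> A mA; rewrite mul0e adde0 qE.
rewrite lt_neqAle W2_ge0 andbT eq_sym; apply: contra_neq munu => w0.
have := mconv_W2 mu q x; rewrite w0 mulr0 normr_le0 subr_eq0 => /eqP.
rewrite [RHS]/conv_prob (mixture_Rint e01 qE (measurable_k measurable_kW x) (kW_bounded x)).
rewrite -!/(conv_prob _ _ _) => h.
have : e * (mconv mu x - mconv nu x) = 0 by lra.
by move=> /eqP; rewrite mulf_eq0 gt_eqF//= subr_eq0 => /eqP.
Qed.

Lemma C_gt0 : 0 < C.
Proof. by rewrite mulr_gt0 ?exprn_gt0// divr_gt0. Qed.

(** Dividing the quadratic bound by the distance leaves [C * W2 mu y], which tends to zero;
    [W2_near] supplies the points needed for the lower bound. *)
Lemma metric_slope_critical mu nu x : critical mu -> mconv mu x != mconv nu x ->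
  metric_slope (@W2 R L d) I mu = 0%E.
Proof.
move=> cmu munu; rewrite /metric_slope.
have Ifin := critical_real cmu.
rewrite ltey_eq Ifin /=; apply/eqP; rewrite eq_le; apply/andP; split; last first.
  apply: le_ereal_inf_tmp => _ [V [r /= r0 hV] <-].
  have [y hy] := W2_near munu r0.
  apply: le_ereal_sup_tmp; eexists; first by exists y; first exact: hV.
  rewrite mule_ge0//; first by rewrite le_max lexx orbT.
  by rewrite lee_fin invr_ge0 W2_ge0.
apply/lee_addgt0Pr => e e0; rewrite add0e.
have C0 := C_gt0.
apply: ge_ereal_inf; exists (ereal_sup ((fun y => maxe (I mu - I y) 0 * ((W2 mu y)^-1)%:E)%E @`
   [set y | 0 < W2 mu y < e / C])).
  exists [set y | 0 < W2 mu y < e / C] => //.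
  by exists (e / C) => //=; rewrite divr_gt0.
apply: ge_ereal_sup => _ [y /= /andP[w0 wr] <-].
have hle : (I mu <= I y + (C * W2 mu y ^+ 2)%:E)%E.
  by apply: critical_free_energy_le cmu _ => z; rewrite distrC; exact: mconv_W2.
have hm : (maxe (I mu - I y) 0 <= (C * W2 mu y ^+ 2)%:E)%E.
  rewrite ge_max; apply/andP; split.
    move: Ifin hle; case: (I mu) => // a _; case: (I y) => [b| |] //.
      rewrite -EFinD -EFinB !lee_fin; lra.
    by move=> _; rewrite leNye.
  by rewrite lee_fin mulr_ge0 ?sqr_ge0// ltW.
apply: (@le_trans _ _ ((C * W2 mu y ^+ 2)%:E * ((W2 mu y)^-1)%:E)%E).
  by apply: lee_wpmul2r hm; rewrite lee_fin invr_ge0 ltW.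
rewrite -EFinM lee_fin.
have -> : C * W2 mu y ^+ 2 / W2 mu y = C * W2 mu y by field; rewrite gt_eqF.
by move: wr; rewrite ltr_pdivlMr// mulrC => /ltW.
Qed.

(** A deformation lowering the height at rate [delta] would produce a drop linear in $t$ within
    distance $t$, against the quadratic bound; so no [delta] is admissible on the epigraph. *)
Lemma weak_slope_critical mu : critical mu -> weak_slope (@W2 R L d) I mu = 0%E.
Proof.
move=> cmu; rewrite /weak_slope; case: pselect => [Imu|]; last first.
  by case; rewrite ltey_eq critical_real.
have C0 := C_gt0.
suff -> : weak_slope_continuous (@epi_dist R P (@W2 R L d) I) (@epi_height R P I) (epi_graph Imu) = 0%E.
  by rewrite lte_fin ltr01 /= mul0r.
rewrite /weak_slope_continuous.
suff -> : [set delta%:E | delta in regular_point (@epi_dist R P (@W2 R L d) I)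
    (@epi_height R P I) (epi_graph Imu)] = set0 by rewrite setU0 ereal_sup1.
apply/seteqP; split => // y [delta [delta0 [U [alpha [psi [[r r0 hU] alpha0 _ hpsi]]]]] _].
have Ug : U (epi_graph Imu).
  by apply: hU; rewrite /= /epi_dist /= W2xx subrr normr0 expr0n /= addr0 sqrtr0.
(* For $t\le\delta/(2C)$ the permitted drop $Ct^2$ is at most half of the required $\delta t$. *)
pose t := Num.min alpha (delta / (2 * C)).
have t0 : 0 < t by rewrite lt_min alpha0 divr_gt0// mulr_gt0.
have talpha : 0 <= t <= alpha by rewrite (ltW t0) ge_min lexx.
have [hd hh] := hpsi _ t Ug talpha.
case: (psi (epi_graph Imu) t) hd hh => [[v z] /= Iv]; rewrite /epi_dist /epi_height /= => hd hh.
have W2t : W2 v mu <= t.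
  apply: le_trans hd; rewrite -[leLHS](ger0_norm (W2_ge0 v mu)) -sqrtr_sqr.
  by rewrite ler_wsqrtr// lerDl sqr_ge0.
have hle : (I mu <= I v + (C * W2 v mu ^+ 2)%:E)%E.
  by apply: critical_free_energy_le cmu _ => z0; exact: mconv_W2.
have h2 : fine (I mu) <= z + C * W2 v mu ^+ 2.
  rewrite -lee_fin fineK ?critical_real// EFinD.
  by apply: le_trans hle _; exact: leeD2r.
have h3 : C * W2 v mu ^+ 2 <= C * t ^+ 2.
  by rewrite ler_wpM2l ?(ltW C0)// ler_pXn2r ?nnegrE ?W2_ge0// ltW.
have h4 : C * t ^+ 2 <= delta / 2 * t.
  have -> : C * t ^+ 2 = C * t * t by ring.
  rewrite ler_wpM2r ?(ltW t0)//.
  apply: (@le_trans _ _ (C * (delta / (2 * C)))).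
    by rewrite ler_wpM2l ?(ltW C0)// ge_min lexx orbT.
  by rewrite (_ : C * _ = delta / 2)//; field; rewrite !gt_eqF.
have h5 : 0 < delta * t by rewrite mulr_gt0.
have : delta * t <= delta * 2^-1 * t.
  by apply: le_trans hh _; apply: le_trans h4; apply: le_trans h3; rewrite lerBlDl.
by rewrite ler_pM2r// ler_pMr// invf_ge1// lern1.
Qed.

End fixed_beta.
End torus_mean_field.

(** * Curves of probability measures *)

Section curves.
Context {R : realType} {L : {posnum R}} {d : nat}.
Local Notation T := (torus L d).
Local Notation P := (probability T R).
Local Notation vol := (volume L d).
Local Notation D := (@torus_diameter R L d).
Implicit Types (mu nu p q : P).

Lemma linear_curve p q : exists gamma : R -> P,
  continuous_curve (@W2 R L d) gamma /\
  forall t, 0 <= t <= 1 ->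
    forall A, measurable A -> gamma t A = ((1 - t)%:E * p A + t%:E * q A)%E.
Proof.
have /choice[gamma gammaE] (t : R) : exists r : P, 0 <= t <= 1 ->
    forall A, measurable A -> r A = ((1 - t)%:E * p A + t%:E * q A)%E.
  have [t01|_] := boolP (0 <= t <= 1); last by exists p.
  by have [r rE] := mixture_exists p q t01; exists r.
exists gamma; split => //.
have le_dist t s : 0 <= t -> t <= s -> s <= 1 ->
    W2 (gamma t) (gamma s) ^+ 2 <= (s - t) * D ^+ 2 /\
    W2 (gamma s) (gamma t) ^+ 2 <= (s - t) * D ^+ 2.
  move=> t0 ts s1.
  have t01 : 0 <= t <= 1 by rewrite t0 (le_trans ts).
  have s01 : 0 <= s <= 1 by rewrite s1 (le_trans t0).
  (* The two points share the mass of weights [1 - s] and [t]; only the excess [s - t] has to be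
     moved. *)
  have gt A : measurable A -> gamma t A =
      ((1 - s)%:E * p A + t%:E * q A + (s - t)%:E * p A)%E.
    move=> mA; rewrite gammaE// (prob_fineE p mA) (prob_fineE q mA).
    by rewrite -!EFinM -!EFinD; congr EFin; ring.
  have gs A : measurable A -> gamma s A =
      ((1 - s)%:E * p A + t%:E * q A + (s - t)%:E * q A)%E.
    move=> mA; rewrite gammaE// (prob_fineE p mA) (prob_fineE q mA).
    by rewrite -!EFinM -!EFinD; congr EFin; ring.
  have s1' : 0 <= 1 - s by rewrite subr_ge0.
  have st' : 0 <= s - t by rewrite subr_ge0.
  have sum1 : 1 - s + t + (s - t) = 1 by ring.
  have h1 := W2_mix s1' t0 st' sum1 gt gs.
  have h2 := W2_mix s1' t0 st' sum1 gs gt.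
  by rewrite W2xx expr0n /= add0r in h1 h2.
move=> t /andP[t0 t1] e e0; have D0 : 0 <= D ^+ 2 by exact: sqr_ge0.
exists (e ^+ 2 / (D ^+ 2 + 1)); first by rewrite divr_gt0 ?exprn_gt0//; lra.
move=> s /andP[s0 s1]; rewrite ltr_pdivlMr; last lra.
move=> hts; rewrite -(@ltr_pXn2r _ 2%N)// ?nnegrE ?W2_ge0 ?(ltW e0)//.
have abs0 := normr_ge0 (t - s).
apply: (@le_lt_trans _ _ (`|t - s| * D ^+ 2)); last first.
  by apply: le_lt_trans hts; rewrite mulrDr mulr1 lerDl.
have [ts|/ltW st] := leP t s.
  by rewrite distrC ger0_norm ?subr_ge0//; exact: (le_dist _ _ t0 ts s1).1.
by rewrite ger0_norm ?subr_ge0//; exact: (le_dist _ _ s0 st t1).2.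
Qed.

Lemma continuous_curve_ivt (gamma : R -> P) (phi : P -> R) (K v : R) : 0 < K ->
  continuous_curve (@W2 R L d) gamma ->
  (forall mu nu, `|phi mu - phi nu| <= K * W2 mu nu) ->
  Num.min (phi (gamma 0)) (phi (gamma 1)) <= v <= Num.max (phi (gamma 0)) (phi (gamma 1)) ->
  exists2 t, 0 <= t <= 1 & phi (gamma t) = v.
Proof.
move=> K0 gc phiK hv.
(* Curves are only constrained on the unit interval, so the parameter is clamped to it, yielding a
   continuous function on the whole line. *)
pose cl (t : R) := Num.max 0 (Num.min 1 t).
have cl01 t : 0 <= cl t <= 1.
  by rewrite /cl le_max lexx /= ge_max ler01 ge_min lexx.
have clE t : 0 <= t <= 1 -> cl t = t.
  by move=> /andP[t0 t1]; rewrite /cl (min_r t1) (max_r t0).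
have cl_dist t s : `|cl t - cl s| <= `|t - s|.
  rewrite /cl !maxEle !minEle.
  have [] := leP 1 t; have [] := leP 1 s => h1 h2;
    repeat case: ifP; move=> *; rewrite ler_norml; have := ler_norm (t - s);
    have := ler_norm (s - t); rewrite (distrC s t) => *; apply/andP; split; lra.
pose g t := phi (gamma (cl t)).
have cg : continuous g.
  move=> t; apply/cvgrPdist_lt => e e0.
  have [r r0 hr] := gc (cl t) (cl01 t) (e / K) (divr_gt0 e0 K0).
  exists r => //= s /= ts; apply: le_lt_trans (phiK _ _) _.
  rewrite mulrC -ltr_pdivlMr//; apply: hr => //.
  exact: le_lt_trans (cl_dist _ _) ts.
have [] := @IVT R g 0 1 v ler01 (continuous_subspaceT cg).
  by rewrite /g !clE ?lexx ?ler01.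
move=> t; rewrite in_itv /= => t01 gt; exists t => //.
by rewrite -gt /g clE.
Qed.

End curves.

(** * Relaxation as a map on probability measures *)

Section relaxation_map.
Context {R : realType} {L : {posnum R}} {d : nat}.
Local Notation T := (torus L d).
Local Notation P := (probability T R).
Local Notation vol := (volume L d).
Local Notation D := (@torus_diameter R L d).
Variables (W : T -> R) (M K : R).
Hypothesis M0 : 0 < M.
Hypothesis K0 : 0 < K.
Hypothesis mW : measurable_fun setT W.
Hypothesis WM : forall x, `|W x| <= M.
Hypothesis WK : forall x y, `|W x - W y| <= K * torus_dist x y.
Hypothesis Wsym : forall x, W (- x) = W x.
Variable beta : R.
Hypothesis beta0 : 0 < beta.
Implicit Types (mu nu : P).
Local Notation mk := (measurable_kW mW).
Local Notation kM := (kW_bounded WM).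
Local Notation conv := (conv_density vol (kW W)).
Local Notation mconv := (conv_prob (kW W)).
Local Notation F := (density_free_energy vol (kW W) beta).
Local Notation gibbs := (gibbs vol beta).
Local Notation I := (free_energy W beta).
Local Notation t0 := (relax_step beta M).

Lemma fin_ent_gibbs_mconv mu : fin_ent vol (gibbs (mconv mu)).
Proof. exact: (fin_ent_gibbs (volume_gt0 (L := L)) beta0 (measurable_mconv mk kM mu) (mconv_bounded mk kM mu)). Qed.

(* On absolutely continuous measures this is [relax], cf. [relaxed_density]. *)
Definition relaxed mu nu := exists2 G : P, has_density vol G (gibbs (mconv mu)) &
  forall A, measurable A -> nu A = ((1 - t0)%:E * mu A + t0%:E * G A)%E.

Lemma relaxed_exists mu : exists nu, relaxed mu nu.
Proof.
have [G Gg] := density_probability (fin_ent_gibbs_mconv mu).1.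
by have [nu nuE] := mixture_exists mu G (relax_step01 beta0 M0); exists nu, G.
Qed.

Lemma relaxed_density mu nu f : relaxed mu nu -> has_density vol mu f ->
  has_density vol nu (relax vol beta (kW W) M f).
Proof.
move=> [G Gg nuE] muf; rewrite /relax.
have cE : mconv mu = conv f by apply/funext => x; exact: (mconv_conv mk kM muf x).
by rewrite cE in Gg; exact: (mixture_has_density (relax_step01 beta0 M0) muf Gg nuE).
Qed.

Lemma gibbs_ratio u v B e x : measurable_fun setT u -> measurable_fun setT v ->
  bounded_by u B -> bounded_by v B -> bounded_by (fun x => u x - v x) e ->
  expR (- (2 * beta * e)) * gibbs u x <= gibbs v x.
Proof.
move=> mu mv uB vB uve.
have vol0 := volume_gt0 (L := L) (d := d).
have gu := gibbs_gt0 vol0 beta0 mu uB x; have gv := gibbs_gt0 vol0 beta0 mv vB x.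
rewrite -[gibbs u x]lnK ?posrE// -expRD -[leRHS]lnK ?posrE// ler_expR.
rewrite (ln_gibbs vol0 beta0 mu uB) (ln_gibbs vol0 beta0 mv vB).
have vue : bounded_by (fun x => v x - u x) e by move=> y; rewrite distrC.
have hZ := ln_partition_function_le vol0 beta0 mv mu vB uB vue.
have := vue x; rewrite ler_norml => /andP[_ /(ler_wpM2l (ltW beta0))].
by lra.
Qed.

(** Nearby potentials have comparable Gibbs densities ([gibbs_ratio]), so the two Gibbs measures
    share all but a mass of order [e]. The original parts are moved by their own plan, the shared
    Gibbs part stays in place, and the rest costs at most the squared diameter. *)
Lemma relaxed_W2 mu nu mu' nu' e : relaxed mu mu' -> relaxed nu nu' ->
  0 < e -> K * W2 mu nu <= e ->
  W2 mu' nu' ^+ 2 <= W2 mu nu ^+ 2 + 2 * beta * e * D ^+ 2.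
Proof.
move=> [G Gg mu'E] [H Hg nu'E] e0 he.
have [mmu mnu] := (measurable_mconv mk kM mu, measurable_mconv mk kM nu).
have [bmu bnu] := (mconv_bounded mk kM mu, mconv_bounded mk kM nu).
have hue : bounded_by (fun x => mconv mu x - mconv nu x) e.
  by move=> x; apply: le_trans he; exact: (mconv_W2 K0 mW WM WK Wsym).
have hx0 : 0 < 2 * beta * e by rewrite !mulr_gt0.
pose a := 1 - expR (- (2 * beta * e)).
have a_gt0 : 0 < a by rewrite subr_gt0 expR_lt1 oppr_lt0.
have a_le1 : a <= 1 by rewrite gerBl expR_ge0.
have a_le : a <= 2 * beta * e.
  by have := expR_ge1Dx (- (2 * beta * e)); rewrite /a; lra.
have a01 : 0 <= a <= 1 by rewrite (ltW a_gt0).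
have [Gd Hd] := (Gg.1, Hg.1); have [Gi Hi] := (density_int Gd, density_int Hd).
(* The normalised remainder after removing [1 - a] times the first Gibbs density from the second;
   [gibbs_ratio] makes it nonnegative. *)
pose r x := a^-1 * (gibbs (mconv nu) x - (1 - a) * gibbs (mconv mu) x).
have rd : density vol r.
  apply: densityP.
  - by apply: intZ; apply: intB => //; exact: intZ.
  - move=> x; rewrite mulr_ge0 ?invr_ge0 ?(ltW a_gt0)// subr_ge0 /a subKr.
    exact: gibbs_ratio mmu mnu bmu bnu hue.
  - rewrite RintZ; last by apply: intB => //; exact: intZ.
    rewrite RintB//; last exact: intZ.
    rewrite RintZ// (density_Rint Gd) (density_Rint Hd) mulr1 subKr mulVf//.
    by rewrite gt_eqF.
have [q qr] := density_probability rd.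
have HE A : measurable A -> (H A = (1 - a)%:E * G A + a%:E * q A)%E.
  have [s sE] := mixture_exists G q a01.
  have sd := mixture_has_density a01 Gg qr sE.
  move=> mA; apply: etrans (sE A mA).
  apply: (has_density_same Hg _ mA); apply: eq_ind sd _ _.
  by apply/funext => x; rewrite /r; field; rewrite gt_eqF.
have t00 := relax_step_gt0 beta0 M0; have t01 := relax_step_le1 beta0 M0.
apply: le_trans (W2_mix (mu := mu) (nu := nu) (G := G) (p := G) (q := q)
  (a1 := 1 - t0) (a2 := t0 * (1 - a)) (a3 := t0 * a) _ _ _ _ _ _) _.
- by rewrite subr_ge0.
- by rewrite mulr_ge0 ?(ltW t00)// subr_ge0.
- by rewrite mulr_ge0 ?(ltW t00)// ltW.
- by ring.
- move=> A mA; rewrite mu'E// (prob_fineE mu mA) (prob_fineE G mA) -!EFinM -!EFinD.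
  by congr EFin; ring.
- move=> A mA; rewrite nu'E// HE// (prob_fineE nu mA) (prob_fineE G mA) (prob_fineE q mA).
  by rewrite -!(EFinM, EFinD); congr EFin; ring.
rewrite lerD2l ler_wpM2r ?sqr_ge0//; apply: le_trans a_le.
by rewrite ler_piMl// ltW.
Qed.

Lemma relaxed_curve (gamma gamma' : R -> P) :
  (forall t, relaxed (gamma t) (gamma' t)) ->
  continuous_curve (@W2 R L d) gamma -> continuous_curve (@W2 R L d) gamma'.
Proof.
move=> hrel gc t t01 e e0.
have D0 : 0 <= 2 * beta * K * D ^+ 2 by rewrite mulr_ge0 ?sqr_ge0// !mulr_ge0// ltW.
pose C := 1 + 2 * beta * K * D ^+ 2.
have C0 : 0 < C by rewrite /C; lra.
pose r := Num.min 1 (e ^+ 2 / (2 * C)).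
have r0 : 0 < r by rewrite lt_min ltr01 divr_gt0 ?exprn_gt0// mulr_gt0.
have [s s0 hs] := gc t t01 r r0.
exists s => // u u01 tu; have hw := hs u u01 tu.
have hKr : K * W2 (gamma t) (gamma u) <= K * r by rewrite ler_wpM2l// ltW.
have := relaxed_W2 (hrel t) (hrel u) (mulr_gt0 K0 r0) hKr => h.
rewrite -(@ltr_pXn2r _ 2%N)// ?nnegrE ?W2_ge0 ?(ltW e0)//.
apply: le_lt_trans h _.
have w2 : W2 (gamma t) (gamma u) ^+ 2 <= r.
  apply: (@le_trans _ _ (r ^+ 2)).
    by rewrite ler_pXn2r ?nnegrE ?W2_ge0 ?(ltW r0)// ltW.
  by rewrite expr2 ler_piMl ?(ltW r0)// ge_min lexx.
have rC : r * C <= e ^+ 2 / 2.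
  apply: (@le_trans _ _ (e ^+ 2 / (2 * C) * C)).
    by rewrite ler_wpM2r ?(ltW C0)// ge_min lexx orbT.
  by rewrite invfM mulrA mulfVK ?gt_eqF.
have e20 : 0 < e ^+ 2 by rewrite exprn_gt0.
move: rC; rewrite /C; lra.
Qed.

(** A minimiser is its own Gibbs measure, so mixing changes nothing. Relaxed paths therefore keep
    their end points. *)
Lemma minimiser_relaxed mu nu : is_minimiser vol (kW W) beta mu -> relaxed mu nu ->
  measure_eq nu mu.
Proof.
move=> mumin [G Gg nuE] A mA.
have muG := minimiser_gibbs (volume_gt0 (L := L)) M0 mk kM (kW_sym Wsym) beta0 mumin Gg.
apply: etrans (nuE A mA) _; have GA : G A = mu A := esym (muG A mA).
suff : ((1 - t0)%:E * mu A + t0%:E * G A)%E = mu A by [].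
rewrite GA (prob_fineE mu mA) -!EFinM -EFinD; congr EFin; ring.
Qed.

End relaxation_map.

(** * The mountain pass argument *)

Section mountain_pass.
Context {R : realType} {L : {posnum R}} {d : nat}.
Local Notation T := (torus L d).
Local Notation P := (probability T R).
Local Notation vol := (volume L d).
Variables (W : T -> R) (M K : R).
Hypothesis M0 : 0 < M.
Hypothesis K0 : 0 < K.
Hypothesis mW : measurable_fun setT W.
Hypothesis WM : forall x, `|W x| <= M.
Hypothesis WK : forall x y, `|W x - W y| <= K * torus_dist x y.
Hypothesis Wsym : forall x, W (- x) = W x.
Hypothesis Wnet : forall e : R, 0 < e -> exists (m : nat) (s : 'I_m -> T),
  forall x, exists i, forall y, `|W (x - y) - W (s i - y)| <= e.
Implicit Types (mu nu : P).
Local Notation mk := (measurable_kW mW).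
Local Notation kM := (kW_bounded WM).
Local Notation ksym := (kW_sym Wsym).
Local Notation vol0 := (volume_gt0 (L := L) (d := d)).
Local Notation conv := (conv_density vol (kW W)).
Local Notation mconv := (conv_prob (kW W)).

Section fixed_beta.
Variable beta : R.
Hypothesis beta0 : 0 < beta.
Local Notation F := (density_free_energy vol (kW W) beta).
Local Notation KL := (KL vol beta).
Local Notation gibbs := (gibbs vol beta).
Local Notation I := (free_energy W beta).
Local Notation t0 := (relax_step beta M).
Local Notation min := (minimiser W beta).

Lemma inv_small (B e : R) : 0 <= B -> 0 < e ->
  exists n0, forall n, (n0 <= n)%N -> B * n.+1%:R^-1 <= e.
Proof.
move=> B0 e0; exists (Num.truncn (B / e)) => n hn.
rewrite ler_pdivrMr// mulrC -ler_pdivrMr//.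
apply: (@le_trans _ _ (Num.truncn (B / e)).+1%:R).
  by apply/ltW; have /andP[] := @truncn_itv _ (B / e) (divr_ge0 B0 (ltW e0)).
by rewrite ler_nat.
Qed.

Lemma palais_smale_rate (f : nat -> T -> R) (c B : R) : 0 <= B ->
  (forall n, [/\ fin_ent vol (f n), `|F (f n) - c| <= B * n.+1%:R^-1 &
                 KL (f n) (conv (f n)) <= B * n.+1%:R^-1]) ->
  exists mu rho, [/\ has_density vol mu rho, critical W beta mu, I mu = c%:E &
    forall e, 0 < e -> exists n, \int[vol]_x `|f n x - rho x| <= e].
Proof.
move=> B0 hf.
have [|e e0|e e0|rho [fr rhoE Frho close]] :=
  @palais_smale _ _ _ vol beta (kW W) M vol0 beta0 M0 mk kM ksym Wnet f c.
- by move=> n; case: (hf n).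
- by have [n0 h] := inv_small B0 e0; exists n0 => n /h; case: (hf n) => _ h1 _; exact: le_trans.
- by have [n0 h] := inv_small B0 e0; exists n0 => n /h; case: (hf n) => _ _; exact: le_trans.
have [mu mur] := density_probability fr.1.
exists mu, rho; split => //.
- by exists rho.
- by rewrite freeE (free_energy_densityE mk kM beta mur fr) Frho.
- by move=> e e0; have [n _ hn] := close e e0 0%N; exists n.
Qed.

Lemma I_measure_eq mu nu : measure_eq mu nu -> I mu = I nu.
Proof. exact: (free_energy_measure_eq vol mk kM beta0). Qed.

Lemma energy_density_le f : density vol f -> `|energy vol (kW W) f f| <= M.
Proof.
move=> fd; rewrite -[leRHS]mulr1 -(density_norm fd).
apply: (energy_le mk kM (density_int fd)).
exact: (conv_density_bounded mk kM fd).
Qed.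

(** The bound is uniform along the segment between two measures of finite entropy, which makes the
    minimax level finite. *)
Lemma mixture_free_energy_le (p q r : P) f g t : 0 <= t <= 1 ->
  has_density vol p f -> fin_ent vol f -> has_density vol q g -> fin_ent vol g ->
  (forall A, measurable A -> r A = ((1 - t)%:E * p A + t%:E * q A)%E) ->
  (I r <= (beta^-1 * (`|entropy vol f| + `|entropy vol g|) + M)%:E)%E.
Proof.
move=> t01 pf ff qg fg rE; have rd := mixture_has_density t01 pf qg rE.
have fr := fin_ent_mix t01 ff fg.
rewrite freeE (free_energy_densityE mk kM beta rd fr) lee_fin lerD//.
  rewrite ler_wpM2l ?invr_ge0 ?(ltW beta0)//.
  apply: le_trans (entropy_mix_le t01 ff fg) _; have /andP[? ?] := t01.
  have le_abs (a x : R) : 0 <= a -> a <= 1 -> a * x <= `|x|.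
    move=> a0 a1; apply: le_trans (ler_norm _) _.
    by rewrite normrM (ger0_norm a0) ler_piMl.
  by apply: lerD; apply: le_abs => //; lra.
have := energy_density_le fr.1; rewrite ler_norml => /andP[_]; have := M0; lra.
Qed.

(** The fourth property of the sequence below pins the potential at [x0] when the minimax level
    equals the minimum; it is what keeps the limit off both ends in that case. *)
Lemma mountain_pass mu0 mu1 : min mu0 -> min mu1 -> ~ measure_eq mu0 mu1 ->
  exists mu, [/\ ~ measure_eq mu mu0, ~ measure_eq mu mu1, critical W beta mu &
                 I mu = minimax_level I mu0 mu1].
Proof.
move=> min0 min1 mu01.
have [x0 hx0] := minimisers_separated vol0 M0 mk kM ksym beta0 min0 min1 mu01.
set c := minimax_level I mu0 mu1.
have [f0 [d0 ff0 I0]] := minimiser_density vol0 mk kM beta0 min0.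
have [f1 [d1 ff1 I1]] := minimiser_density vol0 mk kM beta0 min1.
rewrite -!freeE in I0 I1.
have I01 : I mu0 = I mu1 by apply/eqP; rewrite eq_le min0 min1.
have c_ge : (I mu0 <= c)%E.
  apply: le_ereal_inf_tmp => _ [gamma [gc g0 g1] <-].
  rewrite -(I_measure_eq g0); apply: ereal_sup_ubound.
  by exists 0 => //=; rewrite in_itv /= lexx ler01.
have c_lt : (c < +oo)%E.
  have [gamma [gc gE]] := linear_curve mu0 mu1.
  apply: le_lt_trans (ltry (beta^-1 * (`|entropy vol f0| + `|entropy vol f1|) + M)).
  apply: ge_ereal_inf; eexists.
    exists gamma; last reflexivity; split => //.
      move=> A mA; apply: etrans (gE 0 _ A mA) _; first by rewrite lexx ler01.
      by rewrite subr0 mul1e mul0e adde0.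
    move=> A mA; apply: etrans (gE 1 _ A mA) _; first by rewrite lexx ler01.
    by rewrite subrr mul1e mul0e add0e.
  apply: ge_ereal_sup => _ [t tI <-].
  have t01 : 0 <= t <= 1 by move: tI; rewrite /= in_itv.
  exact: mixture_free_energy_le t01 d0 ff0 d1 ff1 (gE t t01).
have cfin : c \is a fin_num.
  by rewrite fin_numElt c_lt andbT; apply: lt_le_trans c_ge; rewrite I0 ltNyr.
set c' := fine c; have cE : c = c'%:E by rewrite fineK.
pose mid := (mconv mu0 x0 + mconv mu1 x0) / 2.
have t0_gt0 := relax_step_gt0 beta0 M0.
(* The first summand bounds the error in the level; the second inverts the descent estimate for a
   drop smaller than [2 * dn]. *)
pose B := 1 + 2 * beta / t0 * 2.
have Bt0 : 0 <= 2 * beta / t0 by rewrite divr_ge0 ?mulr_ge0// ltW.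
have B0 : 0 <= B by rewrite /B; lra.
have /choice[f hf] (n : nat) : exists f, [/\ fin_ent vol f,
    `|F f - c'| <= B * n.+1%:R^-1, KL f (conv f) <= B * n.+1%:R^-1 &
    I mu0 = c -> conv f x0 = mid].
  set dn := n.+1%:R^-1; have dn0 : 0 < dn by rewrite invr_gt0.
  have : (c < c + dn%:E)%E by rewrite cE -EFinD lte_fin ltrDl.
  move=> /ereal_inf_lt[_ [gamma [gc g0 g1] <-] hsup].
  have Ile t : 0 <= t <= 1 -> (I (gamma t) < (c' + dn)%:E)%E.
    move=> t01; rewrite EFinD -cE; apply: le_lt_trans hsup; apply: ereal_sup_ubound.
    by exists t => //=; rewrite in_itv.
  have dens t : 0 <= t <= 1 -> exists f, [/\ has_density vol (gamma t) f,
      fin_ent vol f & F f < c' + dn].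
    move=> t01; have h := Ile t t01.
    have [g [gd fg Ig]] := free_energy_lty mk kM beta0 (lt_trans h (ltry _)).
    by exists g; split => //; move: h; rewrite freeE Ig lte_fin.
  (* When the level is the minimum, every point of the path is an almost minimiser, so the parameter
     may be chosen to give the potential at [x0] the midpoint value. *)
  have [Ic|Inc] := pselect (I mu0 = c).
    have [t t01 tmid] : exists2 t, 0 <= t <= 1 & mconv (gamma t) x0 = mid.
      apply: (continuous_curve_ivt K0 gc (phi := fun mu => mconv mu x0)).
        by move=> mu nu; exact: (mconv_W2 K0 mW WM WK Wsym).
      have -> : mconv (gamma 0) x0 = mconv mu0 x0 := Rint_measure_eq _ g0.
      have -> : mconv (gamma 1) x0 = mconv mu1 x0 := Rint_measure_eq _ g1.
      by rewrite /mid ge_min le_max; apply/andP; split; apply/orP;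
         have [h|h] := leP (mconv mu0 x0) (mconv mu1 x0); [left|right|right|left]; lra.
    have [f [fd ff Ff]] := dens t t01.
    have cf : (c'%:E <= (F f)%:E)%E.
      rewrite -cE -Ic -(free_energy_densityE mk kM beta fd ff); exact: min0.
    rewrite lee_fin in cf.
    exists f; split => //.
    - rewrite ger0_norm ?subr_ge0//.
      have : 1 * dn <= B * dn by rewrite ler_wpM2r ?(ltW dn0)// /B; lra.
      lra.
    - apply: (@le_trans _ _ (2 * beta / t0 * dn)).
        apply: (almost_minimiser_KL vol0 M0 mk kM ksym beta0 min0 ff).
        by rewrite -freeE Ic cE -EFinD lee_fin ltW.
      by rewrite ler_wpM2r ?(ltW dn0)// /B; lra.
    - by move=> _; rewrite -(mconv_conv mk kM fd) tmid.
  (* Above the minimum the whole path is relaxed. The relaxed path is still admissible, so it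
     exceeds [c - dn] at some parameter, while the original path is below [c + dn] there. *)
  have /choice[gamma' hrel] t : exists nu, relaxed W M beta (gamma t) nu.
    exact: (relaxed_exists M0 mW WM beta0).
  have gc' := relaxed_curve M0 K0 mW WM WK Wsym beta0 hrel gc.
  have path' : paths mu0 mu1 gamma'.
    have end_eq (mu nu nu' : P) : min mu -> measure_eq nu mu -> relaxed W M beta nu nu' ->
        measure_eq nu' mu.
      move=> mumin numu nurel.
      have numin : min nu by move=> ?; rewrite (I_measure_eq numu); exact: mumin.
      move=> A mA; apply: etrans (numu A mA).
      exact: (minimiser_relaxed M0 mW WM Wsym beta0 numin nurel mA).
    by split => //; [exact: end_eq min0 g0 (hrel 0)|exact: end_eq min1 g1 (hrel 1)].
  pose S := [set I (gamma' t) | t in `[0, 1]].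
  have : (c - dn%:E < ereal_sup S)%E.
    apply: (@lt_le_trans _ _ c); first by rewrite cE -EFinB lte_fin gtrBl.
    by apply: ereal_inf_lbound; exists gamma'.
  move=> /ereal_sup_gt[_ [t tI <-]]; rewrite cE -EFinB => hI.
  have t01 : 0 <= t <= 1 by move: tI; rewrite /= in_itv.
  have [f [fd ff Ff]] := dens t t01; exists f.
  have fr := fin_ent_relax vol0 beta0 M0 mk kM ff.
  have frd := relaxed_density M0 mW WM beta0 (hrel t) fd.
  move: hI; rewrite freeE (free_energy_densityE mk kM beta frd fr) lte_fin => hI.
  have hdec := relax_decrease vol0 beta0 M0 mk kM ksym ff.
  have hK := KL_ge0 vol0 beta0 (measurable_conv_density mk kM ff.1) (conv_density_bounded mk kM ff.1) ff.
  have tb0 : 0 < t0 / (2 * beta) by rewrite divr_gt0// mulr_gt0.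
  have hKt : 0 <= t0 / (2 * beta) * KL f (conv f) by rewrite mulr_ge0// ltW.
  have dnB : 1 * dn <= B * dn by rewrite ler_wpM2r ?(ltW dn0)// /B; lra.
  split => //.
  - by rewrite ler_norml; apply/andP; split; lra.
  - apply: (@le_trans _ _ (2 * beta / t0 * 2 * dn)).
      rewrite (_ : KL f (conv f) = 2 * beta / t0 * (t0 / (2 * beta) * KL f (conv f))).
        by rewrite -[leRHS]mulrA ler_wpM2l//; lra.
      by field; rewrite !gt_eqF.
    by rewrite ler_wpM2r ?(ltW dn0)// /B; lra.
  - by move=> Ic; case: Inc; rewrite Ic -cE.
have [|mu [rho [mur cmu Imu close]]] := @palais_smale_rate f c' B B0.
  by move=> n; case: (hf n).
(* The potential at [x0] is continuous in $L^1$ because the kernel is bounded, so the midpoint value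
   passes to the limit. *)
have mid_eq : I mu0 = c -> mconv mu x0 = mid.
  move=> Ic; apply/eqP; rewrite -subr_eq0; apply/eqP; apply: (@eq0_le_small _ _ M) => e e0.
  have [n hn] := close e e0; have [ff _ _ /(_ Ic) <-] := hf n.
  have [f1i r1i] := (density_int ff.1, density_int mur.1).
  rewrite (mconv_conv mk kM mur) /conv_density -RintB; [|exact: (int_kM mk kM)..].
  rewrite (@eq_Rint _ _ _ _ _ (fun z => kW W x0 z * (rho z - f n z))); last by move=> z; ring.
  apply: le_trans (RintM_le (measurable_k mk x0) (kM x0) (intB r1i f1i)) _.
  rewrite ler_wpM2l ?(ltW M0)//; apply: le_trans hn.
  by rewrite (@eq_Rint _ _ _ _ _ (fun x => `|f n x - rho x|))// => z; rewrite distrC.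
have mid0 : mid != mconv mu0 x0.
  by apply: contra_neq hx0; rewrite /mid; lra.
have mid1 : mid != mconv mu1 x0.
  by apply: contra_neq hx0; rewrite /mid; lra.
exists mu; rewrite Imu -cE; split => //.
- move=> eq0; have Ic : I mu0 = c.
    by rewrite -(I_measure_eq eq0) Imu cE.
  by move: mid0; rewrite -(mid_eq Ic) (Rint_measure_eq _ eq0 : mconv mu x0 = mconv mu0 x0) eqxx.
- move=> eq1; have Ic : I mu0 = c.
    by rewrite I01 -(I_measure_eq eq1) Imu cE.
  by move: mid1; rewrite -(mid_eq Ic) (Rint_measure_eq _ eq1 : mconv mu x0 = mconv mu1 x0) eqxx.
Qed.

End fixed_beta.
End mountain_pass.

(** Reversing every coordinate in turn amounts to negation. *)
Lemma even_sym {R : realType} {L : {posnum R}} {d : nat} (W : torus L d -> R) :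
  even_along_coordinates W -> forall x, W (- x) = W x.
Proof.
move=> ev x; have [u <-] := to_torus_surj x.
pose flips (s : seq 'I_d) := foldr (@flip R d) u s.
have Wf s : W (to_torus L (flips s)) = W (to_torus L u).
  by elim: s => //= i s ih; rewrite ev.
have fE s : uniq s -> forall j, flips s ord0 j = if j \in s then - u ord0 j else u ord0 j.
  elim: s => //= i s ih /andP[nis us] j; rewrite mxE in_cons ih//.
  by case: eqP => //= ->; rewrite (negbTE nis).
rewrite -to_torusN -(Wf (enum 'I_d)); congr (W (to_torus L _)).
by apply/rowP => j; rewrite mxE fE ?enum_uniq// mem_enum.
Qed.

(** * Existence of a second minimiser at the transition *)

Section discontinuous_transition.
Context {R : realType} {L : {posnum R}} {d : nat}.
Local Notation T := (torus L d).
Local Notation P := (probability T R).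
Local Notation vol := (volume L d).
Local Notation muL := (uniform_measure L d : P).
Variables (W : T -> R) (M : R).
Hypothesis M0 : 0 < M.
Hypothesis mW : measurable_fun setT W.
Hypothesis WM : forall x, `|W x| <= M.
Hypothesis Wsym : forall x, W (- x) = W x.
Hypothesis Wnet : forall e : R, 0 < e -> exists (m : nat) (s : 'I_m -> T),
  forall x, exists i, forall y, `|W (x - y) - W (s i - y)| <= e.
Implicit Types (mu nu : P).
Local Notation mk := (measurable_kW mW).
Local Notation kM := (kW_bounded WM).
Local Notation ksym := (kW_sym Wsym).
Local Notation vol0 := (volume_gt0 (L := L) (d := d)).
Local Notation F := (density_free_energy vol (kW W)).

Lemma TV_ge0 mu nu : (0 <= TV mu nu)%E.
Proof. by apply: le_ereal_sup_tmp; exists `|mu set0 - nu set0|%E => //; exists set0. Qed.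

(* Minimisers just above [betac] are almost minimisers at [betac]. *)
Lemma minimiser_above_le (betac beta : R) g mu : 0 < betac -> betac < beta ->
  minimiser W betac mu -> has_density vol mu g -> fin_ent vol g ->
  forall nu, minimiser W beta nu -> exists f, [/\ has_density vol nu f,
    fin_ent vol f & F betac f <= F betac g + (beta / betac - 1) * M].
Proof.
move=> bc0 bcb mumin mug fg nu numin.
have b0 : 0 < beta by exact: lt_trans bcb.
have [f [nuf ff Inu]] := minimiser_density vol0 mk kM b0 numin.
exists f; split => //.
have := numin mu; rewrite !freeE Inu (free_energy_densityE mk kM beta mug fg) lee_fin.
have := energy_density_le mW WM ff.1; have := energy_density_le mW WM fg.1.
rewrite /density_free_energy.
set Hf := entropy vol f; set Hg := entropy vol g.
set Ef := energy vol (kW W) f f; set Eg := energy vol (kW W) g g.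
rewrite !ler_norml => /andP[g1 g2] /andP[f1 f2] h.
have bi0 : 0 < beta^-1 by rewrite invr_gt0.
have ci0 : 0 < betac^-1 by rewrite invr_gt0.
have icb : 0 <= betac^-1 - beta^-1 by rewrite subr_ge0 lef_pV2 ?posrE// ltW.
(* Optimality at [beta] with a bounded interaction bounds the entropy excess; changing the parameter
   to [betac] multiplies that excess by the difference of the inverse parameters. *)
have hH : Hf - Hg <= beta * M.
  rewrite -ler_pdivrMl//; lra.
have := ler_wpM2l icb hH.
have -> : (betac^-1 - beta^-1) * (beta * M) = (beta / betac - 1) * M.
  by field; rewrite !gt_eqF.
lra.
Qed.

(** If the uniform measure were the only minimiser at [betac], minimisers just above [betac] staying
    away from it in total variation would be almost minimisers at [betac]. They would then cluster
    in $L^1$ at a minimiser, that is at the uniform measure: a contradiction, so the transition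
    would be continuous. *)
Lemma exists_nontrivial_minimiser (betac : R) :
  discontinuous_transition_point W betac ->
  exists mubar : P, minimiser W betac mubar /\ ~ measure_eq mubar muL.
Proof.
move=> [tp]; apply: contra_notP => /forallNP nontriv.
have [bc0 _ muLmin _] := tp.
have uniqL nu : minimiser W betac nu -> measure_eq nu muL.
  by move=> numin; apply: contrapT => nuL; apply: (nontriv nu).
split => //.
move=> mu_ mu_min; apply/eqP; rewrite eq_le; apply/andP; split; last first.
  apply: le_ereal_inf_tmp => _ [V VF <-].
  have [b Vb] := filter_ex VF; apply: le_ereal_sup_tmp.
  by exists (TV (mu_ b) muL); [exists b|exact: TV_ge0].
apply/lee_addgt0Pr => e e0; rewrite add0e.
suff [r r0 hr] : exists2 r, 0 < r &
    forall b, betac < b < betac + r -> (TV (mu_ b) muL <= e%:E)%E.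
  apply: ge_ereal_inf; exists (ereal_sup ((fun b => TV (mu_ b) muL) @`
      [set b | betac < b < betac + r])).
    exists [set b | betac < b < betac + r] => //=.
    near=> b; apply/andP; split; near: b; first exact: nbhs_right_gt.
    by apply: nbhs_right_lt; rewrite ltrDl.
  by apply: ge_ereal_sup => _ [b hb <-]; exact: hr.
apply: contrapT => /forall2NP hno.
have [g [muLg fg ImuL]] := minimiser_density vol0 mk kM bc0 muLmin.
have t0_gt0 := relax_step_gt0 bc0 M0.
pose B := M + 2 * betac / relax_step betac M * M.
have BM : 0 <= 2 * betac / relax_step betac M * M.
  by rewrite mulr_ge0 ?(ltW M0)// divr_ge0 ?(ltW t0_gt0)// mulr_ge0// ltW.
have B0 : 0 <= B by rewrite addr_ge0// ltW.
have /choice[f hf] (n : nat) : exists f, [/\ fin_ent vol f,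
    `|F betac f - F betac g| <= B * n.+1%:R^-1,
    KL vol betac f (conv_density vol (kW W) f) <= B * n.+1%:R^-1 &
    exists b, has_density vol (mu_ b) f /\ ~ (TV (mu_ b) muL <= e%:E)%E].
  set dn := n.+1%:R^-1; have dn0 : 0 < dn by rewrite invr_gt0.
  (* In a window of relative width [dn] above [betac], the free energy excess at [betac] is at most
     [M * dn]. *)
  have r0 : 0 < betac * dn by rewrite mulr_gt0.
  have [//|/existsNP[b /not_implyP[/andP[b1 b2] hb]]] := hno (betac * dn).
  have [f [bf ff Ff]] := minimiser_above_le bc0 b1 muLmin muLg fg (mu_min b b1).
  have hbd : (b / betac - 1) * M <= M * dn.
    rewrite mulrC ler_wpM2l ?(ltW M0)// lerBlDl ler_pdivrMr// mulrDl mul1r.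
    by rewrite (mulrC dn) ltW.
  have gf : F betac g <= F betac f.
    rewrite -lee_fin -(free_energy_densityE mk kM betac bf ff) -ImuL.
    exact: muLmin.
  have MB : M * dn <= B * dn by rewrite ler_wpM2r ?(ltW dn0)// lerDl.
  exists f; split => //; last by exists b.
    by rewrite ger0_norm ?subr_ge0//; lra.
  apply: (@le_trans _ _ (2 * betac / relax_step betac M * (M * dn))).
    apply: (almost_minimiser_KL vol0 M0 mk kM ksym bc0 muLmin ff).
    by rewrite ImuL -EFinD lee_fin; lra.
  by rewrite mulrA ler_wpM2r ?(ltW dn0)// lerDr ltW.
have [|mu [rho [mur cmu Imu close]]] :=
  @palais_smale_rate _ _ _ W M M0 mW WM Wsym Wnet betac bc0 f (F betac g) B B0.
  by move=> n; case: (hf n).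
have mumin : minimiser W betac mu.
  by move=> nu; rewrite Imu -ImuL; exact: muLmin.
have muLr := has_density_measure_eq (uniqL mu mumin) mur.
have [n hn] := close e e0; have [_ _ _ [b [bf]]] := hf n; apply.
apply: ge_ereal_sup => _ [A mA <-].
by apply: le_trans (has_density_dist bf muLr mA) _; rewrite lee_fin.
Unshelve. all: by end_near.
Qed.

End discontinuous_transition.

Theorem corollary5p7 (R : realType) (L : {posnum R}) (d : nat)
    (W : torus L d -> R) (betac : R) :
  (0 < d)%N ->
  torus_Ck 2 W ->
  even_along_coordinates W ->
  discontinuous_transition_point W betac ->
  let P := probability (torus L d) R in
  let muL : P := uniform_measure L d in
  let I : P -> \bar R := free_energy W betac in
  (exists mubar : P, minimiser W betac mubar /\ ~ (mubar ≡μ muL)) /\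
  (forall mubar : P, minimiser W betac mubar -> ~ (mubar ≡μ muL) ->
    exists mustar : P,
      [/\ ~ (mustar ≡μ muL),
          ~ (mustar ≡μ mubar),
          metric_slope (@W2 R L d) I mustar = 0%E,
          weak_slope (@W2 R L d) I mustar = 0%E &
          I mustar = minimax_level I muL mubar]).
Proof.
move=> _ W2d ev dtp P muL I.
have [M M0 WM] := W_bounded W2d; have [K K0 WK] := W_dist_lipschitz W2d.
have mW := W_measurable W2d; have Wsym := even_sym ev; have Wnet := W_net W2d.
have [[bc0 _ muLmin _] _] := dtp.
split; first exact: exists_nontrivial_minimiser M0 mW WM Wsym Wnet _ dtp.
move=> mubar mubarmin mubarL.
have muLbar : ~ (muL ≡μ mubar) by move=> h; apply: mubarL => A mA; exact: esym (h A mA).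
have [mu [mu0 mu1 cmu Imu]] :=
  mountain_pass M0 K0 mW WM WK Wsym Wnet bc0 muLmin mubarmin muLbar.
have [x hx] := minimisers_separated (volume_gt0 (L := L)) M0 (measurable_kW mW)
  (kW_bounded WM) (kW_sym Wsym) bc0 muLmin mubarmin muLbar.
exists mu; split => //; last exact: (weak_slope_critical K0 mW WM WK Wsym bc0 cmu).
(* The metric slope lemma needs a measure whose potential differs from that of [mu] at some point.
   The two minimisers differ at [x], so at least one of them differs from [mu] there. *)
have [e|ne] := eqVneq (conv_prob (kW W) mu x) (conv_prob (kW W) muL x).
  rewrite -e in hx; exact: (metric_slope_critical K0 mW WM WK Wsym bc0 cmu hx).
exact: (metric_slope_critical K0 mW WM WK Wsym bc0 cmu ne).
Qed.
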